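(* Let $$\mathcal{B} = \left\{ \begin{bmatrix} f & 0 \\ h & \overline{g} \end{bmatrix} : f, g \in A(\mathbb{D}),\ h \in C(\mathbb{T}) \right\} \subset M_2(C(\mathbb{T})).$$ Then: (a) $\mathcal{B}$ is a unital operator algebra that is residually finite dimensional (RFD); (b) there exists a unital representation $\pi: \mathcal{B} \to B(\mathcal{H})$ on some Hilbert space $\mathcal{H}$ which is not the point SOT-limit of a net of finite dimensional representations of $\mathcal{B}$; that is, there is no net $(\pi_\lambda)$ of finite dimensional representations $\pi_\lambda: \mathcal{B} \to B(\mathcal{H})$ such that $(\pi_\lambda(b))$ converges to $\pi(b)$ in the strong operator topology for all $b \in \mathcal{B}$.
   Context: $\mathbb{D}$ is the open unit disc in $\mathbb{C}$, $\mathbb{T} = \partial\mathbb{D}$, and $A(\mathbb{D}) = \{ f \in C(\overline{\mathbb{D}}) : f|_{\mathbb{D}} \text{ is holomorphic} \}$ is the disc algebra, regarded as a subalgebra of $C(\mathbb{T})$ by restriction to $\mathbb{T}$ (maximum modulus principle). $M_2(C(\mathbb{T}))$ is the $C^*$-algebra of $2\times 2$ matrices over $C(\mathbb{T})$. An operator algebra is a norm closed (not necessarily self-adjoint) subalgebra $\mathcal{A} \subset B(\mathcal{K})$ for some Hilbert space $\mathcal{K}$ (subalgebras of $C^*$-algebras are regarded as such via a faithful $*$-representation, taken to be unital when the $C^*$-algebra is unital); it is unital if it contains the identity operator. A representation of $\mathcal{A}$ is a (not necessarily unital) completely contractive homomorphism $\pi: \mathcal{A} \to B(\mathcal{H})$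 for some Hilbert space $\mathcal{H}$; $\pi^{(n)}$ denotes entrywise application of $\pi$ to $n\times n$ matrices. $\mathcal{A}$ is RFD if for every $n \in \mathbb{N}$ and every $a \in M_n(\mathcal{A})$, $\|a\| = \sup \|\pi^{(n)}(a)\|$, where the supremum is over all representations $\pi: \mathcal{A} \to B(\mathcal{H})$ with $\dim \mathcal{H} < \infty$. A representation $\pi: \mathcal{A} \to B(\mathcal{H})$ is finite dimensional if the closed linear span of $C^*(\pi(\mathcal{A}))\mathcal{H}$ is finite dimensional (for unital $\mathcal{A}$: if $\pi(1)\mathcal{H}$ is finite dimensional; $\mathcal{H}$ itself may be infinite dimensional). *)

(* Defs.v *)
From HB Require Import structures.
From mathcomp Require Import all_boot all_order all_algebra.
From mathcomp Require Import complex.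
From mathcomp Require Import all_classical all_reals all_analysis.

Set Implicit Arguments.
Unset Strict Implicit.
Unset Printing Implicit Defensive.

Import Order.TTheory GRing.Theory Num.Theory.
Import numFieldNormedType.Exports.

Local Open Scope classical_set_scope.
Local Open Scope ring_scope.

(* Typing [R[i]] through [numClosedFieldType] is what gives it the topology
   and norm of [numFieldNormedType]. *)
Definition Cx (R : realType) : numClosedFieldType := R[i]%C.

Section HilbertSpaces.
Variable R : realType.

(* Inner products are linear in the first argument and conjugate-linear in the
   second. *)
Record hilbertSpace := HilbertSpace {
  hspace :> completeNormedModType (Cx R);
  hdot : {dot hspace for Num.conj};
  hdot_norm : forall x : hspace, hdot x x = `|x| ^+ 2 }.

(* The norm of a normed module over [Cx R] is [Cx R]-valued; [hnorm] is the
   same number, seen in [R]. *)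
Definition hnorm (H : hilbertSpace) (x : H) : R := complex.Re `|x|.

(* B(H), as a subset of the vector space of all functions H -> H. *)
Definition bounded_op (H : hilbertSpace) : set (H -> H) :=
  [set T | linear T /\ exists M : R, forall x, hnorm (T x) <= M * hnorm x].

Definition opnorm (H : hilbertSpace) (T : H -> H) : R :=
  sup [set hnorm (T x) | x in [set x : H | hnorm x <= 1]].

(* Norm of the Hilbert space H^n. *)
Definition hnormn (H : hilbertSpace) (n : nat) (x : 'I_n -> H) : R :=
  Num.sqrt (\sum_i hnorm (x i) ^+ 2).

(* Norm of M_n(B(H)) = B(H^n). *)
Definition mxopnorm (H : hilbertSpace) (n : nat) (a : 'M[H -> H]_n) : R :=
  sup [set hnormn (fun i => \sum_j a i j (x j))
      | x in [set x : 'I_n -> H | hnormn x <= 1]].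

Definition is_adjoint (H : hilbertSpace) (T T' : H -> H) : Prop :=
  forall x y, hdot H (T x) y = hdot H x (T' y).

Record operator_algebra (K : hilbertSpace) (A : set (K -> K)) : Prop := {
  opalg_bounded : A `<=` @bounded_op K;
  opalg0 : A 0;
  opalg_lin : forall (c : Cx R) a b, A a -> A b -> A (c *: a + b);
  opalg_comp : forall a b, A a -> A b -> A (a \o b);
  opalg_closed : forall T, bounded_op T ->
    (forall e : R, 0 < e -> exists2 a, A a & opnorm (T - a) < e) -> A T }.

Definition unital_operator_algebra (K : hilbertSpace) (A : set (K -> K)) :=
  operator_algebra A /\ A id.

(* A map on A is encoded as a map on all functions K -> K; its values outside
   A are irrelevant. *)
Record representation (K : hilbertSpace) (A : set (K -> K))
    (H : hilbertSpace) (pi : (K -> K) -> (H -> H)) : Prop := {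
  rep_bounded : forall a, A a -> bounded_op (pi a);
  rep_lin : forall (c : Cx R) a b, A a -> A b ->
    pi (c *: a + b) = c *: pi a + pi b;
  rep_comp : forall a b, A a -> A b -> pi (a \o b) = pi a \o pi b;
  rep_cc : forall (n : nat) (a : 'M[K -> K]_n), (forall i j, A (a i j)) ->
    mxopnorm (map_mx pi a) <= mxopnorm a }.

(* The linear span of V is finite dimensional. *)
Definition finite_dim (H : hilbertSpace) (V : set H) : Prop :=
  exists (n : nat) (e : 'I_n -> H),
    forall v, V v -> exists c : 'I_n -> Cx R, v = \sum_i c i *: e i.

(* Complete contractivity bounds the set below by [mxopnorm a], so that [sup]
   is a genuine supremum. *)
Definition RFD (K : hilbertSpace) (A : set (K -> K)) : Prop :=
  forall (n : nat) (a : 'M[K -> K]_n), (forall i j, A (a i j)) ->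
    mxopnorm a =
    sup [set r : R | exists (H : hilbertSpace) (pi : (K -> K) -> (H -> H)),
           [/\ finite_dim [set: H], representation A pi &
               r = mxopnorm (map_mx pi a)]].

Definition cstar_algebra (H : hilbertSpace) (D : set (H -> H)) : Prop :=
  operator_algebra D /\
  forall T T', D T -> bounded_op T' -> is_adjoint T T' -> D T'.

(* C*(S) *)
Definition cstar_gen (H : hilbertSpace) (S : set (H -> H)) : set (H -> H) :=
  smallest (@cstar_algebra H) S.

Definition lspan (H : hilbertSpace) (S : set H) : set H :=
  [set v | exists (n : nat) (c : 'I_n -> Cx R) (e : 'I_n -> H),
     (forall i, S (e i)) /\ v = \sum_i c i *: e i].

Definition finite_dim_rep (K : hilbertSpace) (A : set (K -> K))
    (H : hilbertSpace) (pi : (K -> K) -> (H -> H)) : Prop :=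
  representation A pi /\
  finite_dim (closure (lspan
    [set T x | T in cstar_gen (pi @` A) & x in [set: H]])).

Record directed (I : Type) (le : I -> I -> Prop) : Prop := {
  directed_inh : inhabited I;
  directed_refl : forall i, le i i;
  directed_trans : forall j i k, le i j -> le j k -> le i k;
  directed_ub : forall i j, exists k, le i k /\ le j k }.

(* The filter of eventual subsets of I. *)
Definition net_filter (I : Type) (le : I -> I -> Prop) : set_system I :=
  filter_from [set: I] (fun i => [set j | le i j]).

Definition point_SOT_cvg (K : hilbertSpace) (A : set (K -> K))
    (H : hilbertSpace) (I : Type) (le : I -> I -> Prop)
    (pil : I -> (K -> K) -> (H -> H)) (pi : (K -> K) -> (H -> H)) : Prop :=
  forall b, A b -> forall x : H, (fun i => pil i b x) @ net_filter le --> pi b x.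

End HilbertSpaces.

Section MatricesOverCT.
Variable R : realType.

Definition circle : set (Cx R) := [set z | `|z| = 1].

Definition conj_fun (f : circle -> Cx R) : circle -> Cx R := fun t => (f t)^*.

(* The ambient type of M_2(C(T)): its sum and product are those of matrices
   over the pointwise ring of functions on T. *)
Definition M2fun := 'M[circle -> Cx R]_2.

(* M_2(C(T)) *)
Definition M2CT : set M2fun := [set a | forall i j, continuous (a i j)].

Definition star_mx (a : M2fun) : M2fun := (map_mx conj_fun a)^T.

Record faithful_unital_star_rep (K : hilbertSpace R) (rho : M2fun -> (K -> K)) :
    Prop := {
  srep_bounded : forall a, M2CT a -> bounded_op (rho a);
  srep_lin : forall (c : Cx R) a b, M2CT a -> M2CT b ->
    rho ((cst c : circle -> Cx R) *: a + b) = c *: rho a + rho b;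
  srep_mul : forall a b, M2CT a -> M2CT b -> rho (a *m b) = rho a \o rho b;
  srep_star : forall a, M2CT a -> is_adjoint (rho a) (rho (star_mx a));
  srep_unital : rho 1%:M = id;
  srep_faithful : forall a b, M2CT a -> M2CT b -> rho a = rho b -> a = b }.

(* A(D); values outside the closed disc are irrelevant. Over the complex field
   [derivable f z 1] is complex differentiability at z. *)
Definition disc_algebra : set (Cx R -> Cx R) :=
  [set f | {within [set z : Cx R | `|z| <= 1], continuous f} /\
           forall z : Cx R, `|z| < 1 -> derivable f z 1].

(* A(D) as a subalgebra of C(T) *)
Definition disc_algebra_T : set (circle -> Cx R) :=
  [set (fun t : circle => f (set_val t)) | f in disc_algebra].

Definition mx2 (a b c d : circle -> Cx R) : M2fun :=
  \matrix_(i, j) if i == 0 then (if j == 0 then a else b)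
                 else (if j == 0 then c else d).

Definition calB : set M2fun :=
  [set m | exists f g h, [/\ disc_algebra_T f, disc_algebra_T g, continuous h &
                             m = mx2 f 0 h (conj_fun g)]].

End MatricesOverCT.

Arguments circle R : clear implicits.
Arguments M2CT R : clear implicits.
Arguments disc_algebra R : clear implicits.
Arguments disc_algebra_T R : clear implicits.
Arguments calB R : clear implicits.

(* Main.v *)
From HB Require Import structures.
Require Import Defs.
From mathcomp Require Import all_boot all_order all_algebra.
From mathcomp Require Import complex ring lra finmap.
From mathcomp Require Import all_classical all_reals all_analysis.
Set Implicit Arguments.
Unset Strict Implicit.
Unset Printing Implicit Defensive.

Import Order.TTheory GRing.Theory Num.Theory.
Import numFieldNormedType.Exports.

Local Open Scope classical_set_scope.
Local Open Scope ring_scope.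

(** A faithful unital representation exists because all point evaluations of
    2 x 2 matrices of continuous functions can be put together in one direct sum
    ([faithful_rep_exists]). For any such representation [rho], the norm of a
    matrix over the image of [rho] is the supremum over the points of the circle
    of the norms of its values. One inequality is [ract_le]: a crude estimate by
    the entries, applied to high powers, becomes sharp. The other one is
    [pw_bound_of_rep]: a vector built from a bump function near a point sees the
    value of the symbol at that point. So all norm questions become pointwise,
    and they do not depend on [rho].

    Residual finite dimensionality follows at once: evaluations at points are
    representations on a two dimensional space that together attain the norm
    ([rho_calB_RFD]). That the image of [calB] is closed amounts to the fact
    that the disc algebra is closed under uniform limits on the circle. The disc
    algebra is identified there with the uniform closure of the polynomials
    ([disc_algebra_TP]): Goursat's lemma in logarithmic polar coordinates gives
    the mean value property ([mean_value]), which kills the negative Fourier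
    coefficients, and then Fejer's theorem produces polynomials; conversely, a
    maximum principle for polynomials, applied to difference quotients too, makes
    uniform limits holomorphic.

    The representation that is not a limit is the compression of the symbols to
    two copies of the Hardy space, that is, the map [toep] to Toeplitz operators.
    It is completely contractive as a compression, and it is multiplicative on
    [calB] because of the triangular shape with analytic and conjugate analytic
    diagonal entries ([toepM]).

    Every finite dimensional representation [pi], on the other hand, satisfies
    an identity that is closed under pointwise strong limits: for every vector
    [x], the images of [x] under the elements with [1] and with the conjugate of
    [z] in the lower left corner, and zeros elsewhere, have the same norm
    ([finite_dim_rep_isometric]). Multiplication on the left by the conjugate of
    [z] in the lower right corner is a contraction that lowers the power of [z]
    in the lower left corner by one; in finite dimension the bounded orbit of the
    powers is recurrent, and this forces the contraction to preserve the norm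
    along it. For [toep] and the first vector of the basis the two norms are [1]
    and [0], since the conjugate of [z] has no Fourier coefficient with
    nonnegative index. *)

(** * Complex scalars and real-valued norms *)

Lemma cvg_bigsum (K : numFieldType) (V : normedModType K) (T : Type)
    (F : set_system T) {FF : Filter F} (I : Type) (r : seq I) (f : I -> T -> V)
    (l : I -> V) :
  (forall i, f i @ F --> l i) ->
  (fun x => \sum_(i <- r) f i x) @ F --> \sum_(i <- r) l i.
Proof.
move=> h; elim: r => [|i r IH].
  by under eq_fun do rewrite big_nil; rewrite big_nil; exact: cvg_cst.
under eq_fun do rewrite big_cons; rewrite big_cons.
by apply: cvgD.
Qed.

Section Scalars.
Variable R : realType.
Local Notation C := (Cx R).

Definition toC (x : R) : C := (x +i* 0)%C.

(** The real-valued norm. On a Hilbert space it is [hnorm] by computation,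
    but it also applies to scalars and to any normed module. *)
Definition rnorm (V : normedZmodType C) (x : V) : R := complex.Re `|x|.

Lemma toC1 : toC 1 = 1. Proof. by []. Qed.
Lemma toCD x y : toC (x + y) = toC x + toC y.
Proof. exact: (rmorphD (real_complex R)). Qed.
Lemma toCB x y : toC (x - y) = toC x - toC y.
Proof. exact: (rmorphB (real_complex R)). Qed.
Lemma toCM x y : toC (x * y) = toC x * toC y.
Proof. exact: (rmorphM (real_complex R)). Qed.
Lemma toCX x n : toC (x ^+ n) = toC x ^+ n.
Proof. exact: (rmorphXn (real_complex R)). Qed.
Lemma toCV x : toC x^-1 = (toC x)^-1.
Proof. exact: (fmorphV (real_complex R)). Qed.
Lemma toC_sum I (r : seq I) P (F : I -> R) :
  toC (\sum_(i <- r | P i) F i) = \sum_(i <- r | P i) toC (F i).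
Proof. exact: (rmorph_sum (real_complex R)). Qed.
Lemma toC_nat n : toC n%:R = n%:R.
Proof. exact: (rmorph_nat (real_complex R)). Qed.
Lemma toC_inj : injective toC.
Proof. by move=> x y []. Qed.
Lemma toC_le x y : (toC x <= toC y) = (x <= y). Proof. exact: lecR. Qed.
Lemma toC_lt x y : (toC x < toC y) = (x < y). Proof. exact: ltcR. Qed.
Lemma toC_gt0 x : (0 < toC x) = (0 < x). Proof. exact: ltcR. Qed.
Lemma toC_ge0 x : (0 <= toC x) = (0 <= x). Proof. exact: lecR. Qed.

Lemma Re_toC x : complex.Re (toC x) = x. Proof. by []. Qed.
Lemma Im_toC x : complex.Im (toC x) = 0. Proof. by []. Qed.
Lemma ReD (z w : C) : complex.Re (z + w) = complex.Re z + complex.Re w.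
Proof. by case: z w => [a b] [c d]. Qed.
Lemma ImD (z w : C) : complex.Im (z + w) = complex.Im z + complex.Im w.
Proof. by case: z w => [a b] [c d]. Qed.
Lemma ReN (z : C) : complex.Re (- z) = - complex.Re z.
Proof. by case: z. Qed.
Lemma ImN (z : C) : complex.Im (- z) = - complex.Im z.
Proof. by case: z. Qed.
Lemma ReM (z w : C) : complex.Re (z * w) =
  complex.Re z * complex.Re w - complex.Im z * complex.Im w.
Proof. by case: z w => [a b] [c d]. Qed.
Lemma ImM (z w : C) : complex.Im (z * w) =
  complex.Re z * complex.Im w + complex.Im z * complex.Re w.
Proof. by case: z w => [a b] [c d]. Qed.
Lemma ReJ (z : C) : complex.Re z^* = complex.Re z. Proof. by case: z. Qed.
Lemma ImJ (z : C) : complex.Im z^* = - complex.Im z. Proof. by case: z. Qed.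
Lemma toCJ (x : R) : (toC x)^* = toC x.
Proof. by rewrite /toC; apply/eqP; rewrite eq_complex /= oppr0 !eqxx. Qed.
Lemma Cx_ext (z w : C) : complex.Re z = complex.Re w ->
  complex.Im z = complex.Im w -> z = w.
Proof. by case: z w => [a b] [c d] /= -> ->. Qed.

Lemma Cx_gt0 (e : C) : 0 < e -> e = toC (complex.Re e) /\ 0 < complex.Re e.
Proof.
case: e => a b; rewrite ltcE /= => /andP[/eqP -> a0]; split => //.
Qed.
Lemma Cx_ge0 (e : C) : 0 <= e -> e = toC (complex.Re e).
Proof. by case: e => a b; rewrite lecE /= => /andP[/eqP ->]. Qed.

Section rnorm.
Variable V : normedZmodType C.
Implicit Types x y : V.

Lemma rnormE x : `|x| = toC (rnorm x). Proof. exact/Cx_ge0/normr_ge0. Qed.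
Lemma rnorm_ge0 x : 0 <= rnorm x. Proof. by rewrite -toC_ge0 -rnormE. Qed.
Lemma rnormD x y : rnorm (x + y) <= rnorm x + rnorm y.
Proof. by rewrite -toC_le toCD -!rnormE ler_normD. Qed.
Lemma rnormN x : rnorm (- x) = rnorm x. Proof. by rewrite /rnorm normrN. Qed.
Lemma rnormB x y : rnorm (x - y) <= rnorm x + rnorm y.
Proof. by rewrite -(rnormN y) rnormD. Qed.
Lemma rnormC x y : rnorm (x - y) = rnorm (y - x). Proof. by rewrite -rnormN opprB. Qed.
Lemma rnorm0 : rnorm (0 : V) = 0. Proof. by rewrite /rnorm normr0. Qed.
Lemma rnorm_eq0 x : rnorm x = 0 -> x = 0.
Proof. by move=> h; apply/normr0_eq0; rewrite rnormE h. Qed.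
Lemma rnorm_gt0 x : x != 0 -> 0 < rnorm x.
Proof. by move=> x0; rewrite -toC_gt0 -rnormE normr_gt0. Qed.
Lemma rnorm_sum I (r : seq I) P (F : I -> V) :
  rnorm (\sum_(i <- r | P i) F i) <= \sum_(i <- r | P i) rnorm (F i).
Proof.
rewrite -toC_le toC_sum -rnormE (le_trans (ler_norm_sum _ _ _))//.
by rewrite (eq_bigr _ (fun i _ => rnormE _)).
Qed.
Lemma rnorm_distD z x y : rnorm (x - y) <= rnorm (x - z) + rnorm (z - y).
Proof. by rewrite -[x - y](subrKA z) rnormD. Qed.
Lemma rnormB_ge x y : rnorm x - rnorm y <= rnorm (x - y).
Proof. by rewrite lerBlDr -{1}(subrK y x) rnormD. Qed.
Lemma rnorm_dist x y : `|rnorm x - rnorm y| <= rnorm (x - y).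
Proof.
by rewrite ler_norml rnormB_ge lerNl opprB rnormC rnormB_ge.
Qed.
End rnorm.

Lemma rnormZ (V : normedModType C) (c : C) (x : V) :
  rnorm (c *: x) = rnorm c * rnorm x.
Proof. by apply: toC_inj; rewrite toCM -!rnormE normrZ. Qed.

Section cnorm.
Implicit Types z w : C.
Lemma cnormM z w : rnorm (z * w) = rnorm z * rnorm w.
Proof. by apply: toC_inj; rewrite toCM -!rnormE normrM. Qed.
Lemma cnormX z n : rnorm (z ^+ n) = rnorm z ^+ n.
Proof. by apply: toC_inj; rewrite toCX -!rnormE normrX. Qed.
Lemma cnorm1 : rnorm (1 : C) = 1. Proof. by rewrite /rnorm normr1. Qed.
Lemma cnorm_toC x : rnorm (toC x) = `|x|.
Proof.
by rewrite /rnorm normc_def /= expr0n addr0 sqrtr_sqr.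
Qed.
Lemma cnormJ z : rnorm z^* = rnorm z. Proof. by rewrite /rnorm norm_conjC. Qed.
Lemma cnorm_sq z : rnorm z ^+ 2 = complex.Re z ^+ 2 + complex.Im z ^+ 2.
Proof. by rewrite /rnorm normc_def /= sqr_sqrtr// addr_ge0// sqr_ge0. Qed.
Lemma mulJ_cnorm z : z * z^* = toC (rnorm z ^+ 2).
Proof. by rewrite toCX -rnormE normCK. Qed.
Lemma Re_le_cnorm z : `|complex.Re z| <= rnorm z.
Proof.
rewrite -ler_sqr ?nnegrE ?rnorm_ge0// cnorm_sq real_normK ?num_real//.
by rewrite lerDl sqr_ge0.
Qed.
Lemma Im_le_cnorm z : `|complex.Im z| <= rnorm z.
Proof.
rewrite -ler_sqr ?nnegrE ?rnorm_ge0// cnorm_sq real_normK ?num_real//.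
by rewrite lerDr sqr_ge0.
Qed.
Lemma cnorm_le z : rnorm z <= `|complex.Re z| + `|complex.Im z|.
Proof.
rewrite -ler_sqr ?nnegrE ?rnorm_ge0 ?addr_ge0// cnorm_sq sqrrD.
rewrite !real_normK ?num_real// lerD2r lerDl mulrn_wge0// mulr_ge0//.
Qed.
End cnorm.

(** Convergence in a normed module over the complex numbers asks for complex
    tolerances; real ones suffice, since positive complex numbers are real. *)
Lemma rcvgP (V : normedModType C) (T : Type) (F : set_system T) {FF : Filter F}
    (f : T -> V) (l : V) :
  f @ F --> l <-> forall e : R, 0 < e -> \forall x \near F, rnorm (l - f x) < e.
Proof.
split=> [/cvgrPdist_lt h e e0|h].
  have /h : 0 < toC e by rewrite toC_gt0.
  by apply: filterS => x; rewrite rnormE toC_lt.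
apply/cvgrPdist_lt => e /Cx_gt0[-> e0]; have := h _ e0.
by apply: filterS => x; rewrite rnormE toC_lt.
Qed.

Lemma rcvg_norm (V : normedModType C) (T : Type) (F : set_system T)
    {FF : Filter F} (f : T -> V) (l : V) :
  f @ F --> l -> (fun x => rnorm (f x)) @ F --> rnorm l.
Proof.
move=> /rcvgP h; apply/cvgrPdist_lt => e /h; apply: filterS => x.
exact: le_lt_trans (rnorm_dist _ _).
Qed.

Lemma rnbhsP (V : normedModType C) (x : V) (U : set V) :
  nbhs x U <-> exists2 d : R, 0 < d & forall y, rnorm (x - y) < d -> U y.
Proof.
split=> [/nbhs_ballP[d /= /Cx_gt0[-> d0] hd]|[d d0 hd]].
  exists (complex.Re d) => // y xy.
  by apply: hd; rewrite -ball_normE /= rnormE toC_lt.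
apply/nbhs_ballP; exists (toC d); first by rewrite /= toC_gt0.
by move=> y; rewrite -ball_normE /= rnormE toC_lt => /hd.
Qed.

Lemma rcontP (V W : normedModType C) (f : V -> W) (x : V) :
  {for x, continuous f} <->
  forall e : R, 0 < e -> exists2 d : R, 0 < d &
    forall y, rnorm (x - y) < d -> rnorm (f x - f y) < e.
Proof.
split=> [/rcvgP h e e0|h]; first exact: ((rnbhsP x _).1 (h e e0)).
by apply/rcvgP => e e0; apply/rnbhsP; exact: h.
Qed.

Lemma cvg_Re (T : Type) (F : set_system T) {FF : Filter F} (f : T -> C) (l : C) :
  f @ F --> l -> (fun x => complex.Re (f x)) @ F --> complex.Re l.
Proof.
move=> /rcvgP h; apply/cvgrPdist_lt => e /h; apply: filterS => x.
by apply: le_lt_trans; rewrite -ReN -ReD Re_le_cnorm.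
Qed.
Lemma cvg_Im (T : Type) (F : set_system T) {FF : Filter F} (f : T -> C) (l : C) :
  f @ F --> l -> (fun x => complex.Im (f x)) @ F --> complex.Im l.
Proof.
move=> /rcvgP h; apply/cvgrPdist_lt => e /h; apply: filterS => x.
by apply: le_lt_trans; rewrite -ImN -ImD Im_le_cnorm.
Qed.
Lemma cvg_complex (T : Type) (F : set_system T) {FF : Filter F} (f : T -> C)
    (l : C) :
  (fun x => complex.Re (f x)) @ F --> complex.Re l ->
  (fun x => complex.Im (f x)) @ F --> complex.Im l -> f @ F --> l.
Proof.
move=> /cvgrPdist_lt h1 /cvgrPdist_lt h2; apply/rcvgP => e e0.
have e20 : 0 < e / 2 by rewrite divr_gt0.
near=> x; apply: le_lt_trans (cnorm_le _) _.
rewrite (splitr e) ReD ImD ReN ImN ltrD//.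
  by near: x; exact: h1.
by near: x; exact: h2.
Unshelve. all: by end_near. Qed.
Lemma cvg_conj (T : Type) (F : set_system T) {FF : Filter F} (f : T -> C) (l : C) :
  f @ F --> l -> (fun x => (f x)^*) @ F --> l^*.
Proof.
move=> /rcvgP h; apply/rcvgP => e /h; apply: filterS => x.
by rewrite -rmorphB cnormJ.
Qed.
Lemma cvg_toC (T : Type) (F : set_system T) {FF : Filter F} (f : T -> R) (l : R) :
  f @ F --> l -> (fun x => toC (f x)) @ F --> toC l.
Proof.
move=> h; apply: cvg_complex => //=; exact: cvg_cst.
Qed.

Lemma Cx_complete (F : set_system C) : ProperFilter F -> cauchy F -> cvg F.
Proof.
move=> FF /cauchy_ballP Fc.
have key (g : C -> R) : (forall z w, `|g z - g w| <= rnorm (z - w)) ->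
    cvg (g @ F).
  move=> hg; apply: R_complete; apply/cauchy_ballP => e e0.
  have [[A B] /= [FA FB] hAB] := Fc (toC e) (etrans (toC_gt0 e) e0).
  exists (g @` A, g @` B) => /=.
    by split; [apply: filterS FA|apply: filterS FB]; exact: preimage_image.
  move=> [_ _] /= [[z Az <-] [w Bw <-]].
  have := hAB (z, w) (conj Az Bw); rewrite -!ball_normE /= rnormE toC_lt.
  exact: le_lt_trans.
have /cvg_ex[a ha] : cvg (@complex.Re R @ F).
  by apply: key => z w; rewrite -ReN -ReD Re_le_cnorm.
have /cvg_ex[b hb] : cvg (@complex.Im R @ F).
  by apply: key => z w; rewrite -ImN -ImD Im_le_cnorm.
apply/cvg_ex; exists (a +i* b)%C.
exact: (@cvg_complex _ F _ id (a +i* b)%C).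
Qed.

Lemma compact_disc (M : R) : compact [set z : C | rnorm z <= M].
Proof.
pose f (p : R * R) : C := (p.1 +i* p.2)%C.
have fc : continuous f.
  move=> p; apply: cvg_complex => /=; [exact: cvg_fst|exact: cvg_snd].
have cS : compact (f @` (`[-M, M] `*` `[-M, M])).
  apply: continuous_compact; first exact: continuous_subspaceT.
  by apply: compact_setX; exact: segment_compact.
apply: (subclosed_compact _ cS).
  apply: (@closed_comp _ _ (@rnorm C) [set x | x <= M]); last exact: closed_le.
  by move=> z _; apply: (@rcvg_norm C _ (nbhs z) _ id); exact: cvg_id.
move=> [a b] /= zM; exists (a, b) => //=; rewrite !in_itv /= -!ler_norml.
by split; [exact: le_trans (Re_le_cnorm _) zM|exact: le_trans (Im_le_cnorm _) zM].
Qed.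

End Scalars.

(** * The Hilbert space of square summable families *)

Section FiniteCauchySchwarz.
Variable R : realType.

Lemma sum_cauchy_schwarz I (r : seq I) (a b : I -> R) :
  (forall i, 0 <= a i) -> (forall i, 0 <= b i) ->
  \sum_(i <- r) a i * b i <=
  Num.sqrt (\sum_(i <- r) a i ^+ 2) * Num.sqrt (\sum_(i <- r) b i ^+ 2).
Proof.
move=> a0 b0; elim: r => [|i r IH]; first by rewrite !big_nil sqrtr0 mulr0.
rewrite !big_cons.
set A := \sum_(j <- r) a j ^+ 2 in IH *; set B := \sum_(j <- r) b j ^+ 2 in IH *.
have A0 : 0 <= A by apply: sumr_ge0 => j _; exact: sqr_ge0.
have B0 : 0 <= B by apply: sumr_ge0 => j _; exact: sqr_ge0.
apply: (@le_trans _ _ (a i * b i + Num.sqrt A * Num.sqrt B)).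
  by rewrite lerD2l.
rewrite -[leRHS]sqrtrM ?addr_ge0 ?sqr_ge0//.
rewrite -[leLHS]ger0_norm ?addr_ge0 ?mulr_ge0 ?sqrtr_ge0//.
rewrite -sqrtr_sqr ler_sqrt ?mulr_ge0 ?addr_ge0 ?sqr_ge0//.
have := sqr_ge0 (a i * Num.sqrt B - Num.sqrt A * b i).
rewrite sqrrB sqrrD !exprMn !sqr_sqrtr// => h; move: h.
set x := a i; set y := b i; set s := Num.sqrt A; set t := Num.sqrt B; nra.
Qed.

End FiniteCauchySchwarz.

Section FinFilter.
Variable J : choiceType.
(** A limit along this filter is an unconditional sum over [J]. *)
Definition fin_filter : set_system {fset J} :=
  filter_from [set: {fset J}] (fun A => [set B | (A `<=` B)%fset]).

Global Instance fin_filter_proper : ProperFilter fin_filter.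
Proof.
apply: filter_from_proper; last by move=> A _; exists A => /=; exact: fsubset_refl.
apply: filter_from_filter; first by exists fset0.
move=> A B _ _; exists (A `|` B)%fset => // D /=.
by rewrite fsubUset => /andP[].
Qed.

Lemma fin_filter_ge (A : {fset J}) : \forall B \near fin_filter, (A `<=` B)%fset.
Proof. by exists A. Qed.

End FinFilter.
Arguments fin_filter J : clear implicits.

Section L2.
Variables (R : realType) (J : choiceType).
Local Notation C := (Cx R).
Implicit Types (x y : J -> C) (A B : {fset J}).

Definition sqs A x : R := \sum_(j <- A) rnorm (x j) ^+ 2.

Lemma sqs_ge0 A x : 0 <= sqs A x.
Proof. by apply: sumr_ge0 => j _; exact: sqr_ge0. Qed.

Lemma sqs_mono A B x : (A `<=` B)%fset -> sqs A x <= sqs B x.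
Proof.
move=> AB; have -> : B = (A `|` (B `\` A))%fset by rewrite fsetUDl fsetDv fsetD0; apply/esym/fsetUidPr.
rewrite /sqs [leRHS](perm_big (A ++ (B `\` A)%fset)) /=.
  by rewrite big_cat /= lerDl; apply: sumr_ge0 => j _; exact: sqr_ge0.
apply: uniq_perm => //.
  rewrite cat_uniq !fset_uniq /= andbT; apply/hasPn => j.
  by rewrite inE => /andP[].
by move=> j; rewrite mem_cat !inE.
Qed.

Lemma sqsU1 x j : sqs [fset j]%fset x = rnorm (x j) ^+ 2.
Proof. by rewrite /sqs big_seq_fset1. Qed.

Lemma sqrt_sqsD A x y :
  Num.sqrt (sqs A (x + y)) <= Num.sqrt (sqs A x) + Num.sqrt (sqs A y).
Proof.
rewrite -[leRHS]ger0_norm ?addr_ge0 ?sqrtr_ge0// -sqrtr_sqr.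
rewrite ler_sqrt ?sqr_ge0// sqrrD !sqr_sqrtr ?sqs_ge0//.
apply: (@le_trans _ _ (\sum_(j <- A)
   (rnorm (x j) ^+ 2 + (rnorm (x j) * rnorm (y j)) *+ 2 + rnorm (y j) ^+ 2))).
  apply: ler_sum => j _; rewrite -sqrrD ler_sqr ?nnegrE ?addr_ge0 ?rnorm_ge0//.
  exact: rnormD.
rewrite !big_split /= lerD2r lerD2l mulr2n.
by apply: lerD; apply: sum_cauchy_schwarz => j; exact: rnorm_ge0.
Qed.

Lemma sqsZ A c x : sqs A (c *: x) = rnorm c ^+ 2 * sqs A x.
Proof. by rewrite /sqs mulr_sumr; apply: eq_bigr => j _; rewrite cnormM exprMn. Qed.

Lemma sqsD_le A x y : sqs A (x + y) <= 2 * (sqs A x + sqs A y).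
Proof.
have := sqrt_sqsD A x y.
rewrite -ler_sqr ?nnegrE ?addr_ge0 ?sqrtr_ge0// sqrrD !sqr_sqrtr ?sqs_ge0//.
move=> /le_trans; apply.
have := sqr_ge0 (Num.sqrt (sqs A x) - Num.sqrt (sqs A y)).
rewrite sqrrB !sqr_sqrtr ?sqs_ge0//; lra.
Qed.

(** Boundedness of all finite partial sums is square summability over an
    arbitrary, possibly uncountable, index type. *)
Definition l2_pred : {pred J -> C} :=
  fun x => `[< exists M, forall A, sqs A x <= M >].

Lemma l2_pred_submod : submod_closed l2_pred.
Proof.
split=> [|c x y].
  apply/asboolP; exists 0 => A; rewrite /sqs big1// => j _.
  by rewrite [X in rnorm X](_ : _ = 0)// rnorm0 expr0n.
move=> /asboolP[M hM] /asboolP[N hN]; apply/asboolP.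
exists (2 * (rnorm c ^+ 2 * M + N)) => A; apply: le_trans (sqsD_le _ _ _) _.
by rewrite ler_pM2l// sqsZ lerD// ler_wpM2l// sqr_ge0.
Qed.

HB.instance Definition _ := GRing.isSubmodClosed.Build C (J -> C) l2_pred
  l2_pred_submod.

Record l2 := L2 { l2val :> J -> C; l2valP : l2val \in l2_pred }.
HB.instance Definition _ := [isSub for l2val].
HB.instance Definition _ := [Choice of l2 by <:].
HB.instance Definition _ := [SubChoice_isSubLmodule of l2 by <:].

End L2.

Section L2norm.
Variables (R : realType) (J : choiceType).
Local Notation C := (Cx R).
Local Notation l2 := (l2 R J).
Implicit Types (x y : l2) (A B : {fset J}).

Definition nsq (x : J -> C) : R := sup (range (fun A : {fset J} => sqs A x)).

Lemma sqs_le_nsq A x : sqs A x <= nsq x.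
Proof.
have /asboolP[M hM] := l2valP x.
apply: ub_le_sup; last by exists A.
by exists M => _ [B _ <-].
Qed.

Lemma nsq_le (x : J -> C) (M : R) : (forall A, sqs A x <= M) -> nsq x <= M.
Proof.
move=> h; apply: ge_sup; first by exists (sqs fset0 x); exists fset0.
by move=> _ [A _ <-].
Qed.

Lemma nsq_ge0 x : 0 <= nsq x.
Proof. exact: le_trans (sqs_ge0 fset0 x) (sqs_le_nsq _ _). Qed.

Definition l2norm x : C := toC (Num.sqrt (nsq x)).

Lemma l2normD x y : l2norm (x + y) <= l2norm x + l2norm y.
Proof.
rewrite /l2norm -toCD toC_le -[leRHS]ger0_norm ?addr_ge0 ?sqrtr_ge0//.
rewrite -sqrtr_sqr ler_sqrt ?sqr_ge0//; apply: nsq_le => A.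
rewrite -[leLHS]sqr_sqrtr ?sqs_ge0// ler_sqr ?nnegrE ?addr_ge0 ?sqrtr_ge0//.
by apply: le_trans (sqrt_sqsD _ _ _) _; apply: lerD; rewrite ler_sqrt ?nsq_ge0 ?sqs_le_nsq.
Qed.

Lemma nsqZ (c : C) x : nsq (c *: x) = rnorm c ^+ 2 * nsq x.
Proof.
have le (d : C) (y : l2) : nsq (d *: y) <= rnorm d ^+ 2 * nsq y.
  by apply: nsq_le => A; rewrite sqsZ ler_wpM2l ?sqr_ge0// sqs_le_nsq.
have [->|c0] := eqVneq c 0.
  rewrite rnorm0 expr0n mul0r; apply/eqP; rewrite eq_le nsq_ge0 andbT.
  by rewrite (le_trans (le _ _))// rnorm0 expr0n mul0r.
apply/eqP; rewrite eq_le le /=.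
rewrite -ler_pdivlMl ?exprn_gt0 ?rnorm_gt0//.
have e : c^-1 *: (c *: x) = x by rewrite scalerA mulVf// scale1r.
have := le c^-1 (c *: x); rewrite e.
suff -> : rnorm c^-1 = (rnorm c)^-1 by rewrite exprVn.
by apply: toC_inj; rewrite toCV -!rnormE normfV.
Qed.

Lemma l2normZ (c : C) x : l2norm (c *: x) = `|c| * l2norm x.
Proof.
by rewrite /l2norm nsqZ sqrtrM ?sqr_ge0// sqrtr_sqr ger0_norm ?rnorm_ge0// toCM -rnormE.
Qed.

Lemma l2norm_eq0 x : l2norm x = 0 -> x = 0.
Proof.
move=> /toC_inj/eqP; rewrite sqrtr_eq0 => h; apply: val_inj; apply/funext => j /=.
apply: rnorm_eq0; apply/eqP; rewrite -sqrf_eq0 eq_le sqr_ge0 andbT.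
by rewrite -sqsU1; apply: le_trans (sqs_le_nsq _ _) h.
Qed.

HB.instance Definition _ := Lmodule_isNormed.Build C l2 l2normD l2normZ l2norm_eq0.

Lemma l2_rnorm x : rnorm x = Num.sqrt (nsq x). Proof. by []. Qed.

Lemma l2_rnorm_sq x : rnorm x ^+ 2 = nsq x.
Proof. by rewrite l2_rnorm sqr_sqrtr// nsq_ge0. Qed.

Lemma sqs_le_norm A x : sqs A x <= rnorm x ^+ 2.
Proof. by rewrite l2_rnorm_sq sqs_le_nsq. Qed.

Lemma l2_norm_le x (M : R) : 0 <= M -> (forall A, sqs A x <= M ^+ 2) -> rnorm x <= M.
Proof.
move=> M0 h; rewrite -ler_sqr ?nnegrE ?rnorm_ge0// l2_rnorm_sq; exact: nsq_le.
Qed.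

Lemma l2_coord_le x j : rnorm (x j) <= rnorm x.
Proof.
by rewrite -ler_sqr ?nnegrE ?rnorm_ge0// -sqsU1 sqs_le_norm.
Qed.

(** The candidate limit is taken coordinatewise; a bound on all finite
    partial sums survives such a limit. *)
Lemma l2_complete (F : set_system l2) : ProperFilter F -> cauchy F -> cvg F.
Proof.
move=> FF /cauchy_ballP Fc.
have Fc' (e : R) : 0 < e ->
    \forall x \near F & y \near F, rnorm (x - y) < e.
  move=> e0; have := Fc (toC e) (etrans (toC_gt0 e) e0).
  by apply: filterS => -[x y] /=; rewrite -ball_normE /= rnormE toC_lt.
have cj (j : J) : cvg ((fun x : l2 => x j) @ F).
  apply: Cx_complete; apply/cauchy_ballP => e /Cx_gt0[-> e0].
  have [[P Q] /= [FP FQ] hPQ] := Fc' _ e0.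
  exists ((fun x : l2 => x j) @` P, (fun x : l2 => x j) @` Q) => /=.
    by split; [apply: filterS FP|apply: filterS FQ]; exact: preimage_image.
  move=> [_ _] /= [[x Px <-] [y Qy <-]]; rewrite -ball_normE /= rnormE toC_lt.
  exact: le_lt_trans (l2_coord_le (x - y) j) (hPQ (x, y) (conj Px Qy)).
pose z (j : J) : C := lim ((fun x : l2 => x j) @ F).
have key (e : R) : 0 < e -> \forall x \near F, forall A, sqs A (\val x - z) <= e ^+ 2.
  move=> e0; have := Fc' _ e0.
  move=> /nearP_dep; apply: filterS => x xy A.
  pose h (y : l2) : R := sqs A (\val x - \val y).
  have hc : h @ F --> sqs A (\val x - z).
    apply: (@cvg_bigsum R R) => j. 
    have hj : (fun y : l2 => rnorm (x j - y j)) @ F --> rnorm (x j - z j).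
      by apply: rcvg_norm; apply: cvgB; [exact: cvg_cst|exact: cj].
    exact: (cvgM hj hj).
  have he : \forall y \near F, h y <= e ^+ 2.
    apply: filterS xy => y /ltW xy; apply: le_trans (sqs_le_norm A (x - y)) _.
    by rewrite ler_sqr ?nnegrE ?rnorm_ge0// ltW.
  exact: cvgr_to_le hc he.
have [x0 hx0] := filter_ex (key 1 ltr01).
have zl2 : z \in @l2_pred R J.
  have -> : z = \val x0 - (\val x0 - z) by rewrite opprB addrC subrK.
  apply: rpredB; first exact: valP.
  by apply/asboolP; exists (1 ^+ 2).
pose zz : l2 := L2 zl2.
apply/cvg_ex; exists zz.
apply: (proj2 (@rcvgP R _ _ F _ id zz)) => e e0.
have e20 : 0 < e / 2 by rewrite divr_gt0.
have := key _ e20; apply: filterS => x hx.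
rewrite rnormC; apply: (@le_lt_trans _ _ (e / 2)).
  by apply: l2_norm_le => //; exact: ltW.
by rewrite ltr_pdivrMr// ltr_pMr// ltr1n.
Qed.

HB.instance Definition _ := Uniform_isComplete.Build l2 l2_complete.

Lemma cvg_sqs x : (fun A => sqs A x) @ fin_filter J --> nsq x.
Proof.
apply/cvgrPdist_lt => e e0.
have hs : has_sup (range (fun A : {fset J} => sqs A x)).
  split; first by exists (sqs fset0 x); exists fset0.
  by exists (nsq x) => _ [A _ <-]; exact: sqs_le_nsq.
have [_ [A _ <-] hA] := sup_adherent e0 hs.
exists A => // B /= AB; rewrite ger0_norm ?subr_ge0 ?sqs_le_nsq//.
by rewrite ltrBlDr -ltrBlDl (lt_le_trans hA)// sqs_mono.
Qed.

(** The inner product is obtained from the norm by polarisation, which makes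
    the convergence of its partial sums a consequence of that of the norm. *)
Definition l2re x y : R := (nsq (x + y) - nsq (x - y)) / 4.
Definition l2dot x y : C := (l2re x y +i* l2re x ('i *: y))%C.

Definition psum A (x y : J -> C) : C := \sum_(j <- A) x j * (y j)^*.

Lemma Re_sum I (r : seq I) (P : pred I) (f : I -> C) :
  complex.Re (\sum_(i <- r | P i) f i) = \sum_(i <- r | P i) complex.Re (f i).
Proof. by apply: (big_morph (@complex.Re R)) => //; exact: ReD. Qed.

Lemma Im_sum I (r : seq I) (P : pred I) (f : I -> C) :
  complex.Im (\sum_(i <- r | P i) f i) = \sum_(i <- r | P i) complex.Im (f i).
Proof. by apply: (big_morph (@complex.Im R)) => //; exact: ImD. Qed.

Lemma Re_psum A (x y : J -> C) :
  complex.Re (psum A x y) = (sqs A (x + y) - sqs A (x - y)) / 4.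
Proof.
rewrite /psum /sqs -sumrB mulr_suml Re_sum; apply: eq_bigr => j _.
rewrite !cnorm_sq /= [(x + y) j]/(x j + y j) [(x - y) j]/(x j - y j).
by rewrite ReM ReJ ImJ !ReD !ImD ReN ImN; field.
Qed.

Lemma Im_psum A (x y : J -> C) :
  complex.Im (psum A x y) = complex.Re (psum A x ('i *: y)).
Proof.
rewrite /psum Re_sum Im_sum; apply: eq_bigr => j _.
rewrite [('i *: y) j]/('i * y j) rmorphM /= conjCi.
rewrite mulrCA mulNr ReN ReM ImM ReJ ImJ.
rewrite -complexiE /=; ring.
Qed.

(** Polarisation holds for every finite partial sum, hence in the limit. *)
Lemma cvg_psum x y : (fun A => psum A x y) @ fin_filter J --> l2dot x y.
Proof.
have h (u v : l2) : (fun A => complex.Re (psum A u v)) @ fin_filter J --> l2re u v.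
  under eq_fun do rewrite Re_psum.
  by apply: cvgMr_tmp; apply: cvgB; exact: cvg_sqs.
apply: cvg_complex; first exact: h.
under eq_fun do rewrite Im_psum; exact: h.
Qed.

Lemma Cx_hausdorff : hausdorff_space C. Proof. exact: norm_hausdorff. Qed.

Lemma l2dot_uniq x y (l : C) : (fun A => psum A x y) @ fin_filter J --> l -> l2dot x y = l.
Proof.
by move=> h; apply: (cvg_unique Cx_hausdorff _ h); exact: cvg_psum.
Qed.

Lemma l2dotxx x : l2dot x x = toC (nsq x).
Proof.
apply: l2dot_uniq.
rewrite (_ : (fun A => _) = (fun A => toC (sqs A x))).
  by apply: cvg_toC; exact: cvg_sqs.
apply/funext => A; rewrite /psum toC_sum; apply: eq_bigr => j _; exact: mulJ_cnorm.
Qed.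

Lemma l2dot_bilinear : bilinear_for
  (GRing.Scale.Law.clone _ _ *%R _) (GRing.Scale.Law.clone _ _ (Num.conj \; *%R) _ ) l2dot.
Proof.
split=> [y c x x'|x c y y'] /=.
  apply: l2dot_uniq.
  rewrite (_ : (fun A => _) = (fun A => c * psum A x y + psum A x' y)).
    by apply: cvgD; [apply: cvgMl_tmp|]; exact: cvg_psum.
  apply/funext => A; rewrite /psum mulr_sumr -big_split; apply: eq_bigr => j _ /=.
  by rewrite mulrA -mulrDl.
apply: l2dot_uniq.
rewrite (_ : (fun A => _) = (fun A => c^* * psum A x y + psum A x y')).
  by apply: cvgD; [apply: cvgMl_tmp|]; exact: cvg_psum.
apply/funext => A; rewrite /psum mulr_sumr -big_split; apply: eq_bigr => j _ /=.
transitivity (x j * (c * y j + y' j)^*) => //.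
by rewrite rmorphD rmorphM /=; ring.
Qed.

HB.instance Definition _ := bilinear_isBilinear.Build C l2 l2 C _ _ l2dot l2dot_bilinear.

Lemma l2dot_herm x y : l2dot x y = (-1) ^+ false * (l2dot y x)^*.
Proof.
rewrite expr0 mul1r; apply: l2dot_uniq.
rewrite (_ : (fun A => _) = (fun A => (psum A y x)^*)).
  by apply: cvg_conj; exact: cvg_psum.
apply/funext => A; rewrite /psum rmorph_sum; apply: eq_bigr => j _ /=.
by rewrite rmorphM /= conjCK mulrC.
Qed.

HB.instance Definition _ := isHermitianSesquilinear.Build C l2 false Num.conj l2dot l2dot_herm.

Lemma l2dot_gt0 x : x != 0 -> 0 < l2dot x x.
Proof.
move=> x0; rewrite l2dotxx toC_gt0 -l2_rnorm_sq exprn_gt0//; exact: rnorm_gt0.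
Qed.

HB.instance Definition _ := isDotProduct.Build C l2 l2dot l2dot_gt0.

Lemma l2dot_norm x : l2dot x x = `|x| ^+ 2.
Proof. by rewrite l2dotxx -l2_rnorm_sq toCX -rnormE. Qed.

Definition l2H : hilbertSpace R := @HilbertSpace R l2 l2dot l2dot_norm.

End L2norm.

(** * Bounded operators and matrices of operators *)

Section Hilbert.
Variables (R : realType) (H : hilbertSpace R).
Local Notation C := (Cx R).
Local Notation dot := (hdot H).
Implicit Types x y : H.

Lemma hdotxx x : dot x x = toC (rnorm x ^+ 2).
Proof. by rewrite hdot_norm toCX -rnormE. Qed.

Lemma hnorm_sqD x y :
  rnorm (x + y) ^+ 2 = rnorm x ^+ 2 + rnorm y ^+ 2 + 2 * complex.Re (dot x y).
Proof.
apply: toC_inj; rewrite -hdotxx hnormD !toCD -!hdotxx expr0 mul1r; congr (_ + _).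
apply: Cx_ext; last by rewrite ImD ImJ subrr.
by rewrite ReD ReJ Re_toC mulr_natl mulr2n.
Qed.

Lemma hcauchy_schwarz x y : rnorm (dot x y) <= rnorm x * rnorm y.
Proof.
have [->|y0] := eqVneq y 0.
  by rewrite linear0r !rnorm0 mulr0.
set d := dot x y; set N := rnorm y ^+ 2.
have N0 : 0 < N by rewrite exprn_gt0// rnorm_gt0.
have : 0 <= rnorm (toC N *: x - d *: y) ^+ 2 by exact: sqr_ge0.
rewrite hnorm_sqD rnormN !rnormZ linearNr linearZr_LR /= linearZl_LR /= -/d.
rewrite cnorm_toC (gtr0_norm N0).
have -> : complex.Re (- (d^* * (toC N * d))) = - (N * rnorm d ^+ 2).
  by rewrite mulrCA [d^* * d]mulrC mulJ_cnorm -toCM ReN Re_toC.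
have -> : (N * rnorm x) ^+ 2 + (rnorm d * rnorm y) ^+ 2 + 2 * - (N * rnorm d ^+ 2)
   = N * (N * rnorm x ^+ 2 - rnorm d ^+ 2) by rewrite /N; ring.
rewrite pmulr_rge0// subr_ge0 => h.
rewrite -ler_sqr ?nnegrE ?mulr_ge0 ?rnorm_ge0//.
by rewrite exprMn mulrC.
Qed.

Section LinearMap.
Variables (V W : lmodType C) (T : V -> W).
Hypothesis lT : linear T.
Lemma lin0 : T 0 = 0.
Proof.
have := lT 1 0 0; rewrite scaler0 addr0 scale1r => /esym/(canRL (addrK _)) ->.
by rewrite subrr.
Qed.
Lemma linD u v : T (u + v) = T u + T v.
Proof. by rewrite -[u in LHS]scale1r lT scale1r. Qed.
Lemma linZ c u : T (c *: u) = c *: T u.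
Proof. by rewrite -[X in T X]addr0 lT lin0 addr0. Qed.
Lemma linN u : T (- u) = - T u.
Proof. by rewrite -scaleN1r linZ scaleN1r. Qed.
Lemma linB u v : T (u - v) = T u - T v. Proof. by rewrite linD linN. Qed.
Lemma lin_sum I (r : seq I) (F : I -> V) :
  T (\sum_(i <- r) F i) = \sum_(i <- r) T (F i).
Proof. by apply: (big_morph T linD lin0). Qed.
End LinearMap.

Lemma bounded_opE (T : H -> H) : bounded_op T ->
  exists2 M, 0 <= M & forall x, rnorm (T x) <= M * rnorm x.
Proof.
move=> [_ [M hM]]; exists `|M| => // x; apply: le_trans (hM x) _.
by rewrite ler_wpM2r ?rnorm_ge0 ?ler_norm.
Qed.

Lemma bounded_op_cvg (T : H -> H) (S : Type) (F : set_system S) {FF : Filter F}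
    (f : S -> H) (l : H) :
  bounded_op T -> f @ F --> l -> (fun s => T (f s)) @ F --> T l.
Proof.
move=> bT; have [M M0 hM] := bounded_opE bT.
move=> /rcvgP h; apply/rcvgP => e e0.
have M1 : 0 < M + 1 by rewrite ltr_wpDl.
have /h : 0 < e / (M + 1) by rewrite divr_gt0.
apply: filterS => z hz; rewrite -(linB bT.1).
apply: le_lt_trans (hM _) _.
move: hz; rewrite ltr_pdivlMr// mulrC => /(le_lt_trans _); apply.
by rewrite ler_wpM2r ?rnorm_ge0// lerDl.
Qed.

Lemma bounded_op_id : @bounded_op R H id.
Proof. by split => //; exists 1 => x; rewrite mul1r. Qed.

Lemma bounded_op_lin (c : C) (S T : H -> H) :
  bounded_op S -> bounded_op T -> bounded_op (c *: S + T).
Proof.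
move=> bS bT; have [M M0 hM] := bounded_opE bS; have [N N0 hN] := bounded_opE bT.
split=> [d x y|].
  rewrite /= -![(c *: S + T) _]/(c *: S _ + T _) bS.1 bT.1 !scalerDr !scalerA (mulrC c).
  by rewrite addrACA.
exists (rnorm c * M + N) => x; rewrite -[(c *: S + T) _]/(c *: S x + T x).
rewrite (le_trans (rnormD _ _))// mulrDl lerD// rnormZ -mulrA.
by rewrite ler_wpM2l ?rnorm_ge0.
Qed.

Lemma bounded_op_comp (S T : H -> H) :
  bounded_op S -> bounded_op T -> bounded_op (S \o T).
Proof.
move=> bS bT; have [M M0 hM] := bounded_opE bS; have [N N0 hN] := bounded_opE bT.
split=> [d x y|]; first by rewrite /= bT.1 bS.1.
exists (M * N) => x /=; apply: le_trans (hM _) _.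
by rewrite -mulrA ler_wpM2l.
Qed.

Lemma bounded_opB (S T : H -> H) :
  bounded_op S -> bounded_op T -> bounded_op (S - T).
Proof. by move=> bS bT; rewrite addrC -scaleN1r; exact: bounded_op_lin. Qed.

Lemma le_opnorm (T : H -> H) x : bounded_op T -> rnorm (T x) <= opnorm T * rnorm x.
Proof.
move=> bT; have [M M0 hM] := bounded_opE bT.
have [->|x0] := eqVneq x 0; first by rewrite (lin0 bT.1) !rnorm0 mulr0.
have n0 : 0 < rnorm x by exact: rnorm_gt0.
pose u := (toC (rnorm x)^-1) *: x.
have un : rnorm u = 1.
  by rewrite rnormZ cnorm_toC ger0_norm ?invr_ge0 ?rnorm_ge0// mulVf// gt_eqF.
have : rnorm (T u) <= opnorm T.
  apply: ub_le_sup; last by exists u => //=; rewrite /hnorm -/(rnorm u) un.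
  exists M => _ [y y1 <-]; apply: le_trans (hM _) _.
  by rewrite -[leRHS]mulr1 ler_wpM2l.
rewrite (linZ bT.1) rnormZ cnorm_toC ger0_norm ?invr_ge0 ?rnorm_ge0//.
by rewrite ler_pdivrMl// mulrC.
Qed.

Section Power.
Variable n : nat.
Implicit Types X Y : 'I_n -> H.

Definition nsum X : R := \sum_i rnorm (X i) ^+ 2.
Definition dotn X Y : C := \sum_i dot (X i) (Y i).

Lemma nsum_ge0 X : 0 <= nsum X. Proof. by apply: sumr_ge0 => i _; exact: sqr_ge0. Qed.
Lemma hnormnE X : hnormn X = Num.sqrt (nsum X). Proof. by []. Qed.
Lemma hnormn_ge0 X : 0 <= hnormn X. Proof. exact: sqrtr_ge0. Qed.
Lemma hnormn_sq X : hnormn X ^+ 2 = nsum X. Proof. by rewrite sqr_sqrtr// nsum_ge0. Qed.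
Lemma hnormn_le X c : 0 <= c -> (hnormn X <= c) = (nsum X <= c ^+ 2).
Proof. by move=> c0; rewrite -ler_sqr ?nnegrE ?hnormn_ge0// hnormn_sq. Qed.

Lemma dotnxx X : dotn X X = toC (nsum X).
Proof. by rewrite /dotn toC_sum; apply: eq_bigr => i _; rewrite hdotxx. Qed.

Lemma dotn_cauchy_schwarz X Y : rnorm (dotn X Y) <= hnormn X * hnormn Y.
Proof.
apply: le_trans (rnorm_sum _ _ _) _.
apply: (@le_trans _ _ (\sum_i rnorm (X i) * rnorm (Y i))).
  by apply: ler_sum => i _; exact: hcauchy_schwarz.
by apply: sum_cauchy_schwarz => i; exact: rnorm_ge0.
Qed.

Lemma hnormn_eq0 X : hnormn X = 0 -> forall i, X i = 0.
Proof.
move=> /eqP; rewrite sqrtr_eq0 => h i.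
have : nsum X == 0 by rewrite eq_le h nsum_ge0.
rewrite psumr_eq0; last by move=> ? _; exact: sqr_ge0.
by move=> /allP/(_ i); rewrite mem_index_enum => /(_ isT)/=; rewrite sqrf_eq0 => /eqP/rnorm_eq0.
Qed.

Lemma hnormnZ (c : C) X : hnormn (fun i => c *: X i) = rnorm c * hnormn X.
Proof.
rewrite !hnormnE -[rnorm c]ger0_norm ?rnorm_ge0// -sqrtr_sqr -sqrtrM ?sqr_ge0//.
congr Num.sqrt; rewrite /nsum mulr_sumr; apply: eq_bigr => i _.
by rewrite rnormZ exprMn.
Qed.

(** The operator on the direct sum of [n] copies of [H] whose norm is
    [mxopnorm a]. *)
Definition mxact (a : 'M[H -> H]_n) X : 'I_n -> H := fun i => \sum_j a i j (X j).

Definition bounded_mx (a : 'M[H -> H]_n) := forall i j, bounded_op (a i j).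

Lemma mxactZ a c X : bounded_mx a ->
  mxact a (fun i => c *: X i) = (fun i => c *: mxact a X i).
Proof.
move=> ba; apply/funext => i; rewrite /mxact scaler_sumr; apply: eq_bigr => j _.
by rewrite (linZ (ba i j).1).
Qed.

Lemma hnormn_coord X i : rnorm (X i) <= hnormn X.
Proof.
rewrite -ler_sqr ?nnegrE ?hnormn_ge0 ?rnorm_ge0// hnormn_sq /nsum (bigD1 i)//=.
by rewrite lerDl; apply: sumr_ge0 => j _; exact: sqr_ge0.
Qed.

Lemma mxact_bounded a : bounded_mx a ->
  exists2 M, 0 <= M & forall X, hnormn (mxact a X) <= M * hnormn X.
Proof.
move=> ba.
have /choice[M hM] (ij : 'I_n * 'I_n) : exists M, 0 <= M /\
    forall x, rnorm (a ij.1 ij.2 x) <= M * rnorm x.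
  by have [M M0 hM] := bounded_opE (ba ij.1 ij.2); exists M.
pose N := \sum_(i < n) (\sum_j M (i, j)) ^+ 2.
have N0 : 0 <= N by apply: sumr_ge0 => i _; exact: sqr_ge0.
exists (Num.sqrt N); first exact: sqrtr_ge0.
move=> X; rewrite hnormn_le ?mulr_ge0 ?sqrtr_ge0 ?hnormn_ge0// exprMn sqr_sqrtr//.
rewrite /N mulr_suml; apply: ler_sum => i _; rewrite -exprMn.
have M0 j : 0 <= M (i, j) by have [] := hM (i, j).
rewrite ler_sqr ?nnegrE ?rnorm_ge0 ?mulr_ge0 ?hnormn_ge0//; last exact: sumr_ge0.
apply: le_trans (rnorm_sum _ _ _) _; rewrite mulr_suml; apply: ler_sum => j _.
have [_ h] := hM (i, j); apply: le_trans (h _) _.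
by rewrite ler_wpM2l// hnormn_coord.
Qed.

Lemma le_mxopnorm a X : bounded_mx a -> hnormn (mxact a X) <= mxopnorm a * hnormn X.
Proof.
move=> ba; have [M M0 hM] := mxact_bounded ba.
have [X0|X0] := eqVneq (hnormn X) 0.
  by rewrite (le_trans (hM _))// X0 !mulr0.
have n0 : 0 < hnormn X by rewrite lt_neqAle eq_sym X0 hnormn_ge0.
pose c := toC (hnormn X)^-1.
have cn : rnorm c = (hnormn X)^-1 by rewrite cnorm_toC ger0_norm ?invr_ge0 ?hnormn_ge0.
have : hnormn (mxact a (fun i => c *: X i)) <= mxopnorm a.
  apply: ub_le_sup; last first.
    by exists (fun i => c *: X i) => //=; rewrite hnormnZ cn mulVf.
  exists M => _ [Y Y1 <-]; apply: le_trans (hM _) _.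
  by rewrite -[leRHS]mulr1 ler_wpM2l.
by rewrite mxactZ// hnormnZ cn ler_pdivrMl// mulrC.
Qed.

Lemma mxopnorm_le a c : 0 <= c -> (forall X, hnormn (mxact a X) <= c * hnormn X) ->
  mxopnorm a <= c.
Proof.
move=> c0 h; apply: ge_sup.
  exists (hnormn (mxact a (fun=> 0))), (fun=> 0) => //=.
  by rewrite hnormn_le// /nsum big1 ?expr1n// => i _; rewrite rnorm0 expr0n.
by move=> _ [X X1 <-]; apply: le_trans (h X) _; rewrite -[leRHS]mulr1 ler_wpM2l.
Qed.

Lemma mxopnorm_ge0 a : bounded_mx a -> 0 <= mxopnorm a.
Proof.
move=> ba; have [M M0 hM] := mxact_bounded ba.
apply: le_trans (hnormn_ge0 (mxact a (fun=> 0))) _.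
apply: ub_le_sup; last first.
  exists (fun=> 0) => //=.
  by rewrite hnormn_le// /nsum big1 ?expr1n// => i _; rewrite rnorm0 expr0n.
exists M => _ [Y Y1 <-]; apply: le_trans (hM _) _.
by rewrite -[leRHS]mulr1 ler_wpM2l.
Qed.

End Power.
End Hilbert.

(** * Continuous functions and symbols on the circle *)

Section ContinuousFunctions.
Variables (R : realType) (X : topologicalType).
Local Notation C := (Cx R).
Implicit Types (u v : X -> C).

Lemma cont_cst (c : C) : continuous (cst c : X -> C).
Proof. by move=> t; exact: cvg_cst. Qed.
Lemma cont0 : continuous (0 : X -> C). Proof. by move=> t; exact: cvg_cst. Qed.
Lemma cont1 : continuous (1 : X -> C). Proof. by move=> t; exact: cvg_cst. Qed.
Lemma contD u v : continuous u -> continuous v -> continuous (u + v).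
Proof. by move=> cu cv t; exact: (cvgD (cu t) (cv t)). Qed.
Lemma contM u v : continuous u -> continuous v -> continuous (u * v).
Proof. by move=> cu cv t; exact: (cvgM (cu t) (cv t)). Qed.
Lemma contN u : continuous u -> continuous (- u).
Proof. by move=> cu t; exact: (cvgN (cu t)). Qed.
Lemma contB u v : continuous u -> continuous v -> continuous (u - v).
Proof. by move=> cu cv; exact: (contD cu (contN cv)). Qed.
Lemma cont_sum I (r : seq I) (F : I -> X -> C) :
  (forall i, continuous (F i)) -> continuous (\sum_(i <- r) F i).
Proof.
move=> cF; elim: r => [|i r IH]; first by rewrite big_nil; exact: cont0.
by rewrite big_cons; exact: (contD (cF i) IH).
Qed.
Lemma cont_sum_fun I (r : seq I) (F : I -> X -> C) :
  (forall i, continuous (F i)) -> continuous (fun t => \sum_(i <- r) F i t).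
Proof. by move=> cF t; apply: (@cvg_bigsum C C) => i; exact: cF. Qed.
Lemma contD_fun u v : continuous u -> continuous v -> continuous (fun t => u t + v t).
Proof. exact: contD. Qed.
Lemma contB_fun u v : continuous u -> continuous v -> continuous (fun t => u t - v t).
Proof. exact: contB. Qed.
Lemma contM_fun u v : continuous u -> continuous v -> continuous (fun t => u t * v t).
Proof. exact: contM. Qed.
Lemma cont_cst_fun (c : C) : continuous (fun _ : X => c).
Proof. exact: cont_cst. Qed.
Lemma cont_toC (g : X -> R) : continuous g -> continuous (fun t => toC (g t)).
Proof. by move=> cg t; exact: (cvg_toC (cg t)). Qed.
Lemma cnorm_cont u : continuous u -> continuous (fun t => rnorm (u t)).
Proof. by move=> cu t; exact: (rcvg_norm (cu t)). Qed.

Section RealValued.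
Implicit Types (g h : X -> R).
Lemma rcont_cst (c : R) : continuous (fun _ : X => c).
Proof. by move=> t; exact: cvg_cst. Qed.
Lemma rcontD g h : continuous g -> continuous h -> continuous (fun t => g t + h t).
Proof. by move=> cg ch t; exact: (cvgD (cg t) (ch t)). Qed.
Lemma rcontB g h : continuous g -> continuous h -> continuous (fun t => g t - h t).
Proof. by move=> cg ch t; exact: (cvgB (cg t) (ch t)). Qed.
Lemma rcontM g h : continuous g -> continuous h -> continuous (fun t => g t * h t).
Proof. by move=> cg ch t; exact: (cvgM (cg t) (ch t)). Qed.
Lemma rcont_max g h : continuous g -> continuous h -> continuous (fun t => Num.max (g t) (h t)).
Proof. by move=> cg ch t; exact: (continuous_max (cg t) (ch t)). Qed.
Lemma rcont_sum I (r : seq I) (F : I -> X -> R) :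
  (forall i, continuous (F i)) -> continuous (fun t => \sum_(i <- r) F i t).
Proof. by move=> cF t; apply: (@cvg_bigsum R R) => i; exact: cF. Qed.
Lemma rcont_norm_sq (u : X -> C) : continuous u -> continuous (fun t => rnorm (u t) ^+ 2).
Proof. by move=> cu; apply: rcontM; exact: cnorm_cont. Qed.
End RealValued.

End ContinuousFunctions.

Section StarAlgebra.
Variable R : realType.
Local Notation C := (Cx R).
Local Notation CT := (circle R -> C).
Implicit Types (a b : M2fun R) (u v f : CT).

Lemma cont_conj f : continuous f -> continuous (conj_fun f).
Proof. by move=> cf t; exact: (cvg_conj (cf t)). Qed.

Lemma M2CT0 : M2CT R 0. Proof. by move=> i j; rewrite mxE; exact: cont0. Qed.
Lemma M2CTD a b : M2CT R a -> M2CT R b -> M2CT R (a + b).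
Proof. by move=> ca cb i j; rewrite mxE; exact: (contD (ca i j) (cb i j)). Qed.
Lemma M2CTZ f a : continuous f -> M2CT R a -> M2CT R (f *: a).
Proof. by move=> cf ca i j; rewrite mxE; exact: (contM cf (ca i j)). Qed.
Lemma M2CTN a : M2CT R a -> M2CT R (- a).
Proof. by move=> ca i j; rewrite mxE; exact: (contN (ca i j)). Qed.
Lemma M2CTB a b : M2CT R a -> M2CT R b -> M2CT R (a - b).
Proof. by move=> ca cb; exact: (M2CTD ca (M2CTN cb)). Qed.
Lemma M2CTM a b : M2CT R a -> M2CT R b -> M2CT R (a *m b).
Proof. by move=> ca cb i j; rewrite mxE; apply: cont_sum => k; exact: (contM (ca i k) (cb k j)). Qed.
(** The matrix unit with a function in place of the scalar [1]. *)
Definition funit f (i j : 'I_2) : M2fun R :=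
  \matrix_(k, l) (if (k == i) && (l == j) then f else 0).
Lemma M2CT_funit f i j : continuous f -> M2CT R (funit f i j).
Proof. by move=> cf k l; rewrite mxE; case: ifP => _; [exact: cf|exact: cont0]. Qed.
Lemma M2CT1 : M2CT R 1%:M.
Proof. by move=> i j; rewrite mxE; case: eqP => _; [exact: cont1|exact: cont0]. Qed.
Lemma M2CT_star a : M2CT R a -> M2CT R (star_mx a).
Proof. by move=> ca i j; rewrite !mxE; exact: (cont_conj (ca j i)). Qed.
Lemma M2CT_sum I (r : seq I) (F : I -> M2fun R) :
  (forall i, M2CT R (F i)) -> M2CT R (\sum_(i <- r) F i).
Proof.
move=> cF; elim: r => [|i r IH]; first by rewrite big_nil; exact: M2CT0.
by rewrite big_cons; exact: (M2CTD (cF i) IH).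
Qed.

Lemma star_mxE a i j t : star_mx a i j t = (a j i t)^*.
Proof. by rewrite !mxE. Qed.

Lemma M2_ext a b : (forall i j t, a i j t = b i j t) -> a = b.
Proof. by move=> h; apply/matrixP => i j; apply/funext => t. Qed.

Lemma mulmxEt a b i j t : (a *m b) i j t = \sum_k a i k t * b k j t.
Proof. by rewrite mxE fct_sumE. Qed.

Lemma addmxEt a b i j t : (a + b) i j t = a i j t + b i j t.
Proof. by rewrite mxE. Qed.

Lemma star_mxM a b : star_mx (a *m b) = star_mx b *m star_mx a.
Proof.
apply: M2_ext => i j t; rewrite star_mxE !mulmxEt rmorph_sum; apply: eq_bigr => k _.
by rewrite !star_mxE rmorphM mulrC.
Qed.

Lemma star_mxD a b : star_mx (a + b) = star_mx a + star_mx b.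
Proof.
by apply: M2_ext => i j t; rewrite star_mxE !addmxEt !star_mxE rmorphD.
Qed.

Lemma star_mx0 : star_mx 0 = 0 :> M2fun R.
Proof. by apply: M2_ext => i j t; rewrite star_mxE !mxE rmorph0. Qed.

Lemma star_mx_sum I (r : seq I) (F : I -> M2fun R) :
  star_mx (\sum_(i <- r) F i) = \sum_(i <- r) star_mx (F i).
Proof. by apply: (big_morph _ star_mxD star_mx0). Qed.

Lemma star_mxK a : star_mx (star_mx a) = a.
Proof. by apply: M2_ext => i j t; rewrite !star_mxE conjCK. Qed.

Lemma funitEt f i j k l t :
  funit f i j k l t = if (k == i) && (l == j) then f t else 0.
Proof. by rewrite mxE; case: ifP. Qed.

Lemma funitM f g i j k : funit f i j *m funit g j k = funit (f * g) i k.
Proof.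
apply: M2_ext => p q t; rewrite mulmxEt (bigD1 j)//= big1 ?addr0; last first.
  by move=> l lj; rewrite !funitEt (negbTE lj) andbF mul0r.
rewrite !funitEt eqxx andbT /=.
by case: (p == i); case: (q == k); rewrite ?mul0r ?mulr0.
Qed.

Lemma star_funit f i j : star_mx (funit f i j) = funit (conj_fun f) j i.
Proof.
apply: M2_ext => p q t; rewrite star_mxE !funitEt andbC.
by case: (_ && _); rewrite ?rmorph0.
Qed.

Lemma funitB f g i j : funit (f - g) i j = funit f i j - funit g i j.
Proof.
by apply/matrixP => k l; rewrite !mxE; case: ifP; rewrite ?subr0.
Qed.

Lemma funitD f g i j : funit (f + g) i j = funit f i j + funit g i j.
Proof.
by apply/matrixP => k l; rewrite !mxE; case: ifP; rewrite ?addr0.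
Qed.

Lemma funitZ (c : C) f i j : (cst c : CT) *: funit f i j = funit ((cst c : CT) * f) i j.
Proof.
by apply/matrixP => k l; rewrite !mxE; case: ifP; rewrite ?mulr0.
Qed.

Lemma M2_decomp a : a = \sum_i \sum_j funit (a i j) i j.
Proof.
apply/matrixP => k l; rewrite summxE (bigD1 k)//= summxE (bigD1 l)//= mxE !eqxx /=.
rewrite !big1 ?addr0// => [i ik|j jl].
  by rewrite summxE big1// => j _; rewrite mxE eq_sym (negbTE ik).
by rewrite mxE eqxx eq_sym (negbTE jl).
Qed.

(** Evaluation at a point is such a map, though not a faithful one; the
    estimates for this class apply both to the given representation and to
    evaluations. *)
Record star_rep (K : hilbertSpace R) (rho : M2fun R -> (K -> K)) : Prop := {
  star_rep_bounded : forall a, M2CT R a -> bounded_op (rho a);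
  star_rep_lin : forall (c : C) a b, M2CT R a -> M2CT R b ->
    rho ((cst c : CT) *: a + b) = c *: rho a + rho b;
  star_rep_mul : forall a b, M2CT R a -> M2CT R b ->
    rho (a *m b) = rho a \o rho b;
  star_rep_star : forall a, M2CT R a -> is_adjoint (rho a) (rho (star_mx a));
  star_rep_unital : rho 1%:M = id }.

Lemma faithful_star_rep (K : hilbertSpace R) (rho : M2fun R -> (K -> K)) :
  faithful_unital_star_rep rho -> star_rep rho.
Proof. by case=> *; constructor. Qed.

Lemma cst_scale1 (a : M2fun R) : (cst 1 : CT) *: a = a. Proof. exact: scale1r. Qed.

Section StarRep.
Variables (K : hilbertSpace R) (rho : M2fun R -> (K -> K)).
Hypothesis rhoP : star_rep rho.
Local Notation dot := (hdot K).

Lemma srep0 : rho 0 = 0.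
Proof.
have := star_rep_lin rhoP 1 M2CT0 M2CT0; rewrite cst_scale1 addr0 scale1r.
by move=> /esym/(canRL (addrK _)) ->; rewrite subrr.
Qed.

Lemma srepD a b : M2CT R a -> M2CT R b -> rho (a + b) = rho a + rho b.
Proof. by move=> ca cb; rewrite -[in LHS](cst_scale1 a) (star_rep_lin rhoP _ ca cb) scale1r. Qed.

Lemma srepZ c a : M2CT R a -> rho ((cst c : CT) *: a) = c *: rho a.
Proof. by move=> ca; rewrite -[X in rho X]addr0 (star_rep_lin rhoP _ ca M2CT0) srep0 addr0. Qed.

Lemma srepN a : M2CT R a -> rho (- a) = - rho a.
Proof.
move=> ca; rewrite -scaleN1r -[X in X *: _](_ : cst (-1) = _)//.
by rewrite (srepZ _ ca) scaleN1r.
Qed.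

Lemma srepB a b : M2CT R a -> M2CT R b -> rho (a - b) = rho a - rho b.
Proof. by move=> ca cb; rewrite (srepD ca (M2CTN cb)) (srepN cb). Qed.

Lemma srep_sum I (r : seq I) (F : I -> M2fun R) : (forall i, M2CT R (F i)) ->
  rho (\sum_(i <- r) F i) = \sum_(i <- r) rho (F i).
Proof.
move=> cF; elim: r => [|i r IH]; first by rewrite !big_nil srep0.
by rewrite !big_cons (srepD (cF i) (@M2CT_sum _ r _ cF)) IH.
Qed.

Lemma srep_dot a b x y : M2CT R a -> M2CT R b ->
  dot (rho a x) (rho b y) = dot x (rho (star_mx a *m b) y).
Proof.
by move=> ca cb; rewrite (star_rep_star rhoP ca) (star_rep_mul rhoP (M2CT_star ca) cb).
Qed.

(** If [|u1| <= |u2|] then [|u2|^2 - |u1|^2] is the square of a continuous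
    function, so its image is a positive operator. *)
Lemma srep_unit_le u1 u2 i k j x : continuous u1 -> continuous u2 ->
  (forall t, rnorm (u1 t) <= rnorm (u2 t)) ->
  rnorm (rho (funit u1 i j) x) <= rnorm (rho (funit u2 k j) x).
Proof.
move=> cu1 cu2 h.
have normE (v : CT) l : continuous v -> rnorm (rho (funit v l j) x) ^+ 2 =
    complex.Re (dot x (rho (funit (conj_fun v * v) j j) x)).
  move=> cv; have cfv := @M2CT_funit v l j cv; rewrite -[LHS]Re_toC -hdotxx (srep_dot _ _ cfv cfv).
  by rewrite star_funit funitM.
pose w : CT := fun t => toC (Num.sqrt (rnorm (u2 t) ^+ 2 - rnorm (u1 t) ^+ 2)).
have cw : continuous w.
  apply: cont_toC => t.
  apply: (@continuous_comp _ _ _ (fun t => rnorm (u2 t) ^+ 2 - rnorm (u1 t) ^+ 2)).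
    have n2 := @cnorm_cont _ _ _ cu2 t; have n1 := @cnorm_cont _ _ _ cu1 t.
    exact: (cvgB (cvgM n2 n2) (cvgM n1 n1)).
  exact: sqrt_continuous.
rewrite -ler_sqr ?nnegrE ?rnorm_ge0// !normE// -subr_ge0 -ReN -ReD -linearNr -linearDr.
suff -> : rho (funit (conj_fun u2 * u2) j j) x - rho (funit (conj_fun u1 * u1) j j) x
    = rho (funit (conj_fun w * w) j j) x.
  by rewrite -(normE w j)// sqr_ge0.
have cc (v : CT) : continuous v -> M2CT R (funit (conj_fun v * v) j j).
  by move=> cv; exact: (M2CT_funit (contM (cont_conj cv) cv)).
transitivity ((rho (funit (conj_fun u2 * u2) j j) -
   rho (funit (conj_fun u1 * u1) j j)) x) => //.
rewrite -(srepB (cc _ cu2) (cc _ cu1)) -funitB; congr (rho (funit _ _ _) x).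
apply/funext => t.
transitivity (toC (rnorm (u2 t) ^+ 2) - toC (rnorm (u1 t) ^+ 2)).
  by rewrite -!mulJ_cnorm ![_ * _^*]mulrC.
rewrite -toCB; transitivity (toC (rnorm (w t) ^+ 2)); last by rewrite -mulJ_cnorm mulrC.
rewrite cnorm_toC ger0_norm ?sqrtr_ge0// sqr_sqrtr//.
by rewrite subr_ge0 ler_sqr ?nnegrE ?rnorm_ge0.
Qed.

(** Compare with the constant function [c], whose image acts as [c] times a
    projection. *)
Lemma srep_unit_bound u i j x (c : R) : 0 <= c -> continuous u ->
  (forall t, rnorm (u t) <= c) -> rnorm (rho (funit u i j) x) <= c * rnorm x.
Proof.
move=> c0 cu uc; pose v : CT := cst (toC c).
have cv : continuous v by exact: cont_cst.
apply: (@le_trans _ _ (rnorm (rho (funit v j j) x))).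
  by apply: srep_unit_le => // t; rewrite cnorm_toC ger0_norm.
have cu1 : M2CT R (funit 1 j j) by apply: M2CT_funit; exact: cont1.
have -> : rho (funit v j j) x = toC c *: rho (funit 1 j j) x.
  have e : funit v j j = (v *: funit 1 j j) by rewrite funitZ mulr1.
  by rewrite e (srepZ _ cu1).
rewrite rnormZ cnorm_toC ger0_norm// ler_wpM2l//.
set y := rho _ x.
have : rnorm y ^+ 2 <= rnorm y * rnorm x.
  have e : star_mx (funit 1 j j) *m funit 1 j j = funit 1 j j :> M2fun R.
    rewrite star_funit funitM; congr (funit _ j j).
    by apply/funext => t; rewrite mulr1 /conj_fun rmorph1.
  rewrite -[leLHS]Re_toC -hdotxx /y (srep_dot _ _ cu1 cu1) e.
  apply: le_trans (ler_norm _) _; apply: le_trans (Re_le_cnorm _) _.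
  by apply: le_trans (hcauchy_schwarz _ _) _; rewrite mulrC.
have [->|y0] := eqVneq y 0; first by rewrite rnorm0 rnorm_ge0.
by rewrite expr2 ler_pM2l// rnorm_gt0.
Qed.

(** Bound the four entries separately; the resulting constant is not
    optimal. *)
Lemma srep_entry_bound a x (c : R) : 0 <= c -> M2CT R a ->
  (forall i j t, rnorm (a i j t) <= c) -> rnorm (rho a x) <= 4 * c * rnorm x.
Proof.
move=> c0 ca h; rewrite [a in leLHS]M2_decomp.
have cij i j : M2CT R (funit (a i j) i j) by apply: M2CT_funit; exact: ca.
have cs i : M2CT R (\sum_j funit (a i j) i j) by apply: M2CT_sum => j; exact: cij.
rewrite (srep_sum _ cs) fct_sumE.
apply: le_trans (rnorm_sum _ _ _) _.
apply: (@le_trans _ _ (\sum_(i < 2) 2 * (c * rnorm x))).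
  apply: ler_sum => i _; rewrite (srep_sum _ (cij i)) fct_sumE.
  apply: le_trans (rnorm_sum _ _ _) _.
  apply: (@le_trans _ _ (\sum_(j < 2) c * rnorm x)).
    apply: ler_sum => j _; apply: srep_unit_bound => //; exact: ca.
  by rewrite sumr_const card_ord mulr_natl.
by rewrite sumr_const card_ord -mulr_natl; lra.
Qed.

End StarRep.
End StarAlgebra.

(** * The circle as a compact space *)

Section Circle.
Variable R : realType.
Local Notation C := (Cx R).
Local Notation CT := (circle R -> C).

Lemma circle_norm (t : circle R) : rnorm (set_val t) = 1.
Proof. by have := set_mem (valP t); rewrite /circle /= /rnorm set_valE => ->. Qed.

Definition circle_pt (z : C) (h : rnorm z = 1) : circle R :=
  exist _ z (mem_set (etrans (rnormE z) (congr1 (@toC R) h))).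

Lemma circle_ptE z (h : rnorm z = 1) : set_val (circle_pt h) = z.
Proof. by rewrite set_valE. Qed.

Lemma circle_nbhs (t : circle R) (U : set (circle R)) :
  nbhs t U <-> exists2 d : R, 0 < d &
    forall s, rnorm (set_val t - set_val s) < d -> U s.
Proof.
split=> [[_ [[W oW <-] /= Wt WU]]|[d d0 h]].
  have /nbhs_ballP[e /= /Cx_gt0[ee e0] he] := open_nbhs_nbhs (conj oW Wt).
  rewrite ee in he.
  exists (complex.Re e) => // s ts; apply: WU; apply: he.
  by rewrite -ball_normE /= rnormE toC_lt.
have : nbhs (set_val t) (ball (set_val t) (toC d)).
  by apply: nbhsx_ballx; rewrite toC_gt0.
rewrite nbhsE => -[W [oW Wt] hW].
exists (set_val @^-1` W); split => //=; first by exists W.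
by move=> s /= /hW; rewrite -ball_normE /= rnormE toC_lt => /h.
Qed.

Lemma circle_contP (u : CT) (t : circle R) :
  {for t, continuous u} <-> forall e : R, 0 < e -> exists2 d : R, 0 < d &
    forall s, rnorm (set_val t - set_val s) < d -> rnorm (u t - u s) < e.
Proof.
split=> [/rcvgP h e e0|h]; first exact: ((circle_nbhs t _).1 (h e e0)).
apply: (proj2 (@rcvgP R _ _ (nbhs t) _ u (u t))) => e /h hd.
exact: ((circle_nbhs t _).2 hd).
Qed.

Lemma circle_val_cont : continuous (set_val : circle R -> C).
Proof. by move=> t; apply/circle_contP => e e0; exists e. Qed.

Lemma circle_compact : compact [set: circle R].
Proof.
have cc : compact (circle R).
  apply: (subclosed_compact _ (@compact_disc R 1)).
    have -> : circle R = (@rnorm R C) @^-1` [set x | x = 1].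
      apply/seteqP; split => z /=; rewrite /circle /= => h; first by rewrite /rnorm h.
      by rewrite rnormE h.
    apply: (@closed_comp _ _ (@rnorm R C) [set x | x = 1]); last exact: closed_eq.
    by move=> z _; exact: (@rcvg_norm R C _ (nbhs z) _ id z cvg_id).
  by move=> z; rewrite /circle /= => h; rewrite /rnorm h.
move=> F FF _.
have GF : ProperFilter (set_val @ F) by exact: fmap_proper_filter.
have [|z [cz hz]] := cc (set_val @ F) GF.
  by apply: (@filterE _ F) => s; exact: set_mem (valP s).
exists (exist _ z (mem_set cz)); split => // A B FA [_ [[W oW <-] /= Wz WB]].
have [|_ [[s As <-] Ws]] := hz (set_val @` A) W _ (open_nbhs_nbhs (conj oW Wz)).
  by apply: (@filterS _ F _ A) FA => s As; exists s.
by exists s; split => //; exact: WB.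
Qed.

Lemma circle_bounded (u : CT) : continuous u ->
  exists2 c : R, 0 <= c & forall t, rnorm (u t) <= c.
Proof.
move=> cu.
have : compact ((fun t => rnorm (u t)) @` [set: circle R]).
  apply: continuous_compact; last exact: circle_compact.
  by apply: continuous_subspaceT; exact: cnorm_cont.
move=> /compact_bounded[M [_ hM]]; exists (`|M| + 1); first by rewrite addr_ge0.
move=> t; rewrite -[leLHS]ger0_norm ?rnorm_ge0//; apply: hM; last by exists t.
by rewrite ltr_pwDr// ler_norm.
Qed.

(** Uniform continuity, from compactness. *)
Lemma circle_unif (u : CT) : continuous u -> forall e : R, 0 < e ->
  exists2 d : R, 0 < d & forall t s : circle R,
    rnorm (set_val t - set_val s) < d -> rnorm (u t - u s) < e.
Proof.
move=> cu e e0.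
have e20 : 0 < e / 2 by rewrite divr_gt0.
pose P (d : R) (t : circle R) := forall s,
  rnorm (set_val t - set_val s) < d -> rnorm (u t - u s) < e.
have /compact_near_coveringP/(_ _ (0^'+)%R P) := circle_compact.
case=> [t _|d /= d0 h].
  have [d d0 hd] := (circle_contP u t).1 (cu t) _ e20.
  have d20 : 0 < d / 2 by rewrite divr_gt0.
  exists ([set t' | rnorm (set_val t - set_val t') < d / 2], [set x | 0 < x < d / 2]).
    split => /=; first by apply/circle_nbhs; exists (d / 2).
    by exists (d / 2) => //= x; rewrite /= sub0r normrN => xd x0; rewrite x0 -(gtr0_norm x0).
  move=> [t' x] /= [tt' /andP[x0 xd]] s ts.
  rewrite (splitr e) (le_lt_trans (rnorm_distD (u t) _ _))// ltrD//.
    by rewrite rnormC hd// (lt_le_trans tt')// ler_pdivrMr// ler_pMr// ler1n.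
  apply: hd; rewrite (le_lt_trans (rnorm_distD (set_val t') _ _))//.
  by rewrite (splitr d) ltrD// (lt_trans ts).
exists (d / 2) => [|t s ts]; first by rewrite divr_gt0.
by apply: (h (d / 2)) => //=; rewrite ?divr_gt0// sub0r normrN gtr0_norm ?divr_gt0// ltr_pdivrMr// ltr_pMr// ltr1n.
Qed.

End Circle.

(** * Point evaluations and the existence of faithful representations *)

Section L2basis.
Variables (R : realType) (J : choiceType).
Local Notation C := (Cx R).
Local Notation l2 := (l2 R J).
Implicit Types (x y : l2) (A B : {fset J}).

Lemma l2_predP (f : J -> C) (M : R) : (forall A, sqs A f <= M) -> f \in @l2_pred R J.
Proof. by move=> h; apply/asboolP; exists M. Qed.

Lemma l2_ext x y : (forall j, x j = y j) -> x = y.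
Proof. by move=> h; apply: val_inj; apply/funext. Qed.

Lemma l2_sumE I (r : seq I) (F : I -> l2) j :
  (\sum_(i <- r) F i : l2) j = \sum_(i <- r) F i j.
Proof. by elim: r => [|i r IH]; rewrite ?big_nil ?big_cons //= -IH. Qed.

Lemma sqs_delta A (j : J) : sqs A (fun i => if i == j then 1 else 0 : C) <= 1.
Proof.
rewrite /sqs; have [jA|jA] := boolP (j \in A); last first.
  rewrite big_seq big1// => i iA.
  by case: eqVneq => [ij|_]; [rewrite ij (negbTE jA) in iA|rewrite rnorm0 expr0n].
rewrite (bigD1_seq j)//= eqxx cnorm1 expr1n big1 ?addr0// => i ij.
by rewrite (negbTE ij) rnorm0 expr0n.
Qed.

Definition ldelta (j : J) : l2 := L2 (l2_predP (sqs_delta ^~ j)).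

Lemma ldeltaE j i : ldelta j i = if i == j then 1 else 0.
Proof. by []. Qed.

Lemma ldelta_sumE A (c : J -> C) i :
  (\sum_(j <- A) c j *: ldelta j) i = if i \in A then c i else 0.
Proof.
rewrite l2_sumE.
transitivity (\sum_(j <- A) c j * (if i == j then 1 else 0)) => //.
case: ifPn => iA.
  rewrite (bigD1_seq i)//= eqxx mulr1 big1 ?addr0// => j ji.
  by rewrite eq_sym (negbTE ji) mulr0.
rewrite big_seq big1// => j jA /=.
by case: eqVneq => [ij|_]; [rewrite ij jA in iA|rewrite mulr0].
Qed.

Lemma l2_expand x : (fun A => \sum_(j <- A) x j *: ldelta j) @ fin_filter J --> x.
Proof.
apply/rcvgP => e e0.
have e20 : 0 < e / 2 by rewrite divr_gt0.
have /cvgrPdist_lt/(_ ((e / 2) ^+ 2)) := @cvg_sqs R J x.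
rewrite exprn_gt0// => /(_ isT); apply: filterS => A hA.
apply: (@le_lt_trans _ _ (e / 2)); last by rewrite ltr_pdivrMr// ltr_pMr// ltr1n.
apply: l2_norm_le; first exact: ltW.
move=> B; apply: le_trans (ltW hA).
apply: le_trans (ler_norm _); rewrite lerBrDr.
apply: le_trans (sqs_le_nsq (A `|` B)%fset x).
pose z : l2 := x - \sum_(j <- A) x j *: ldelta j.
have zE : \val z = (fun i => if i \in A then 0 else x i).
  apply/funext => i; transitivity (x i - (\sum_(j <- A) x j *: ldelta j : l2) i) => //.
  by rewrite ldelta_sumE; case: ifP; rewrite ?subrr ?subr0.
rewrite -[X in sqs B X]/(\val z) zE; set w := (X in sqs B X).
apply: le_trans (_ : sqs (A `|` B)%fset w + sqs A x <= _).
  by rewrite lerD2r sqs_mono// fsubsetUr.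
have -> : sqs A x = \sum_(i <- (A `|` B)%fset) if i \in A then rnorm (x i) ^+ 2 else 0.
  have -> : (A `|` B)%fset = (A `|` (B `\` A))%fset.
    by apply/fsetP => i; rewrite !inE; case: (i \in A).
  rewrite [RHS](perm_big (A ++ (B `\` A)%fset)) /=; last first.
    apply: uniq_perm => [//||i]; last by rewrite mem_cat !inE.
    rewrite cat_uniq !fset_uniq /= andbT; apply/hasPn => j.
    by rewrite inE => /andP[].
  rewrite big_cat /= [X in _ = _ + X]big_seq [X in _ = _ + X]big1 ?addr0; last first.
    by move=> i; rewrite inE => /andP[/negbTE ->].
  by rewrite /sqs big_seq [RHS]big_seq; apply: eq_bigr => i ->.
rewrite /sqs -big_split; apply: ler_sum => i _ /=; rewrite /w.
by case: ifP; rewrite ?rnorm0 ?expr0n ?add0r ?addr0.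
Qed.

Lemma cvg_near_cst (T : Type) (F : set_system T) {FF : Filter F} (V : normedModType C)
  (f : T -> V) (l : V) : (\forall x \near F, f x = l) -> f @ F --> l.
Proof.
move=> h; apply/rcvgP => e e0; apply: filterS h => x ->.
by rewrite subrr rnorm0.
Qed.

(** By continuity, since finite linear combinations of the basis are dense
    ([l2_expand]). *)
Lemma bounded_op_basis (S T : l2H R J -> l2H R J) :
  bounded_op S -> bounded_op T -> (forall j, S (ldelta j) = T (ldelta j)) -> S = T.
Proof.
move=> bS bT h; apply/funext => x.
have hS : (fun A => S (\sum_(j <- A) x j *: ldelta j)) @ fin_filter J --> S x.
  exact: (bounded_op_cvg bS (@l2_expand x)).
have hT : (fun A => T (\sum_(j <- A) x j *: ldelta j)) @ fin_filter J --> T x.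
  exact: (bounded_op_cvg bT (@l2_expand x)).
apply: (cvg_unique (@norm_hausdorff _ (l2H R J)) hS).
rewrite (_ : (fun A => _) = (fun A => T (\sum_(j <- A) x j *: ldelta j))) //.
apply/funext => A; rewrite !lin_sum; [|exact: bT.1|exact: bS.1].
by apply: eq_bigr => j _; rewrite (linZ bS.1) (linZ bT.1) h.
Qed.

End L2basis.

Lemma l2_finite_dim (R : realType) (J : finType) : finite_dim [set: l2H R J].
Proof.
exists #|J|, (fun i => ldelta R (enum_val i)) => x _; exists (fun i => x (enum_val i)).
apply: l2_ext => j; rewrite l2_sumE; apply/esym.
transitivity (\sum_(i < #|J|) x (enum_val i) * (if j == enum_val i then 1 else 0)) => //.
rewrite (bigD1 (enum_rank j))//= enum_rankK eqxx mulr1.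
rewrite big1 ?addr0// => i ij; case: eqVneq => [ji|_]; last by rewrite mulr0.
by rewrite ji enum_valK eqxx in ij.
Qed.

Section Sigma.
Variables (R : realType) (J : choiceType) (tau : J -> circle R).
Local Notation C := (Cx R).
Local Notation P := (J * 'I_2)%type.
Local Notation l2 := (l2 R P).
Implicit Types (x y : l2) (A B : {fset J}) (a b : M2fun R).

(** Finite sets of indices of this product form are cofinal, so limits along
    [fin_filter] may be computed along them. *)
Definition prodset A : {fset P} := [fset p in [seq (j, k) | j <- A, k <- enum 'I_2]]%fset.

Lemma big_prodset (V : zmodType) A (F : P -> V) :
  \sum_(p <- prodset A) F p = \sum_(j <- A) \sum_k F (j, k).
Proof.
rewrite (perm_big [seq (j, k) | j <- A, k <- enum 'I_2]).
  by rewrite big_allpairs; apply: eq_bigr => j _; rewrite big_enum.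
apply: uniq_perm; [exact: fset_uniq| |by move=> p; rewrite in_fset].
by apply: allpairs_uniq; [exact: fset_uniq|exact: enum_uniq|move=> [? ?] [? ?]].
Qed.

Lemma sub_prodset (D : {fset P}) : (D `<=` prodset [fset p.1 | p in D])%fset.
Proof.
apply/fsubsetP => -[j k] jk; rewrite in_fset; apply/allpairsP; exists (j, k) => /=.
by split => //; [apply/imfsetP; exists (j, k)|rewrite mem_enum].
Qed.

Lemma prodset_mono A B : (A `<=` B)%fset -> (prodset A `<=` prodset B)%fset.
Proof.
move=> /fsubsetP AB; apply/fsubsetP => p; rewrite !in_fset => /allpairsP[[j k] /= [jA kk ->]].
by apply/allpairsP; exists (j, k); split => //; exact: AB.
Qed.

Lemma cvg_psum_prod x y :
  (fun A => \sum_(j <- A) \sum_k x (j, k) * (y (j, k))^*) @ fin_filter J --> l2dot x y.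
Proof.
have -> : (fun A => \sum_(j <- A) \sum_k x (j, k) * (y (j, k))^*) =
    (fun D => psum D x y) \o prodset.
  by apply/funext => A /=; rewrite /psum big_prodset.
move=> U /(@cvg_psum R _ x y)[D _ hD].
exists [fset p.1 | p in D]%fset => //= A DA; apply: hD => /=.
by apply: fsubset_trans (prodset_mono DA); exact: sub_prodset.
Qed.

(** On the copy of the complex plane squared with index [j], the symbol acts
    through its value at [tau j]. A constant [tau] on a single index gives
    one point evaluation, the identity gives all of them at once. *)
Definition sigf a (x : P -> C) : P -> C :=
  fun p => \sum_l a p.2 l (tau p.1) * x (p.1, l).

Lemma sqs_sigf a (x : P -> C) (c : R) (A : {fset P}) : 0 <= c ->
  (forall i j t, rnorm (a i j t) <= c) ->
  sqs A (sigf a x) <= (2 * c) ^+ 2 * sqs (prodset [fset p.1 | p in A]%fset) x.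
Proof.
move=> c0 h; apply: le_trans (sqs_mono _ (sub_prodset A)) _.
rewrite /sqs !big_prodset mulr_sumr; apply: ler_sum => j _.
have key k : rnorm (sigf a x (j, k)) ^+ 2 <= 2 * c ^+ 2 * \sum_l rnorm (x (j, l)) ^+ 2.
  rewrite !big_ord_recl big_ord0 addr0.
  set l0 := ord0; set l1 := lift ord0 ord0.
  have : rnorm (sigf a x (j, k)) <= c * rnorm (x (j, l0)) + c * rnorm (x (j, l1)).
    rewrite /sigf /= !big_ord_recl big_ord0 addr0; apply: le_trans (rnormD _ _) _.
    by rewrite !cnormM lerD// ler_wpM2r ?rnorm_ge0.
  rewrite -ler_sqr ?nnegrE ?addr_ge0 ?mulr_ge0 ?rnorm_ge0// => /le_trans; apply.
  have := sqr_ge0 (c * (rnorm (x (j, l0)) - rnorm (x (j, l1)))); nra.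
apply: (@le_trans _ _ (\sum_(k < 2) 2 * c ^+ 2 * \sum_l rnorm (x (j, l)) ^+ 2)).
  by apply: ler_sum => k _; exact: key.
rewrite sumr_const card_ord -mulr_natl mulrA; by rewrite le_eqVlt; apply/orP; left; apply/eqP; ring.
Qed.

Lemma M2CT_bounded a : M2CT R a ->
  exists2 c : R, 0 <= c & forall i j t, rnorm (a i j t) <= c.
Proof.
move=> ca.
have /choice[c hc] (ij : 'I_2 * 'I_2) : exists c : R, 0 <= c /\
    forall t, rnorm (a ij.1 ij.2 t) <= c.
  by have [c c0 h] := circle_bounded (ca ij.1 ij.2); exists c.
exists (\sum_ij c ij) => [|i j t]; first by apply: sumr_ge0 => ij _; case: (hc ij).
have [_ h] := hc (i, j); apply: le_trans (h t) _.
by rewrite (bigD1 (i, j))//= lerDl; apply: sumr_ge0 => ij _; case: (hc ij).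
Qed.

Definition sigop a (x : l2H R P) : l2H R P := insubd (0 : l2) (sigf a (x : l2)).

Lemma sigf_l2 a x : M2CT R a -> sigf a x \in @l2_pred R P.
Proof.
move=> /M2CT_bounded[c c0 h]; apply: (@l2_predP _ _ _ ((2 * c) ^+ 2 * rnorm x ^+ 2)).
move=> A; apply: le_trans (sqs_sigf _ _ c0 h) _.
by rewrite ler_wpM2l ?sqr_ge0 ?sqs_le_norm.
Qed.

Lemma sigopE a x : M2CT R a -> l2val (sigop a x) = sigf a x.
Proof.
by move=> ca; have := @insubdK _ _ _ (0 : l2) (sigf a x) (sigf_l2 x ca).
Qed.

Lemma sigop_star_rep : star_rep sigop.
Proof.
have lin (c : C) a x y : M2CT R a -> sigop a (c *: x + y) = c *: sigop a x + sigop a y.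
  move=> ca; apply: l2_ext => p; rewrite (sigopE _ ca).
  transitivity (c * sigf a x p + sigf a y p).
    rewrite /sigf mulr_sumr -big_split; apply: eq_bigr => l _ /=.
    transitivity (a p.2 l (tau p.1) * (c * x (p.1, l) + y (p.1, l))) => //.
    by rewrite mulrDr mulrCA.
  by rewrite -(sigopE x ca) -(sigopE y ca).
split.
- move=> a ca; split; first by move=> c x y; exact: lin.
  have [c c0 h] := M2CT_bounded ca; exists (2 * c) => x.
  apply: l2_norm_le; first by rewrite mulr_ge0 ?mulr_ge0//; exact: (rnorm_ge0 x).
  move=> A; rewrite exprMn (sigopE _ ca); apply: le_trans (sqs_sigf _ _ c0 h) _.
  by rewrite ler_wpM2l ?sqr_ge0 ?sqs_le_norm.
- move=> c a b ca cb; apply/funext => x; apply: l2_ext => p.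
  have cab : M2CT R ((cst c : circle R -> C) *: a + b).
    exact: (M2CTD (M2CTZ (@cont_cst _ _ c) ca) cb).
  rewrite (sigopE _ cab).
  transitivity (c * sigf a x p + sigf b x p); last first.
    by rewrite -(sigopE x ca) -(sigopE x cb).
  rewrite /sigf mulr_sumr -big_split; apply: eq_bigr => l _ /=.
  by rewrite addmxEt mulrDl mxE mulrA.
- move=> a b ca cb; apply/funext => x; apply: l2_ext => p.
  rewrite (sigopE _ (M2CTM ca cb)) /= (sigopE _ ca) /sigf.
  rewrite (eq_bigr (fun l => \sum_k a p.2 k (tau p.1) * (b k l (tau p.1) * x (p.1, l)))).
    rewrite exchange_big; apply: eq_bigr => k _.
    by rewrite (sigopE _ cb) /sigf -mulr_sumr.
  by move=> l _; rewrite mulmxEt mulr_suml; apply: eq_bigr => k _; rewrite mulrA.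
- move=> a ca x y.
  have h1 := @cvg_psum_prod (sigop a x) y.
  have h2 := @cvg_psum_prod x (sigop (star_mx a) y).
  rewrite -[LHS]/(l2dot (sigop a x) y) -[RHS]/(l2dot x (sigop (star_mx a) y)).
  apply: (cvg_unique (@Cx_hausdorff R) h1).
  suff -> : (fun A => \sum_(j <- A) \sum_k sigop a x (j, k) * (y (j, k))^*) =
     (fun A => \sum_(j <- A) \sum_k x (j, k) * (sigop (star_mx a) y (j, k))^*) by [].
  apply/funext => A; apply: eq_bigr => j _.
  transitivity (\sum_k \sum_l a k l (tau j) * x (j, l) * (y (j, k))^*).
    by apply: eq_bigr => k _; rewrite (sigopE _ ca) /sigf mulr_suml.
  rewrite exchange_big; apply: eq_bigr => l _.
  rewrite (sigopE _ (M2CT_star ca)) /sigf rmorph_sum mulr_sumr; apply: eq_bigr => k _ /=.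
  by rewrite rmorphM star_mxE /= conjCK; ring.
- apply/funext => x; apply: l2_ext => -[j k].
  rewrite (sigopE _ (@M2CT1 R)) /sigf /= (bigD1 k)//= mxE eqxx big1 ?addr0 ?mul1r//.
  by move=> l lk; rewrite mxE eq_sym (negbTE lk) mul0r.
Qed.

Lemma sigop_delta a j l k : M2CT R a ->
  l2val (sigop a (ldelta R (j, l))) (j, k) = a k l (tau j).
Proof.
move=> ca; rewrite (sigopE _ ca) /sigf /= (bigD1 l)//= eqxx mulr1 big1 ?addr0//.
by move=> i il; rewrite xpair_eqE eqxx (negbTE il) mulr0.
Qed.

End Sigma.

(** The witness is the direct sum of all point evaluations: a continuous symbol
    is zero as soon as all of its values are. *)
Lemma faithful_rep_exists (R : realType) :
  exists (K : hilbertSpace R) (rho : M2fun R -> (K -> K)), faithful_unital_star_rep rho.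
Proof.
pose S := @sigop R (circle R) id; have SP : star_rep S := sigop_star_rep _.
exists (l2H R (circle R * 'I_2)%type), S.
case: SP => h1 h2 h3 h4 h5; split; [exact: h1|exact: h2|exact: h3|exact: h4|exact: h5|].
move=> a b ca cb ab; apply: M2_ext => i j t.
have := sigop_delta id t j i ca; rewrite -/S ab => <-.
by rewrite (sigop_delta id t j i cb).
Qed.

(** * Operator norms are suprema of pointwise norms *)

(** This is how an estimate that loses a constant, once it is known for all
    iterated squares, yields the sharp estimate. *)
Lemma pow2_bounded_le1 (R : realType) (r M : R) :
  0 <= r -> (forall k, r ^+ (2 ^ k) <= M) -> r <= 1.
Proof.
move=> r0 h; rewrite leNgt; apply/negP => r1.
have d0 : 0 < r - 1 by rewrite subr_gt0.
have bern k : 1 + k%:R * (r - 1) <= r ^+ k.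
  elim: k => [|k IH]; first by rewrite mul0r addr0.
  rewrite exprS -natr1; have := ler_wpM2l r0 IH.
  have : 0 <= k%:R * (r - 1) ^+ 2 by rewrite mulr_ge0// sqr_ge0.
  nra.
have [N hN] : exists N : nat, M < N%:R * (r - 1).
  exists (Num.bound `|M / (r - 1)|); rewrite -ltr_pdivrMr//.
  by apply: le_lt_trans (ler_norm _) _; exact: archi_boundP (normr_ge0 _).
have := h N; have := bern (2 ^ N)%N; have : (N%:R <= (2 ^ N)%:R :> R).
  by rewrite ler_nat ltnW// ltn_expl.
move=> e1 e2 e3; have : N%:R * (r - 1) <= (2 ^ N)%:R * (r - 1) by rewrite ler_wpM2r// ltW.
lra.
Qed.

Section Amplification.
Variables (R : realType) (n : nat).
Local Notation C := (Cx R).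
Local Notation CT := (circle R -> C).
Implicit Types (a b : 'M[M2fun R]_n).

Definition M2CTn a := forall i j, M2CT R (a i j).

Definition star_n a : 'M[M2fun R]_n := \matrix_(i, j) star_mx (a j i).
Definition mul_n a b : 'M[M2fun R]_n := \matrix_(i, j) \sum_k a i k *m b k j.

Lemma M2CTn_star a : M2CTn a -> M2CTn (star_n a).
Proof. by move=> ca i j; rewrite mxE; exact: M2CT_star (ca j i). Qed.

Lemma M2CTn_mul a b : M2CTn a -> M2CTn b -> M2CTn (mul_n a b).
Proof.
by move=> ca cb i j; rewrite mxE; apply: M2CT_sum => k; exact: M2CTM (ca i k) (cb k j).
Qed.

Lemma star_nM a b : star_n (mul_n a b) = mul_n (star_n b) (star_n a).
Proof.
apply/matrixP => i j; rewrite !mxE star_mx_sum; apply: eq_bigr => k _.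
by rewrite star_mxM !mxE.
Qed.

Lemma star_nK a : star_n (star_n a) = a.
Proof. by apply/matrixP => i j; rewrite !mxE star_mxK. Qed.

Section Rep.
Variables (K : hilbertSpace R) (rho : M2fun R -> (K -> K)).
Hypothesis rhoP : star_rep rho.
Implicit Types X Y : 'I_n -> K.

Definition ract a X := mxact (map_mx rho a) X.

Lemma ractE a X i : ract a X i = \sum_j rho (a i j) (X j).
Proof. by rewrite /ract /mxact; apply: eq_bigr => j _; rewrite mxE. Qed.

Lemma rep_bounded_mx a : M2CTn a -> bounded_mx (map_mx rho a).
Proof. by move=> ca i j; rewrite mxE; exact: star_rep_bounded rhoP _ (ca i j). Qed.

Lemma ractM a b X : M2CTn a -> M2CTn b -> ract (mul_n a b) X = ract a (ract b X).
Proof.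
move=> ca cb; apply/funext => i; rewrite !ractE.
transitivity (\sum_k \sum_j rho (a i j) (rho (b j k) (X k))).
  apply: eq_bigr => k _; rewrite mxE (srep_sum rhoP); last first.
    by move=> j; exact: M2CTM (ca i j) (cb j k).
  rewrite fct_sumE; apply: eq_bigr => j _.
  by rewrite (star_rep_mul rhoP (ca i j) (cb j k)).
rewrite exchange_big; apply: eq_bigr => j _; rewrite ractE.
by rewrite (lin_sum (star_rep_bounded rhoP (ca i j)).1).
Qed.

Lemma ract_star a X Y : M2CTn a -> dotn (ract a X) Y = dotn X (ract (star_n a) Y).
Proof.
move=> ca; rewrite /dotn.
transitivity (\sum_i \sum_j hdot K (X j) (rho (star_mx (a i j)) (Y i))).
  apply: eq_bigr => i _; rewrite ractE linear_sumlz; apply: eq_bigr => j _.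
  exact: star_rep_star rhoP _ (ca i j) _ _.
rewrite exchange_big; apply: eq_bigr => j _; rewrite ractE linear_sumr.
by apply: eq_bigr => i _; rewrite mxE.
Qed.

(** A bound by the size of the entries, with a constant that depends on [n]
    but not on the symbol. *)
Lemma ract_entry_bound a X (c : R) : 0 <= c -> M2CTn a ->
  (forall i j k l t, rnorm (a i j k l t) <= c) ->
  hnormn (ract a X) <= 4 * n%:R ^+ 2 * c * hnormn X.
Proof.
move=> c0 ca h.
rewrite hnormn_le ?mulr_ge0 ?sqr_ge0 ?hnormn_ge0//.
apply: (@le_trans _ _ (\sum_(i < n) (4 * n%:R * c * hnormn X) ^+ 2)).
  apply: ler_sum => i _; rewrite ler_sqr ?nnegrE ?rnorm_ge0 ?mulr_ge0 ?hnormn_ge0//.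
  rewrite ractE; apply: le_trans (rnorm_sum _ _ _) _.
  apply: (@le_trans _ _ (\sum_(j < n) 4 * c * hnormn X)).
    apply: ler_sum => j _; apply: le_trans (srep_entry_bound rhoP _ c0 (ca i j) (h i j)) _.
    by rewrite ler_wpM2l ?mulr_ge0// hnormn_coord.
  rewrite sumr_const card_ord -mulr_natl le_eqVlt; apply/orP; left; apply/eqP; ring.
rewrite sumr_const card_ord -[leLHS]mulr_natl.
have n1 : n%:R <= n%:R ^+ 2 :> R by rewrite -natrX ler_nat; case: (n) => // m; rewrite -[leqLHS]expn1 leq_pexp2l.
have := ler_wpM2r (sqr_ge0 (4 * n%:R * c * hnormn X)) n1; move/le_trans; apply.
by rewrite le_eqVlt; apply/orP; left; apply/eqP; ring.
Qed.

Definition sqn k b := iter k (fun b => mul_n b b) b.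

Lemma M2CTn_sqn k b : M2CTn b -> M2CTn (sqn k b).
Proof. by move=> cb; elim: k => [|k IH]; [exact: cb|exact: (M2CTn_mul IH IH)]. Qed.

Lemma star_sqn k b : star_n b = b -> star_n (sqn k b) = sqn k b.
Proof. by move=> sb; elim: k => //= k IH; rewrite star_nM IH. Qed.

(** For a self-adjoint operator [B], Cauchy--Schwarz gives
    [|B x|^2 <= |B^2 x| |x|]; iterating, [|B x|] is controlled by the powers
    [B^(2^k)]. *)
Lemma sqn_bound k b X : M2CTn b -> star_n b = b ->
  hnormn (ract b X) ^+ (2 ^ k) * hnormn X <=
  hnormn (ract (sqn k b) X) * hnormn X ^+ (2 ^ k).
Proof.
move=> cb sb; elim: k => [|k IH] /=; first by rewrite expr1 mulrC.
have [->|X0] := eqVneq (hnormn X) 0; first by rewrite mulr0 expr0n expn_eq0 /= mulr0.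
have p0 : 0 < hnormn X by rewrite lt_neqAle eq_sym X0 hnormn_ge0.
have csq := @M2CTn_sqn k b cb.
set u := hnormn (ract b X) in IH *; set y := hnormn X in IH p0 *.
set v := hnormn (ract (sqn k b) X) in IH.
set w := hnormn _.
have step : v ^+ 2 <= w * y.
  rewrite /v hnormn_sq -[leLHS]Re_toC -dotnxx (ract_star _ _ csq) (star_sqn _ sb) -(ractM _ csq csq).
  apply: le_trans (ler_norm _) _; apply: le_trans (Re_le_cnorm _) _.
  by apply: le_trans (dotn_cauchy_schwarz _ _) _; rewrite mulrC.
have u0 : 0 <= u by exact: hnormn_ge0.
have v0 : 0 <= v by exact: hnormn_ge0.
rewrite expnS mulnC !exprM.
have : (u ^+ (2 ^ k) * y) ^+ 2 <= (v * y ^+ (2 ^ k)) ^+ 2.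
  by rewrite ler_sqr ?nnegrE ?mulr_ge0 ?exprn_ge0// ltW.
rewrite !exprMn => h1.
have h2 : v ^+ 2 * y ^+ (2 ^ k) ^+ 2 <= w * y * y ^+ (2 ^ k) ^+ 2.
  by rewrite ler_wpM2r// sqr_ge0.
rewrite -(ler_pM2r p0); apply: le_trans (le_trans (le_trans _ h1) h2) _.
  by rewrite -mulrA -expr2.
by rewrite mulrAC.
Qed.

End Rep.

(** Evaluation at [t], as a representation on a two dimensional space. *)
Definition ev (t : circle R) := sigop (fun _ : unit => t).

Lemma evP t : star_rep (ev t). Proof. exact: sigop_star_rep. Qed.

(** The space of [ev t] is a copy of the complex plane squared, so this bounds
    the operator norm of the value of the symbol at each point. *)
Definition pw_bound (c : R) a := forall t X,
  hnormn (ract (ev t) a X) <= c * hnormn X.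

Lemma pw_boundM (c d : R) a b : 0 <= c -> M2CTn a -> M2CTn b ->
  pw_bound c a -> pw_bound d b -> pw_bound (c * d) (mul_n a b).
Proof.
move=> c0 ca cb ha hb t X; rewrite (ractM (evP t) _ ca cb).
by apply: le_trans (ha t _) _; rewrite -mulrA ler_wpM2l.
Qed.

(** At each point, an operator and its adjoint have the same norm. *)
Lemma pw_bound_star (c : R) a : 0 <= c -> M2CTn a -> pw_bound c a -> pw_bound c (star_n a).
Proof.
move=> c0 ca ha t X; have cs := @M2CTn_star a ca.
set Y := ract _ _ _.
have : hnormn Y ^+ 2 <= (c * hnormn X) * hnormn Y.
  rewrite hnormn_sq -[leLHS]Re_toC -dotnxx {1}/Y (ract_star (evP t) _ _ cs) star_nK.
  apply: le_trans (ler_norm _) _; apply: le_trans (Re_le_cnorm _) _.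
  apply: le_trans (dotn_cauchy_schwarz _ _) _.
  by rewrite -[leRHS]mulrA [leRHS]mulrCA; apply: ler_wpM2l; [exact: hnormn_ge0|exact: ha].
have [Y0|Y0] := eqVneq (hnormn Y) 0; first by rewrite Y0 mulr_ge0// hnormn_ge0.
by rewrite expr2 ler_pM2r// lt_neqAle eq_sym Y0 hnormn_ge0.
Qed.

Lemma pw_bound_entry (c : R) a : 0 <= c -> M2CTn a -> pw_bound c a ->
  forall i j k l t, rnorm (a i j k l t) <= c.
Proof.
move=> c0 ca ha i j k l t.
pose X (j' : 'I_n) : l2H R (unit * 'I_2)%type := if j' == j then ldelta R (tt, l) else 0.
have nX : hnormn X <= 1.
  rewrite hnormn_le// expr1n /nsum (bigD1 j)//= big1 ?addr0.
    rewrite /X eqxx -[leRHS](expr1n _ 2) ler_sqr ?nnegrE ?rnorm_ge0//.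
    by apply: l2_norm_le => // A; rewrite expr1n; exact: sqs_delta.
  by move=> j' jj; rewrite /X (negbTE jj) rnorm0 expr0n.
have e : ract (ev t) a X i = ev t (a i j) (ldelta R (tt, l)).
  rewrite ractE (bigD1 j)//= /X eqxx big1 ?addr0// => j' jj.
  by rewrite (negbTE jj) (lin0 (star_rep_bounded (evP t) (ca i j')).1).
rewrite -(sigop_delta (fun=> t) tt l k (ca i j)).
apply: le_trans (@l2_coord_le R _ (ev t (a i j) (ldelta R (tt, l))) (tt, k)) _.
rewrite -e.
apply: le_trans (@hnormn_coord R (l2H R _) n (ract (ev t) a X) i) _.
apply: le_trans (ha t X) _.
by rewrite -[leRHS]mulr1 ler_wpM2l.
Qed.

End Amplification.

Section UpperBound.
Variables (R : realType) (n : nat).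
Local Notation C := (Cx R).
Local Notation CT := (circle R -> C).
Implicit Types (a b : 'M[M2fun R]_n).
Variables (K : hilbertSpace R) (rho : M2fun R -> (K -> K)).
Hypothesis rhoP : star_rep rho.
Implicit Types X Y : 'I_n -> K.

Lemma pw_bound_sqn k (c : R) b : 0 <= c -> M2CTn b -> pw_bound c b ->
  pw_bound (c ^+ (2 ^ k)) (sqn k b).
Proof.
move=> c0 cb hb; elim: k => [|k IH]; first by rewrite expr1; exact: hb.
rewrite expnS mulnC exprM expr2 /=.
have csq := @M2CTn_sqn R n k b cb.
exact: (pw_boundM (exprn_ge0 _ c0) csq csq IH IH).
Qed.

(** With [b] the product of the adjoint of [a] and [a], the powers of
    [rho b] grow at most like those of [c ^ 2] up to the constant of
    [ract_entry_bound]; then [sqn_bound] and [pow2_bounded_le1] remove that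
    constant, and the norm of [a x] is controlled by that of [b x]. *)
Lemma ract_le_pos (c : R) a X : 0 < c -> M2CTn a -> pw_bound c a ->
  hnormn (ract rho a X) <= c * hnormn X.
Proof.
move=> c0 ca ha.
have cs := @M2CTn_star R n a ca.
pose b := mul_n (star_n a) a.
have cb : M2CTn b by exact: (M2CTn_mul cs ca).
have sb : star_n b = b by rewrite /b star_nM star_nK.
have hb : pw_bound (c * c) b.
  exact: (pw_boundM (ltW c0) cs ca (pw_bound_star (ltW c0) ca ha) ha).
have cc0 : 0 < c * c by rewrite mulr_gt0.
have [X0|X0] := eqVneq (hnormn X) 0.
  have -> : ract rho a X = fun=> 0.
    apply/funext => i; rewrite ractE big1// => j _.
    by rewrite (hnormn_eq0 X0) (lin0 (star_rep_bounded rhoP (ca i j)).1).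
  rewrite X0 mulr0 hnormn_le// expr0n /nsum big1// => i _.
  by rewrite rnorm0 expr0n.
have y0 : 0 < hnormn X by rewrite lt_neqAle eq_sym X0 hnormn_ge0.
have ub : hnormn (ract rho b X) <= c * c * hnormn X.
  rewrite -ler_pdivrMr// -[leRHS]mulr1 -ler_pdivrMl// mulrC.
  apply: (@pow2_bounded_le1 _ _ (4 * n%:R ^+ 2)) => [|k].
    by rewrite !divr_ge0 ?hnormn_ge0// ltW.
  have := sqn_bound rhoP k X cb sb.
  set u := hnormn _; set y := hnormn X in y0 *.
  have csq := @M2CTn_sqn R n k b cb.
  have cck : 0 <= (c * c) ^+ (2 ^ k) by rewrite exprn_ge0// ltW.
  have entry := pw_bound_entry cck csq (pw_bound_sqn k (ltW cc0) cb hb).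
  have := ract_entry_bound rhoP X cck csq entry.
  rewrite -/y => h1 h2.
  have := le_trans h2 (ler_wpM2r (exprn_ge0 (2 ^ k) (ltW y0)) h1).
  rewrite mulrAC ler_pM2r// => h.
  rewrite !exprMn !exprVn -mulrA -invfM ler_pdivrMr; last by rewrite mulr_gt0 ?exprn_gt0.
  apply: le_trans h _.
  by rewrite exprMn le_eqVlt; apply/orP; left; apply/eqP; ring.
rewrite hnormn_le; last by rewrite mulr_ge0 ?hnormn_ge0 ?ltW.
rewrite -[leLHS]Re_toC -dotnxx (ract_star rhoP _ _ ca) -(ractM rhoP _ cs ca).
apply: le_trans (ler_norm _) _; apply: le_trans (Re_le_cnorm _) _.
apply: le_trans (dotn_cauchy_schwarz _ _) _.
apply: le_trans (ler_wpM2l (hnormn_ge0 _) ub) _.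
by rewrite le_eqVlt; apply/orP; left; apply/eqP; ring.
Qed.

(** The norm of [rho a] is at most the supremum of the pointwise norms: the
    crude bound of [ract_entry_bound], applied to the powers [b ^ (2 ^ k)] of
    [b = a^* a], loses its constant after taking roots. *)
Lemma ract_le (c : R) a X : 0 <= c -> M2CTn a -> pw_bound c a ->
  hnormn (ract rho a X) <= c * hnormn X.
Proof.
move=> c0 ca ha; apply/ler_addgt0Pr => e e0.
have y1 : 0 < hnormn X + 1 by rewrite ltr_wpDl ?hnormn_ge0.
have d0 : 0 < e / (hnormn X + 1) by rewrite divr_gt0.
have cd : 0 < c + e / (hnormn X + 1) by rewrite ltr_wpDl.
have hd : pw_bound (c + e / (hnormn X + 1)) a.
  by move=> t Y; apply: le_trans (ha t Y) _; rewrite ler_wpM2r ?hnormn_ge0// lerDl ltW.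
apply: le_trans (ract_le_pos X cd ca hd) _; rewrite mulrDl lerD2l.
by rewrite -mulrA ler_piMr ?(ltW e0)// ler_pdivrMl// mulr1 lerDl.
Qed.

End UpperBound.

Section LowerBound.
Variables (R : realType).
Local Notation C := (Cx R).
Local Notation CT := (circle R -> C).

(** The vector-valued functions [f] on which symbols act are realised as
    first columns of symbols. *)
Definition colf (f : 'I_2 -> CT) : M2fun R := \matrix_(k, i) if i == 0 then f k else 0.

Lemma colfE f k i t : colf f k i t = if i == 0 then f k t else 0.
Proof. by rewrite mxE; case: ifP. Qed.

Lemma M2CT_colf f : (forall k, continuous (f k)) -> M2CT R (colf f).
Proof. by move=> cf k i; rewrite mxE; case: ifP => _; [exact: cf|exact: cont0]. Qed.

Lemma mul_colf (a : M2fun R) f :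
  a *m colf f = colf (fun k => \sum_l a k l * f l).
Proof.
apply: M2_ext => k i t; rewrite mulmxEt colfE fct_sumE.
case: ifP => i0; last by rewrite big1// => l _; rewrite colfE i0 mulr0.
by apply: eq_bigr => l _; rewrite colfE i0.
Qed.

Lemma colf_sum n (f : 'I_n -> 'I_2 -> CT) :
  \sum_j colf (f j) = colf (fun k => \sum_j f j k).
Proof.
apply/matrixP => k i; rewrite summxE mxE; case: ifP => i0.
  by apply: eq_bigr => j _; rewrite mxE i0.
by rewrite big1// => j _; rewrite mxE i0.
Qed.

Lemma l2_unit_norm (x : l2H R (unit * 'I_2)%type) :
  rnorm x ^+ 2 = \sum_l rnorm ((x : l2 R _) (tt, l)) ^+ 2.
Proof.
have e : sqs (prodset [fset tt]%fset) (x : l2 R _) = \sum_l rnorm ((x : l2 R _) (tt, l)) ^+ 2.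
  by rewrite /sqs big_prodset big_seq_fset1.
rewrite -e; have -> := @l2_rnorm_sq R _ (x : l2 R _); apply/eqP; rewrite eq_le sqs_le_nsq andbT.
apply: nsq_le => A; apply: sqs_mono; apply: (fsubset_trans (sub_prodset A)).
by apply: prodset_mono; apply/fsubsetP => -[]; rewrite inE.
Qed.

Variables (K : hilbertSpace R) (rho : M2fun R -> (K -> K)).
Hypothesis rhoP : faithful_unital_star_rep rho.
Let rhoS := faithful_star_rep rhoP.

Section PositiveFunctional.
Variable xi : K.
Implicit Types g h : circle R -> R.

(** The state of [C(T)] given by the vector [xi], up to normalisation. All
    norms that occur in [pw_bound_of_rep] are values of this positive
    functional. *)
Definition qf g : R := complex.Re (hdot K xi (rho (funit (fun t => toC (g t)) 0 0) xi)).

Lemma qf_col f : (forall k, continuous (f k)) ->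
  rnorm (rho (colf f) xi) ^+ 2 = qf (fun t => \sum_k rnorm (f k t) ^+ 2).
Proof.
move=> cf; have cc := @M2CT_colf f cf.
rewrite -[LHS]Re_toC -hdotxx (srep_dot rhoS _ _ cc cc); congr (complex.Re (hdot K xi (rho _ xi))).
apply: M2_ext => i j t; rewrite mulmxEt funitEt.
case: (altP (i =P 0)) => i0 /=; last first.
  by rewrite big1// => k _; rewrite star_mxE colfE (negbTE i0) rmorph0 mul0r.
case: (altP (j =P 0)) => j0 /=; last first.
  by rewrite big1// => k _; rewrite [colf f k j t]colfE (negbTE j0) mulr0.
rewrite toC_sum; apply: eq_bigr => k _.
by rewrite star_mxE !colfE i0 j0 /= mulrC mulJ_cnorm.
Qed.

Lemma qf_lin (c : R) g h : continuous g -> continuous h ->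
  qf (fun t => c * g t + h t) = c * qf g + qf h.
Proof.
move=> cg ch; rewrite /qf.
have Mg : M2CT R (funit (fun t => toC (g t)) 0 0) by apply: M2CT_funit; exact: cont_toC.
have Mh : M2CT R (funit (fun t => toC (h t)) 0 0) by apply: M2CT_funit; exact: cont_toC.
have -> : funit (fun t => toC (c * g t + h t)) 0 0 =
    (cst (toC c) : CT) *: funit (fun t => toC (g t)) 0 0 + funit (fun t => toC (h t)) 0 0.
  rewrite funitZ -funitD; congr (funit _ 0 0); apply/funext => t.
  by rewrite toCD toCM.
rewrite (star_rep_lin rhoS _ Mg Mh) linearDr linearZr_LR /= ReD ReM toCJ Im_toC mul0r subr0.
by [].
Qed.

Lemma qf0 : qf (fun=> 0) = 0.
Proof.
rewrite /qf (_ : funit _ 0 0 = 0) ?(srep0 rhoS) ?linear0r//.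
by apply: M2_ext => i k t; rewrite funitEt mxE; case: ifP.
Qed.

Lemma qfZ (c : R) g : continuous g -> qf (fun t => c * g t) = c * qf g.
Proof.
move=> cg; rewrite -[RHS]addr0 -[X in _ + X]qf0 -(qf_lin _ cg); last exact: cst_continuous.
by congr qf; apply/funext => t; rewrite addr0.
Qed.

Lemma qf_sum I (r : seq I) (g : I -> circle R -> R) : (forall i, continuous (g i)) ->
  qf (fun t => \sum_(i <- r) g i t) = \sum_(i <- r) qf (g i).
Proof.
move=> cg; elim: r => [|i r IH].
  by rewrite big_nil -[RHS]qf0; congr qf; apply/funext => t; rewrite big_nil.
rewrite big_cons -IH -[X in X + _]mul1r -(qf_lin _ (cg i)).
  by congr qf; apply/funext => t; rewrite big_cons mul1r.
exact: rcont_sum.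
Qed.

(** A nonnegative function is the square of its root, so [qf_col] applies. *)
Lemma qf_ge0 g : continuous g -> (forall t, 0 <= g t) -> 0 <= qf g.
Proof.
move=> cg g0; pose s : CT := fun t => toC (Num.sqrt (g t)).
pose f (k : 'I_2) : CT := if k == 0 then s else 0.
have cs : continuous s.
  apply: cont_toC => t; apply: (@continuous_comp _ _ _ g); first exact: cg.
  exact: sqrt_continuous.
have cf k : continuous (f k) by rewrite /f; case: ifP => _; [exact: cs|exact: cont0].
have := qf_col cf; rewrite (_ : (fun t => _) = g) => [<-|]; first exact: sqr_ge0.
apply/funext => t; rewrite (bigD1 0)//= big1 ?addr0; last first.
  by move=> k k0; rewrite /f (negbTE k0) rnorm0 expr0n.
by rewrite /f eqxx cnorm_toC ger0_norm ?sqrtr_ge0// sqr_sqrtr.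
Qed.

End PositiveFunctional.

(** If [|a t0 v| > c |v|], then [|a t v|^2 >= kappa > c^2 |v|^2] near [t0]; for a
    bump [phi] supported there and [x_j = rho (phi v_j) xi], the hypothesis
    forces [rho phi xi = 0] for all [xi], hence [phi = 0] by faithfulness. *)
Lemma pw_bound_of_rep n (c : R) (a : 'M[M2fun R]_n) : 0 <= c -> M2CTn a ->
  (forall X, hnormn (ract rho a X) <= c * hnormn X) -> pw_bound c a.
Proof.
move=> c0 ca ha t0 V.
pose v j l : C := (V j : l2 R _) (tt, l).
pose w i k : CT := \sum_j \sum_l a i j k l * (cst (v j l) : CT).
pose G t : R := \sum_i \sum_k rnorm (w i k t) ^+ 2.
pose N : R := \sum_j \sum_l rnorm (v j l) ^+ 2.
have cw i k : continuous (w i k).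
  by apply: cont_sum => j; apply: cont_sum => l; exact: contM (ca i j k l) (@cont_cst _ _ (v j l)).
have nV : hnormn V ^+ 2 = N.
  by rewrite hnormn_sq; apply: eq_bigr => j _; rewrite l2_unit_norm.
have nW : hnormn (ract (ev t0) a V) ^+ 2 = G t0.
  rewrite hnormn_sq; apply: eq_bigr => i _; rewrite l2_unit_norm; apply: eq_bigr => k _.
  congr (rnorm _ ^+ 2); rewrite ractE.
  transitivity (\sum_j (ev t0 (a i j) (V j) : l2 R _) (tt, k)); first exact: l2_sumE.
  rewrite /w fct_sumE; apply: eq_bigr => j _.
  by rewrite /ev (sigopE _ _ (ca i j)) /sigf /= fct_sumE.
have cG : continuous G.
  by apply: rcont_sum => i; apply: rcont_sum => k; apply: rcont_norm_sq; exact: cw.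
rewrite -ler_sqr ?nnegrE ?mulr_ge0 ?hnormn_ge0// nW exprMn nV leNgt; apply/negP => hlt.
(* The gap between the hypothesis and the assumed value at [t0] is shared
   out so that a neighbourhood of [t0] keeps half of it. *)
pose kappa := (c ^+ 2 * N + G t0) / 2.
have k1 : c ^+ 2 * N < kappa by rewrite midf_lt.
have k2 : kappa < G t0 by rewrite midf_lt.
have [d d0 hd] : exists2 d : R, 0 < d &
    forall t, rnorm (set_val t0 - set_val t) < d -> kappa <= G t.
  apply/circle_nbhs.
  have /cvgrPdist_lt/(_ (G t0 - kappa)) := cG t0.
  rewrite subr_gt0 => /(_ k2); apply: filterS => t.
  by move=> /(le_lt_trans (ler_norm _)); rewrite ltrD2l ltrN2 => /ltW.
pose phi (t : circle R) : R := Num.max 0 (d - rnorm (set_val t0 - set_val t)).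
have phi0 t : 0 <= phi t by rewrite /phi le_max lexx.
have cphi : continuous phi.
  have cr : continuous (fun t : circle R => rnorm (set_val t0 - set_val t)).
    by apply: cnorm_cont; exact: (contB (@cont_cst _ _ (set_val t0)) (@circle_val_cont R)).
  exact: (rcont_max (@rcont_cst _ _ 0) (rcontB (@rcont_cst _ _ d) cr)).
have cphi2 : continuous (fun t => phi t ^+ 2) by exact: (rcontM cphi cphi).
pose Phi : CT := fun t => toC (phi t).
have cPhi : continuous Phi by exact: cont_toC.
have key xi : rho (funit Phi 0 0) xi = 0.
  pose f j k : CT := Phi * (cst (v j k) : CT).
  have cf j k : continuous (f j k) by exact: contM cPhi (@cont_cst _ _ (v j k)).
  pose X j := rho (colf (f j)) xi.
  have nX : hnormn X ^+ 2 = N * qf xi (fun t => phi t ^+ 2).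
    rewrite hnormn_sq /nsum /N mulr_suml; apply: eq_bigr => j _.
    rewrite (qf_col xi (cf j)) -(qfZ _ _ cphi2).
    congr (qf xi _); apply/funext => t; rewrite mulr_suml; apply: eq_bigr => l _.
    by rewrite /f cnormM exprMn /Phi cnorm_toC ger0_norm// mulrC.
  have nAX : hnormn (ract rho a X) ^+ 2 = qf xi (fun t => phi t ^+ 2 * G t).
    have -> : ract rho a X = fun i => rho (colf (fun k => Phi * w i k)) xi.
      apply/funext => i; rewrite ractE.
      transitivity (rho (\sum_j a i j *m colf (f j)) xi).
        rewrite (srep_sum rhoS); last by move=> j; exact: M2CTM (ca i j) (M2CT_colf (cf j)).
        rewrite fct_sumE; apply: eq_bigr => j _.
        by rewrite (star_rep_mul rhoS (ca i j) (M2CT_colf (cf j))).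
      congr (rho _ xi); rewrite (eq_bigr (fun j => colf (fun k => \sum_l a i j k l * f j l))).
        rewrite colf_sum; congr colf; apply/funext => k; rewrite /w mulr_sumr.
        apply: eq_bigr => j _; rewrite mulr_sumr; apply: eq_bigr => l _.
        by rewrite /f mulrCA.
      by move=> j _; exact: mul_colf.
    rewrite hnormn_sq /nsum.
    rewrite (eq_bigr (fun i => qf xi (fun t => phi t ^+ 2 * \sum_k rnorm (w i k t) ^+ 2))); last first.
      move=> i _; rewrite qf_col; last by move=> k; exact: contM cPhi (cw i k).
      congr (qf xi _); apply/funext => t; rewrite mulr_sumr; apply: eq_bigr => k _.
      by rewrite cnormM exprMn cnorm_toC ger0_norm.
    rewrite -qf_sum.
      by congr (qf xi _); apply/funext => t; rewrite -mulr_sumr.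
    move=> i; apply: (rcontM cphi2); apply: rcont_sum => k; apply: rcont_norm_sq; exact: cw.
  have := ha X; rewrite -ler_sqr ?nnegrE ?mulr_ge0 ?hnormn_ge0// nAX exprMn nX mulrA => h1.
  have h2 : kappa * qf xi (fun t => phi t ^+ 2) <= qf xi (fun t => phi t ^+ 2 * G t).
    rewrite -subr_ge0.
    have <- : qf xi (fun t => - kappa * (phi t ^+ 2) + phi t ^+ 2 * G t) =
       qf xi (fun t => phi t ^+ 2 * G t) - kappa * qf xi (fun t => phi t ^+ 2).
      by rewrite (qf_lin _ _ cphi2 (rcontM cphi2 cG)) mulNr addrC.
    apply: qf_ge0 => [|t].
      exact: (rcontD (rcontM (@rcont_cst _ _ _) cphi2) (rcontM cphi2 cG)).
    rewrite mulNr addrC [phi t ^+ 2 * _]mulrC -mulrBl.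
    have [td|td] := ltP (rnorm (set_val t0 - set_val t)) d.
      by rewrite mulr_ge0 ?sqr_ge0// subr_ge0 hd.
    by rewrite /phi (max_l _) ?expr0n ?mulr0// subr_le0.
  have q0 : qf xi (fun t => phi t ^+ 2) = 0.
    apply/eqP; rewrite eq_le (qf_ge0 xi cphi2) ?andbT; last by move=> t; exact: sqr_ge0.
    have := le_trans h2 h1; rewrite -subr_ge0 -mulrBl => h3.
    rewrite leNgt; apply/negP => q0; move: h3; rewrite pmulr_lge0// subr_ge0.
    by rewrite leNgt k1.
  apply: rnorm_eq0; apply/eqP; rewrite -sqrf_eq0.
  pose g (k : 'I_2) : CT := if k == 0 then Phi else 0.
  have -> : funit Phi 0 0 = colf g.
    by apply: M2_ext => i j t; rewrite funitEt colfE /g; case: (i == 0); case: (j == 0).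
  rewrite qf_col; last by move=> k; rewrite /g; case: ifP => _; [exact: cPhi|exact: cont0].
  rewrite (_ : (fun t => _) = (fun t => phi t ^+ 2)) ?q0//; apply/funext => t.
  rewrite (bigD1 0)//= big1 ?addr0; last first.
    by move=> k k0; rewrite /g (negbTE k0) rnorm0 expr0n.
  by rewrite /g eqxx cnorm_toC ger0_norm.
have : funit Phi 0 0 = 0.
  apply: (srep_faithful rhoP); [exact: (M2CT_funit cPhi)|exact: M2CT0|].
  by rewrite (srep0 rhoS); apply/funext => xi; exact: key.
move=> /matrixP/(_ 0 0)/(congr1 (fun u : CT => u t0)); rewrite funitEt mxE eqxx /= => /toC_inj.
rewrite /phi subrr rnorm0 subr0 => /eqP; rewrite eq_le ge_max.
by rewrite [d <= 0]leNgt d0 andbF.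
Qed.

End LowerBound.

(** * Integrals of complex-valued functions *)

Section Integral.
Variable R : realType.
Local Notation C := (Cx R).
Implicit Types (a b c : R) (f g : R -> R).

Definition rint f a b : R := \int[@lebesgue_measure R]_(x in `[a, b]) f x.

Lemma cont_integrable f a b : continuous f ->
  (@lebesgue_measure R).-integrable `[a, b] (EFin \o f).
Proof.
move=> cf; apply: continuous_compact_integrable; first exact: segment_compact.
exact: continuous_subspaceT.
Qed.

Lemma rint_lin k f g a b : continuous f -> continuous g ->
  rint (fun x => k * f x + g x) a b = k * rint f a b + rint g a b.
Proof.
move=> cf cg; have ckf : continuous (fun x => k * f x).
  by move=> x; apply: cvgMl_tmp; exact: cf.
have mI : measurable `[a, b] by exact: measurable_itv.
by rewrite /rint RintegralD ?RintegralZl//; exact: cont_integrable.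
Qed.

Lemma rint_cst k a b : a <= b -> rint (fun=> k) a b = k * (b - a).
Proof.
move=> ab; rewrite /rint Rintegral_cst//= lebesgue_measure_itv /= lte_fin.
by move: ab; rewrite le_eqVlt => /predU1P[->|->]; rewrite ?ltxx ?subrr.
Qed.

Lemma rint_ge0 f a b : (forall x, a <= x <= b -> 0 <= f x) -> 0 <= rint f a b.
Proof. by move=> h; apply: Rintegral_ge0 => x /=; rewrite in_itv => /h. Qed.

Lemma rint_le f g a b : continuous f -> continuous g ->
  (forall x, a <= x <= b -> f x <= g x) -> rint f a b <= rint g a b.
Proof.
move=> cf cg h; apply: le_Rintegral; [exact: measurable_itv|exact: cont_integrable|exact: cont_integrable|].
by move=> x /=; rewrite in_itv; exact: h.
Qed.

Lemma rint_abs f a b M : a <= b -> continuous f -> (forall x, a <= x <= b -> `|f x| <= M) ->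
  `|rint f a b| <= M * (b - a).
Proof.
move=> ab cf h; rewrite ler_norml -mulNr -!rint_cst//.
have cc (k : R) : continuous (fun _ : R => k) by exact: cst_continuous.
apply/andP; split; [apply: rint_le (cc _) cf _|apply: rint_le cf (cc _) _] => x /h.
  by rewrite ler_norml => /andP[].
by rewrite ler_norml => /andP[].
Qed.

Lemma rint_cat f a b c : continuous f -> a <= b -> b <= c ->
  rint f a c = rint f a b + rint f b c.
Proof.
move=> cf ab bc; have i x y := @cont_integrable f x y cf.
have := @Rintegral_itvB R f (BLeft a) (BRight c) b (i a c).
rewrite !bnd_simp => /(_ ab bc) /eqP; rewrite subr_eq => /eqP.
rewrite /rint => ->; rewrite addrC; congr (_ + _).
rewrite Rintegral_itv_obnd_cbnd//; apply: integrableS (i b c) => //.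
by move=> x /=; rewrite !in_itv /= => /andP[/ltW -> ->].
Qed.

Lemma rint_id a b : a <= b -> rint id a b = (b ^+ 2 - a ^+ 2) / 2.
Proof.
rewrite le_eqVlt => /predU1P[->|ab].
  rewrite subrr mul0r /rint (_ : `[b, b]%classic = [set b]) ?Rintegral_set1//.
  by rewrite set_itv1.
have dF (x : R) : is_derive x 1 (fun x : R => x ^+ 2 / 2) x.
  apply: is_derive_eq; rewrite /GRing.scale /=; lra.
rewrite /rint /Rintegral.
rewrite (@continuous_FTC2 R id (fun x => x ^+ 2 / 2)) //=.
- by rewrite -mulrBl.
- by apply: continuous_subspaceT => x; exact: cvg_id.
- have cF : continuous (fun x : R => x ^+ 2 / 2).
    by move=> x; apply: cvgMr_tmp; exact: (cvgM cvg_id cvg_id).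
  split=> [x _||]; first by case: (dF x).
    by apply: cvg_at_right_filter; exact: cF.
  by apply: cvg_at_left_filter; exact: cF.
- by move=> x _; rewrite derive1E; by case: (dF x).
Qed.

Definition cint (u : R -> C) a b : C :=
  (rint (fun x => complex.Re (u x)) a b +i* rint (fun x => complex.Im (u x)) a b)%C.

Lemma Re_cont (u : R -> C) : continuous u -> continuous (fun x => complex.Re (u x)).
Proof. by move=> cu x; exact: (cvg_Re (cu x)). Qed.
Lemma Im_cont (u : R -> C) : continuous u -> continuous (fun x => complex.Im (u x)).
Proof. by move=> cu x; exact: (cvg_Im (cu x)). Qed.

Lemma cint_lin (k : C) (u v : R -> C) a b : continuous u -> continuous v ->
  cint (fun x => k * u x + v x) a b = k * cint u a b + cint v a b.
Proof.
move=> cu cv; have [rU iU] := (Re_cont cu, Im_cont cu).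
have [rV iV] := (Re_cont cv, Im_cont cv).
have cNU c : continuous (fun x => c * complex.Im (u x) + complex.Re (v x)).
  by move=> x; apply: cvgD; [apply: cvgMl_tmp; exact: iU|exact: rV].
have cRU c : continuous (fun x => c * complex.Re (u x) + complex.Im (v x)).
  by move=> x; apply: cvgD; [apply: cvgMl_tmp; exact: rU|exact: iV].
apply: Cx_ext; rewrite ?ReD ?ImD ?ReM ?ImM /=.
  under [X in rint X]eq_fun do rewrite ReD ReM -addrA -mulNr.
  by rewrite !rint_lin//; ring.
under [X in rint X]eq_fun do rewrite ImD ImM -addrA.
have -> : (fun x => complex.Re k * complex.Im (u x) +
    (complex.Im k * complex.Re (u x) + complex.Im (v x))) =
   (fun x => complex.Re k * complex.Im (u x) + (complex.Im k * complex.Re (u x) + complex.Im (v x))) by [].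
by rewrite !rint_lin//; ring.
Qed.

Lemma cint_cst (k : C) a b : a <= b -> cint (fun=> k) a b = k * toC (b - a).
Proof.
by move=> ab; apply: Cx_ext; rewrite /= ?rint_cst// ?ReM ?ImM Re_toC Im_toC; ring.
Qed.

Lemma cintB (u v : R -> C) a b : continuous u -> continuous v ->
  cint (fun x => u x - v x) a b = cint u a b - cint v a b.
Proof.
move=> cu cv; rewrite addrC -mulN1r -(cint_lin _ _ _ cv cu); congr cint.
by apply/funext => s; rewrite mulN1r addrC.
Qed.

Lemma cint_toC f a b : cint (fun x => toC (f x)) a b = toC (rint f a b).
Proof.
apply: Cx_ext => //=; transitivity (rint (fun=> 0) a b) => //.
by rewrite /rint /Rintegral integral0.
Qed.

Lemma cint_cat (u : R -> C) a b c : continuous u -> a <= b -> b <= c ->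
  cint u a c = cint u a b + cint u b c.
Proof.
move=> cu ab bc; apply: Cx_ext; rewrite ?ReD ?ImD /=; apply: rint_cat => //.
  exact: Re_cont.
exact: Im_cont.
Qed.

(** The factor [2] comes from estimating real and imaginary parts
    separately; the argument only uses such bounds up to a constant. *)
Lemma cint_norm (u : R -> C) a b (M : R) : a <= b -> continuous u ->
  (forall x, a <= x <= b -> rnorm (u x) <= M) -> rnorm (cint u a b) <= 2 * M * (b - a).
Proof.
move=> ab cu h; apply: le_trans (cnorm_le _) _ => /=.
rewrite -mulrA mulr_natl mulr2n; apply: lerD; apply: rint_abs => //.
- exact: Re_cont.
- by move=> x /h; apply: le_trans (Re_le_cnorm _).
- exact: Im_cont.
- by move=> x /h; apply: le_trans (Im_le_cnorm _).
Qed.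

End Integral.

(** * Goursat's lemma and the mean value property *)

Section Goursat.
Variable R : realType.
Local Notation C := (Cx R).
Implicit Types (x y w h p q s t e d : R) (G : R -> R -> C).

Definition cpt s t : C := toC s + 'i * toC t.

(** The integral of [G] along the boundary of the rectangle with lower left
    corner [(x, y)], width [w] and height [h]. *)
Definition bdint G x y w h : C :=
  cint (fun s => G s y) x (x + w) + 'i * cint (G (x + w)) y (y + h)
  - cint (fun s => G s (y + h)) x (x + w) - 'i * cint (G x) y (y + h).

(** Continuity along horizontal and vertical lines is all that the four
    boundary integrals require. *)
Definition sep_cont G := (forall t, continuous (fun s => G s t)) /\
  (forall s, continuous (G s)).

Lemma bdint_quarter G x y w h : sep_cont G -> 0 <= w -> 0 <= h ->
  bdint G x y (w + w) (h + h) =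
  bdint G x y w h + bdint G (x + w) y w h + bdint G x (y + h) w h +
  bdint G (x + w) (y + h) w h.
Proof.
move=> [c1 c2] w0 h0; rewrite /bdint !addrA.
have l1 : x <= x + w by rewrite lerDl.
have l2 : x + w <= x + w + w by rewrite lerDl.
have l3 : y <= y + h by rewrite lerDl.
have l4 : y + h <= y + h + h by rewrite lerDl.
rewrite (cint_cat (c1 y) l1 l2) (cint_cat (c1 (y + h + h)) l1 l2).
rewrite (cint_cat (c2 x) l3 l4) (cint_cat (c2 (x + w + w)) l3 l4).
ring.
Qed.

Lemma toC_cont : continuous (@toC R).
Proof. by move=> x; exact: (cvg_toC cvg_id). Qed.

(** The four contributions cancel because affine functions of [s + i t] have
    a primitive. *)
Lemma bdint_affine (k A : C) x y w h : 0 <= w -> 0 <= h ->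
  bdint (fun s t => k + A * cpt s t) x y w h = 0.
Proof.
move=> w0 h0.
have hor (u : C) t a b : a <= b -> cint (fun s => k + A * cpt s t) a b =
    A * toC ((b ^+ 2 - a ^+ 2) / 2) + (k + A * 'i * toC t) * toC (b - a).
  move=> ab; rewrite -(rint_id ab) -cint_toC -cint_cst// -cint_lin.
  - by congr cint; apply/funext => s; rewrite /cpt; ring.
  - exact: toC_cont.
  - exact: cst_continuous.
have ver s a b : a <= b -> cint (fun t => k + A * cpt s t) a b =
    (A * 'i) * toC ((b ^+ 2 - a ^+ 2) / 2) + (k + A * toC s) * toC (b - a).
  move=> ab; rewrite -(rint_id ab) -cint_toC -cint_cst// -cint_lin.
  - by congr cint; apply/funext => t; rewrite /cpt; ring.
  - exact: toC_cont.
  - exact: cst_continuous.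
rewrite /bdint !(hor 0) ?lerDl// !ver ?lerDl//.
rewrite ![x + w - x]addrAC ![y + h - y]addrAC !subrr !add0r.
have i2 : 'i * 'i = -1 :> C by rewrite -expr2 sqrCi.
have -> : ((x + w) ^+ 2 - x ^+ 2) / 2 = x * w + w ^+ 2 / 2 by field.
have -> : ((y + h) ^+ 2 - y ^+ 2) / 2 = y * h + h ^+ 2 / 2 by field.
rewrite !toCD !toCM.
transitivity (A * toC h * toC w * ('i - 'i) + 0 * ('i * 'i + 1 : C)); last first.
  by rewrite subrr mulr0 mul0r addr0.
ring.
Qed.

Lemma bdint_bound G x y w h (M : R) : sep_cont G -> 0 <= w -> 0 <= h ->
  (forall s t, x <= s <= x + w -> y <= t <= y + h -> rnorm (G s t) <= M) ->
  rnorm (bdint G x y w h) <= 4 * M * (w + h).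
Proof.
move=> [c1 c2] w0 h0 hM.
have xw : x <= x + w by rewrite lerDl.
have yh : y <= y + h by rewrite lerDl.
have ni (z : C) : rnorm ('i * z) = rnorm z.
  by rewrite cnormM /rnorm normCi mul1r.
have hor t : y <= t <= y + h -> rnorm (cint (fun s => G s t) x (x + w)) <= 2 * M * w.
  move=> ht; apply: le_trans (cint_norm xw (c1 t) (fun s hs => hM s t hs ht)) _.
  by rewrite addrAC subrr add0r.
have ver s : x <= s <= x + w -> rnorm (cint (G s) y (y + h)) <= 2 * M * h.
  move=> hs; apply: le_trans (cint_norm yh (c2 s) (fun t ht => hM s t hs ht)) _.
  by rewrite addrAC subrr add0r.
have h1 := hor y; have h2 := hor (y + h); have v1 := ver x; have v2 := ver (x + w).
rewrite !lexx ?xw ?yh /= in h1 h2 v1 v2.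
apply: le_trans (rnormB _ _) _; rewrite ni.
have := rnormB (cint (fun s => G s y) x (x + w) + 'i * cint (G (x + w)) y (y + h))
  (cint (fun s => G s (y + h)) x (x + w)).
have := rnormD (cint (fun s => G s y) x (x + w)) ('i * cint (G (x + w)) y (y + h)).
rewrite ni; move: (h1 isT) (h2 isT) (v1 isT) (v2 isT); lra.
Qed.

Lemma bdintB G L x y w h : sep_cont G -> sep_cont L ->
  bdint (fun s t => G s t - L s t) x y w h = bdint G x y w h - bdint L x y w h.
Proof.
move=> [g1 g2] [l1 l2].
rewrite /bdint !cintB//; ring.
Qed.

(** Complex differentiability at [p + i q], with the increment split into
    real and imaginary parts. *)
Definition diff_at G p q := exists A : C, forall e, 0 < e -> exists2 d, 0 < d &
  forall s t, `|s - p| < d -> `|t - q| < d ->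
    rnorm (G s t - G p q - A * cpt (s - p) (t - q)) <= e * (`|s - p| + `|t - q|).

Lemma affine_cont (k A : C) : sep_cont (fun s t => k + A * cpt s t).
Proof.
split=> [t s|s t]; apply: cvgD; try exact: cvg_cst; apply: cvgMl_tmp; apply: cvgD;
  try exact: cvg_cst; first exact: toC_cont.
by apply: cvgMl_tmp; exact: toC_cont.
Qed.

Lemma sep_contB G L : sep_cont G -> sep_cont L -> sep_cont (fun s t => G s t - L s t).
Proof.
move=> [g1 g2] [l1 l2]; split=> [t s|s t].
  exact: (cvgB (g1 t s) (l1 t s)).
exact: (cvgB (g2 s t) (l2 s t)).
Qed.

(** Subtracting the affine approximation does not change the boundary
    integral, by [bdint_affine]; what remains is small compared with the
    diameter. *)
Lemma bdint_local G p q e : sep_cont G -> diff_at G p q -> 0 < e ->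
  exists2 d, 0 < d & forall x y w h, 0 <= w < d -> 0 <= h < d ->
    x <= p <= x + w -> y <= q <= y + h ->
    rnorm (bdint G x y w h) <= 4 * (e * (w + h)) * (w + h).
Proof.
move=> cG [A hA] e0; have [d d0 hd] := hA e e0; exists d => // x y w h.
move=> /andP[w0 wd] /andP[h0 hh] /andP[xp px] /andP[yq qy].
pose L s t := (G p q - A * cpt p q) + A * cpt s t.
have cL : sep_cont L by exact: affine_cont.
have -> : bdint G x y w h = bdint (fun s t => G s t - L s t) x y w h.
  by rewrite bdintB// bdint_affine// subr0.
apply: (bdint_bound (sep_contB cG cL) w0 h0).
move=> s t /andP[xs sx] /andP[yt ty].
have sp : `|s - p| <= w by rewrite ler_norml; apply/andP; split; lra.
have tq : `|t - q| <= h by rewrite ler_norml; apply/andP; split; lra.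
have -> : G s t - L s t = G s t - G p q - A * cpt (s - p) (t - q).
  by rewrite /L /cpt !toCB; ring.
apply: le_trans (hd s t _ _) _; [exact: le_lt_trans wd|exact: le_lt_trans hh|].
by rewrite ler_pM2l// lerD.
Qed.

Lemma bisect_limit (X : nat -> R) (W : R) : 0 <= W ->
  (forall n, X n <= X n.+1 /\ X n.+1 + W / 2 ^+ n.+1 <= X n + W / 2 ^+ n) ->
  exists p, forall n, X n <= p <= X n + W / 2 ^+ n.
Proof.
move=> W0 hX.
have mono : {homo X : m n / (m <= n)%N >-> m <= n}.
  by apply: homo_leq => [//|a b c ab|n]; [exact: le_trans ab|case: (hX n)].
have anti m n : (m <= n)%N -> X n + W / 2 ^+ n <= X m + W / 2 ^+ m.
  elim: n => [|n IH]; first by rewrite leqn0 => /eqP ->.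
  rewrite leq_eqVlt ltnS => /predU1P[->//|/IH]; apply: le_trans; by case: (hX n).
have Wn n : 0 <= W / 2 ^+ n by rewrite divr_ge0// exprn_ge0.
have cross m n : X m <= X n + W / 2 ^+ n.
  case: (leqP m n) => mn.
    by apply: le_trans (mono _ _ mn) _; rewrite lerDl.
  by apply: le_trans (anti _ _ (ltnW mn)); rewrite lerDl.
exists (sup (range X)) => n; apply/andP; split.
  by apply: ub_le_sup; [exists (X 0%N + W / 2 ^+ 0) => _ [m _ <-]; exact: cross|exists n].
by apply: ge_sup; [exists (X 0%N); exists 0%N|move=> _ [m _ <-]; exact: cross].
Qed.

Lemma quarter_large (E : R) (a b c d : C) : E + E + E + E <= rnorm (a + b + c + d) ->
  [\/ E <= rnorm a, E <= rnorm b, E <= rnorm c | E <= rnorm d].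
Proof.
have [|a1] := leP E (rnorm a); first by constructor 1.
have [|b1] := leP E (rnorm b); first by constructor 2.
have [|c1] := leP E (rnorm c); first by constructor 3.
have [|d1] := leP E (rnorm d); first by constructor 4.
have := rnormD (a + b + c) d; have := rnormD (a + b) c; have := rnormD a b; lra.
Qed.

(** Goursat's argument: if the integral over the boundary of a rectangle were
    not [0], repeated bisection would find rectangles shrinking to a point whose
    boundary integrals are at least a fixed multiple of their area, which
    [bdint_local] excludes. *)
Lemma goursat G x y w h : sep_cont G -> 0 < w -> 0 < h ->
  (forall p q, x <= p <= x + w -> diff_at G p q) -> bdint G x y w h = 0.
Proof.
move=> cG w0 h0 dG; apply/eqP; apply: contraT => J0.
pose eta := rnorm (bdint G x y w h).
have eta0 : 0 < eta by exact: rnorm_gt0.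
pose J n (z : R * R) := rnorm (bdint G z.1 z.2 (w / 2 ^+ n) (h / 2 ^+ n)).
have two n : 0 < 2 ^+ n :> R by rewrite exprn_gt0.
have half (u : R) n : u / 2 ^+ n = u / 2 ^+ n.+1 + u / 2 ^+ n.+1.
  by rewrite exprS invfM; field; rewrite expf_neq0// pnatr_eq0.
have step n (z : R * R) : exists z' : R * R, eta / 4 ^+ n <= J n z ->
    [/\ z.1 <= z'.1, z'.1 + w / 2 ^+ n.+1 <= z.1 + w / 2 ^+ n,
        z.2 <= z'.2, z'.2 + h / 2 ^+ n.+1 <= z.2 + h / 2 ^+ n &
        eta / 4 ^+ n.+1 <= J n.+1 z'].
  have [hJ|hJ] := boolP (eta / 4 ^+ n <= J n z); last by exists z.
  set w' := w / 2 ^+ n.+1; set h' := h / 2 ^+ n.+1.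
  have w'0 : 0 <= w' by rewrite divr_ge0 ?ltW.
  have h'0 : 0 <= h' by rewrite divr_ge0 ?ltW.
  have e4 : eta / 4 ^+ n = eta / 4 ^+ n.+1 + eta / 4 ^+ n.+1 +
     eta / 4 ^+ n.+1 + eta / 4 ^+ n.+1.
    by rewrite exprS invfM; field; rewrite expf_neq0// pnatr_eq0.
  have : [\/ eta / 4 ^+ n.+1 <= J n.+1 z, eta / 4 ^+ n.+1 <= J n.+1 (z.1 + w', z.2),
      eta / 4 ^+ n.+1 <= J n.+1 (z.1, z.2 + h') |
      eta / 4 ^+ n.+1 <= J n.+1 (z.1 + w', z.2 + h')].
    by apply: quarter_large; move: hJ; rewrite e4 /J !(half _ n) bdint_quarter.
  rewrite !(half _ n) -/w' -/h'.
  by case=> hz; [exists z|exists (z.1 + w', z.2)|exists (z.1, z.2 + h')|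
    exists (z.1 + w', z.2 + h')] => _; split; rewrite /= -?addrA ?lerD2l ?lerDl.
pose f n := projT1 (choice (step n)).
have hf n := projT2 (choice (step n)).
(* The lower left corners of the nested rectangles. *)
pose Z := fix Z n := if n is m.+1 then f m (Z m) else (x, y).
have ZJ n : eta / 4 ^+ n <= J n (Z n).
  elim: n => [|n IH]; first by rewrite /J /= !expr0 !divr1.
  by case: (hf n (Z n) IH).
have [p hp] := @bisect_limit (fun n => (Z n).1) w (ltW w0)
  (fun n => let: And5 a b _ _ _ := hf n (Z n) (ZJ n) in conj a b).
have [q hq] := @bisect_limit (fun n => (Z n).2) h (ltW h0)
  (fun n => let: And5 _ _ a b _ := hf n (Z n) (ZJ n) in conj a b).
have := hp 0%N; rewrite /= expr0 divr1 => /(dG p q) dpq.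
pose e := eta / (8 * (w + h) ^+ 2).
have wh0 : 0 < w + h by rewrite addr_gt0.
have e0 : 0 < e by rewrite divr_gt0// mulr_gt0// exprn_gt0.
have [d d0 hd] := bdint_local cG dpq e0.
have [n hn] : exists n, (w + h) / 2 ^+ n < d.
  exists (Num.bound ((w + h) / d)); rewrite ltr_pdivrMr// mulrC -ltr_pdivrMr//.
  apply: lt_trans (archi_boundP _) _; first by rewrite divr_ge0// ltW.
  by rewrite -natrX ltr_nat ltn_expl.
have wn : 0 <= w / 2 ^+ n < d.
  rewrite divr_ge0 ?ltW//= (le_lt_trans _ hn)// ler_pM2r ?invr_gt0//; lra.
have hhn : 0 <= h / 2 ^+ n < d.
  rewrite divr_ge0 ?ltW//= (le_lt_trans _ hn)// ler_pM2r ?invr_gt0//; lra.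
have := le_trans (ZJ n) (hd _ _ _ _ wn hhn (hp n) (hq n)).
have -> : 4 * (e * (w / 2 ^+ n + h / 2 ^+ n)) * (w / 2 ^+ n + h / 2 ^+ n) =
    (eta / 4 ^+ n) / 2.
  have -> : 4 ^+ n = 2 ^+ n * 2 ^+ n :> R by rewrite -exprMn -natrM.
  rewrite /e; field; rewrite ?expf_neq0 ?pnatr_eq0//= gt_eqF//.
rewrite -subr_ge0; have : 0 < eta / 4 ^+ n by rewrite divr_gt0// exprn_gt0.
lra.
Qed.

End Goursat.

Section DiscAlgebra.
Variable R : realType.
Local Notation C := (Cx R).
Implicit Types (s t u v e d x y : R).

Lemma derive_eps (f : R -> R) x l : is_derive x 1 f l ->
  forall e, 0 < e -> exists2 d, 0 < d &
    forall h, `|h| < d -> `|f (x + h) - f x - l * h| <= e * `|h|.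
Proof.
move=> [df dl] e e0.
have : (fun h => h^-1 *: ((f \o shift x) (h *: 1) - f x)) @ 0^' --> l by rewrite -dl; exact: df.
move=> /cvgrPdist_lt/(_ e e0)[d /= d0 hd]; exists d => // h hhd.
have [->|h0] := eqVneq h 0; first by rewrite addr0 mulr0 subrr sub0r normrN !normr0 mulr0.
have := hd h; rewrite /ball_/= sub0r normrN => /(_ hhd h0) /ltW.
rewrite /GRing.scale /= mulr1 => hl'.
have -> : f (x + h) - f x - l * h = - (h * (l - h^-1 * (f (h + x) - f x))).
  by rewrite [h + x]addrC; field.
by rewrite normrN normrM mulrC ler_wpM2r.
Qed.

Lemma cderive_eps (f : C -> C) (z : C) : derivable f z 1 -> exists l : C,
  forall e, 0 < e -> exists2 d, 0 < d &
    forall h : C, rnorm h < d -> rnorm (f (z + h) - f z - l * h) <= e * rnorm h.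
Proof.
move=> /cvg_ex[l hl]; exists l => e e0.
have /cvgrPdist_lt/(_ (toC e)) := hl; rewrite toC_gt0 => /(_ e0)[d0 /= /Cx_gt0[-> d0p] hd].
exists (complex.Re d0) => // h hhd.
have [->|h0] := eqVneq h 0; first by rewrite addr0 mulr0 !subrr ?subr0 rnorm0 mulr0.
have := hd h; rewrite /ball_/= sub0r normrN rnormE toC_lt => /(_ hhd h0).
rewrite rnormE toC_lt => /ltW.
rewrite /GRing.scale /= mulr1 => hl'.
have -> : f (z + h) - f z - l * h = - (h * (l - h^-1 * (f (h + z) - f z))).
  by rewrite [h + z]addrC; field.
by rewrite rnormN cnormM mulrC ler_wpM2r ?rnorm_ge0.
Qed.

Definition cis t : C := (cos t +i* sin t)%C.

Lemma cis_norm t : rnorm (cis t) = 1.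
Proof.
apply/eqP; rewrite -(@eqrXn2 _ 2) ?rnorm_ge0//.
by rewrite cnorm_sq /= cos2Dsin2 expr1n.
Qed.

Lemma cis_cont : continuous cis.
Proof.
move=> t; apply: cvg_complex => /=; [exact: continuous_cos|exact: continuous_sin].
Qed.

Lemma cisD s t : cis (s + t) = cis s * cis t.
Proof. by apply: Cx_ext; rewrite ?ReM ?ImM /= ?cosD ?sinD //; ring. Qed.

Lemma cis2pi t : cis (t + pi *+ 2) = cis t.
Proof. by rewrite /cis cosD2pi sinD2pi. Qed.

Definition ccirc t : circle R := circle_pt (cis_norm t).

Lemma ccircE t : set_val (ccirc t) = cis t. Proof. exact: circle_ptE. Qed.

Lemma ccirc_cont (f : circle R -> C) : continuous f -> continuous (fun t => f (ccirc t)).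
Proof.
move=> cf t; apply/rcvgP => e /((circle_contP f (ccirc t)).1 (cf _))[d d0 hd].
have /rcvgP/(_ d d0) := @cis_cont t; apply: filterS => s hs.
by apply: hd; rewrite !ccircE.
Qed.

(** The complex exponential in real coordinates: [s] is the logarithm of the
    radius and [t] the angle. *)
Definition ecis s t : C := toC (expR s) * cis t.

Lemma ecis_norm s t : rnorm (ecis s t) = expR s.
Proof. by rewrite cnormM cis_norm mulr1 cnorm_toC ger0_norm ?expR_ge0. Qed.

Lemma ecisD s t u v : ecis (s + u) (t + v) = ecis s t * ecis u v.
Proof. by rewrite /ecis expRD toCM cisD; ring. Qed.

(** The complex derivative of the exponential at [0] is [1]. *)
Lemma ecis_diff0 e : 0 < e -> exists2 d, 0 < d & forall u v, `|u| < d -> `|v| < d ->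
  rnorm (ecis u v - 1 - cpt u v) <= e * (`|u| + `|v|).
Proof.
move=> e0.
have e50 : 0 < e / 5 by rewrite divr_gt0.
have [d1 d10 h1] := derive_eps (@is_derive_expR R 0) e50.
have [d2 d20 h2] := derive_eps (@is_derive_cos R 0) e50.
have [d3 d30 h3] := derive_eps (@is_derive_sin R 0) e50.
have [d4 d40 h4] := derive_eps (@is_derive_expR R 0) ltr01.
pose d := Num.min (Num.min d1 d2) (Num.min (Num.min d3 d4) (Num.min (1/2) (e / 5 / 2))).
exists d.
  by rewrite !lt_min d10 d20 d30 d40 /= !divr_gt0.
move=> u v; rewrite /d !lt_min => /andP[/andP[u1 u2] /andP[/andP[u3 u4] /andP[u5 u6]]].
move=> /andP[/andP[v1 v2] /andP[/andP[v3 v4] /andP[v5 v6]]].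
have := h1 u u1; rewrite add0r expR0 mul1r => hu.
have := h2 v v2; rewrite add0r cos0 sin0 oppr0 mul0r subr0 => hc.
have := h3 v v3; rewrite add0r cos0 sin0 mul1r subr0 => hs.
have := h4 u u4; rewrite add0r expR0 !mul1r => hx.
have eu : `|expR u - 1| <= 2 * `|u|.
  rewrite (_ : expR u - 1 = (expR u - 1 - u) + u); last by ring.
  by apply: le_trans (ler_normD _ _) _; lra.
have e2 : expR u <= 2.
  have := ler_norm (expR u - 1); lra.
have ex0 := expR_ge0 u.
apply: le_trans (cnorm_le _) _.
have -> : complex.Re (ecis u v - 1 - cpt u v) = expR u * (cos v - 1) + (expR u - 1 - u).
  rewrite /ecis /cpt -toC1 !ReD !ReN ReD !ReM -!complexiE /=; ring.
have -> : complex.Im (ecis u v - 1 - cpt u v) = expR u * (sin v - v) + (expR u - 1) * v.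
  rewrite /ecis /cpt -toC1 !ImD !ImN ImD !ImM -!complexiE /=; ring.
have A1 := ler_normD (expR u * (cos v - 1)) (expR u - 1 - u).
have A2 := ler_normD (expR u * (sin v - v)) ((expR u - 1) * v).
rewrite !normrM !(ger0_norm ex0) in A1 A2.
have B1 : expR u * `|cos v - 1| <= 2 * (e / 5 * `|v|) by apply: ler_pM.
have B2 : expR u * `|sin v - v| <= 2 * (e / 5 * `|v|) by apply: ler_pM.
have B3 : `|expR u - 1| * `|v| <= (e / 5) * `|v|.
  by apply: ler_wpM2r => //; lra.
have v0 := normr_ge0 v; have u0 := normr_ge0 u.
have eu0 := mulr_ge0 (ltW e0) u0.
apply: le_trans (lerD A1 A2) _; lra.
Qed.

Section DiscFunction.
Variable f : C -> C.
Hypothesis fA : disc_algebra R f.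

Lemma disc_cont (z : C) : rnorm z <= 1 -> forall e, 0 < e -> exists2 d, 0 < d &
  forall w, rnorm w <= 1 -> rnorm (z - w) < d -> rnorm (f z - f w) < e.
Proof.
move=> z1 e e0; have /subspace_continuousP/(_ z) := fA.1.
have Az (w : C) : rnorm w <= 1 -> [set z : C | `|z| <= 1] w.
  by move=> h /=; rewrite rnormE -toC1 toC_le.
move=> /(_ (Az z z1)) /rcvgP/(_ e e0).
move=> /(@rnbhsP R C z)[d d0 hd]; exists d => // w w1 zw.
exact: (hd w zw (Az w w1)).
Qed.

Lemma disc_unif e : 0 < e -> exists2 d, 0 < d & forall z w : C, rnorm z <= 1 ->
  rnorm w <= 1 -> rnorm (z - w) < d -> rnorm (f z - f w) < e.
Proof.
move=> e0; have e20 : 0 < e / 2 by rewrite divr_gt0.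
pose P d (z : C) := rnorm z <= 1 -> forall w, rnorm w <= 1 ->
  rnorm (z - w) < d -> rnorm (f z - f w) < e.
have /compact_near_coveringP/(_ _ (0^'+)%R P) := @compact_disc R 1.
case=> [z z1|d /= d0 h].
  have [d d0 hd] := disc_cont z1 e20.
  have d20 : 0 < d / 2 by rewrite divr_gt0.
  exists ([set z' | rnorm (z - z') < d / 2], [set x | 0 < x < d / 2]).
    split => /=.
      by apply/(@rnbhsP R C z); exists (d / 2).
    by exists (d / 2) => //= x; rewrite /= sub0r normrN => xd x0; rewrite x0 -(gtr0_norm x0).
  move=> [z' x] /= [zz' /andP[x0 xd]] z'1 w w1 zw.
  rewrite (splitr e) (le_lt_trans (rnorm_distD (f z) _ _))// ltrD//.
    by rewrite rnormC hd// (lt_le_trans zz')// ler_pdivrMr// ler_pMr// ler1n.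
  apply: hd => //; rewrite (le_lt_trans (rnorm_distD z' _ _))//.
  by rewrite (splitr d) ltrD// (lt_trans zw).
exists (d / 2) => [|z w z1 w1 zw]; first by rewrite divr_gt0.
by apply: (h (d / 2)) => //=; rewrite ?divr_gt0// sub0r normrN gtr0_norm ?divr_gt0// ltr_pdivrMr// ltr_pMr// ltr1n.
Qed.

(** The function in logarithmic polar coordinates. Truncating [s] at [0]
    keeps the argument in the closed disc, so that the boundary integrals
    make sense for all [s]; it changes nothing for [s < 0], where
    differentiability is used. *)
Definition polar s t : C := f (ecis (Num.min s 0) t).

Lemma ecis_disc s t : rnorm (ecis (Num.min s 0) t) <= 1.
Proof. by rewrite ecis_norm -expR0 ler_expR ge_min lexx orbT. Qed.

Lemma disc_comp_cont (h : R -> C) : continuous h -> (forall x, rnorm (h x) <= 1) ->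
  continuous (fun x => f (h x)).
Proof.
move=> ch h1 x; apply/rcvgP => e /(disc_cont (h1 x))[d d0 hd].
have /rcvgP/(_ d d0) := ch x; apply: filterS => y hy; exact: hd.
Qed.

Lemma polar_cont : sep_cont polar.
Proof.
split=> [t|s]; apply: disc_comp_cont; try by move=> x; exact: ecis_disc.
  move=> x; apply: cvgMr_tmp.
  apply: (@continuous_comp _ _ _ (fun s => expR (Num.min s 0)) (@toC R)); last exact: toC_cont.
  apply: (@continuous_comp _ _ _ (fun s => Num.min s 0) (@expR R)); last exact: continuous_expR.
  by apply: continuous_min; [exact: cvg_id|exact: cvg_cst].
by move=> x; apply: cvgMl_tmp; exact: cis_cont.
Qed.

Lemma polar_diff p q : p < 0 -> diff_at polar p q.
Proof.
move=> p0; pose z := ecis p q.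
have nz : rnorm z = expR p by exact: ecis_norm.
have z1 : rnorm z < 1 by rewrite nz -expR0 ltr_expR.
have /cderive_eps[l hl] : derivable f z 1 by apply: fA.2; rewrite rnormE -toC1 toC_lt.
exists (l * z) => e e0.
have e1 : 0 < e / 2 / (rnorm l + 1) by rewrite !divr_gt0// ltr_wpDl ?rnorm_ge0.
have e2 : 0 < e / 4 by rewrite divr_gt0.
have [d1 d10 h1] := ecis_diff0 e1.
have [d2 d20 h2] := hl _ e2.
have [d3 d30 h3] := ecis_diff0 (@ltr01 R).
pose d := Num.min (Num.min d1 (d2 / 4)) (Num.min d3 (- p)).
exists d; first by rewrite !lt_min d10 d30 divr_gt0// oppr_gt0.
move=> s t; rewrite /d !lt_min => /andP[/andP[s1 s2] /andP[s3 s4]].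
move=> /andP[/andP[t1 t2] /andP[t3 t4]].
have sneg : s < 0 by have := ler_norm (s - p); lra.
rewrite /polar (min_l (ltW sneg)) (min_l (ltW p0)) -/z.
set u := s - p in s1 s2 s3 s4 *; set v := t - q in t1 t2 t3 t4 *.
have -> : ecis s t = z + z * (ecis u v - 1).
  by rewrite mulrBr mulr1 -ecisD addrC subrK /u /v ![_ + (_ - _)]addrC !subrK.
set k := z * (ecis u v - 1).
have cn : rnorm (cpt u v) <= `|u| + `|v|.
  rewrite /cpt; apply: le_trans (rnormD _ _) _.
  by rewrite cnormM !cnorm_toC /rnorm normCi mul1r.
have nk : rnorm k <= 2 * (`|u| + `|v|).
  rewrite /k cnormM; apply: (@le_trans _ _ (1 * rnorm (ecis u v - 1))).
    by rewrite ler_wpM2r ?rnorm_ge0// ltW.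
  rewrite mul1r -(subrK (cpt u v) (ecis u v - 1)).
  apply: le_trans (rnormD _ _) _; have := h3 u v s3 t3; lra.
have kd : rnorm k < d2 by lra.
have -> : f (z + k) - f z - l * z * cpt u v =
   (f (z + k) - f z - l * k) + l * z * (ecis u v - 1 - cpt u v).
  by rewrite /k; ring.
apply: le_trans (rnormD _ _) _; rewrite (cnormM (l * z)) (cnormM l z).
have A := h2 k kd.
have B : rnorm l * rnorm z * rnorm (ecis u v - 1 - cpt u v) <= e / 2 * (`|u| + `|v|).
  apply: (@le_trans _ _ ((rnorm l + 1) * (e / 2 / (rnorm l + 1) * (`|u| + `|v|)))).
    apply: ler_pM; rewrite ?mulr_ge0 ?rnorm_ge0//; last exact: h1.
    by have := ltW z1; have := rnorm_ge0 l; have := rnorm_ge0 z; nra.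
  have r1 : rnorm l + 1 != 0 by rewrite gt_eqF// ltr_wpDl ?rnorm_ge0.
  by rewrite le_eqVlt; apply/orP; left; apply/eqP; field.
have nk' := ler_wpM2l (ltW e2) nk.
apply: le_trans (lerD A B) _; lra.
Qed.

Definition circ_int s : C := cint (polar s) 0 (pi *+ 2).

(** Integrate over the boundary of a rectangle of height one full turn: the
    two horizontal sides cancel by periodicity. *)
Lemma circ_int_cst x y : x < y -> y < 0 -> circ_int x = circ_int y.
Proof.
move=> xy y0; have pi0 : 0 < pi *+ 2 :> R by rewrite mulrn_wgt0 ?pi_gt0.
have sx : x + (y - x) = y by rewrite addrC subrK.
have yx0 : 0 < y - x by rewrite subr_gt0.
have : bdint polar x 0 (y - x) (pi *+ 2) = 0.
  have g := @goursat R polar x 0 (y - x) (pi *+ 2) polar_cont yx0 pi0.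
  apply: g => p q; rewrite sx => /andP[_ py].
  exact: polar_diff (le_lt_trans py y0).
rewrite /bdint sx add0r -/(circ_int x) -/(circ_int y).
have -> : (fun s => polar s (pi *+ 2)) = (fun s => polar s 0).
  by apply/funext => s; rewrite /polar /ecis -[pi *+ 2]add0r cis2pi.
have key (a b c : C) : a + b - a - c = 0 -> b - c = 0.
  by move=> <-; ring.
move=> /key; rewrite -mulrBr.
move=> /eqP; rewrite mulf_eq0 (negbTE (neq0Ci _)) /= subr_eq0.
by move=> /eqP ->.
Qed.

Lemma circ_int_near x (k : R -> C) e : continuous k ->
  (forall t, rnorm (polar x t - k t) <= e) ->
  rnorm (circ_int x - cint k 0 (pi *+ 2)) <= 2 * e * (pi *+ 2).
Proof.
move=> ck h; have pi0 : 0 <= pi *+ 2 :> R by rewrite mulrn_wge0 ?pi_ge0.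
rewrite /circ_int -(cintB _ _ (polar_cont.2 x) ck).
have contB : continuous (fun t => polar x t - k t).
  by move=> t; exact: (cvgB (polar_cont.2 x t) (ck t)).
by have := cint_norm pi0 contB (fun t _ => h t); rewrite subr0.
Qed.

(** The mean value property: the integral of [f] over the circle of radius
    [expR s] does not depend on [s < 0] by [circ_int_cst]; it is close to the
    left hand side when the radius is close to [1], and to the right hand side
    when the radius is close to [0]. *)
Lemma mean_value : cint (fun t => f (cis t)) 0 (pi *+ 2) = toC (pi *+ 2) * f 0.
Proof.
have pi0 : 0 < pi *+ 2 :> R by rewrite mulrn_wgt0 ?pi_gt0.
have le_half (r : R) : 0 < r -> r <= r / 2 -> False by lra.
have same_int u v : u < 0 -> v < 0 -> circ_int u = circ_int v.
  move=> u0 v0; case: (ltgtP u v) => [uv|vu|->//]; first exact: circ_int_cst uv v0.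
  exact: esym (circ_int_cst vu u0).
have e0E : cint (fun t => f (cis t)) 0 (pi *+ 2) = circ_int 0.
  by congr cint; apply/funext => t; rewrite /polar minxx /ecis expR0 toC1 mul1r.
rewrite e0E; apply/eqP; rewrite -subr_eq0; apply: contraT => ne0.
set D := _ - _ in ne0; have D0 : 0 < rnorm D by exact: rnorm_gt0.
pose e := rnorm D / (8 * (pi *+ 2)).
have e0 : 0 < e by rewrite divr_gt0// mulr_gt0.
have [d d0 hd] := disc_unif e0.
pose m := Num.min d 1 / 2.
have m0 : 0 < m by rewrite divr_gt0// lt_min d0 ltr01.
have md : m < d by rewrite /m ltr_pdivrMr// (@le_lt_trans _ _ d)// ?ge_min ?lexx// ltr_pMr// ltr1n.
have m1 : m < 1 by rewrite /m ltr_pdivrMr// (@le_lt_trans _ _ 1)// ?ge_min ?lexx ?orbT// mul1r ltr1n.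
have om0 : 0 < 1 - m by rewrite subr_gt0.
have near1 (r : R) x : 0 < r -> r < 1 -> x = ln r -> x < 0 /\ expR x = r.
  move=> r0 r1 ->; split; last by rewrite lnK.
  by rewrite -ln1 ltr_ln ?posrE.
have [y0 Ey] := near1 (1 - m) _ om0 (ltac:(lra)) erefl; set y := ln (1 - m) in y0 Ey.
have [x0 Ex] := near1 m _ m0 m1 erefl; set x := ln m in x0 Ex.
have same : circ_int x = circ_int y := same_int _ _ x0 y0.
have Hx : rnorm (circ_int x - cint (fun=> f 0) 0 (pi *+ 2)) <= 2 * e * (pi *+ 2).
  apply: circ_int_near => [|t]; first exact: cst_continuous.
  have n0 : rnorm (0 : C) <= 1 by rewrite rnorm0.
  apply: (ltW (hd _ _ (ecis_disc x t) n0 _)).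
  by rewrite subr0 ecis_norm (min_l (ltW x0)) Ex.
have Hy : rnorm (circ_int y - circ_int 0) <= 2 * e * (pi *+ 2).
  apply: circ_int_near => [|t]; first exact: polar_cont.2.
  apply: (ltW (hd _ _ (ecis_disc y t) (ecis_disc 0 t) _)).
  rewrite (min_l (ltW y0)) minxx /ecis expR0 -mulrBl cnormM cis_norm mulr1 -toCB cnorm_toC Ey.
  have -> : 1 - m - 1 = - m by ring.
  by rewrite normrN (gtr0_norm m0).
rewrite (cint_cst (f 0) (ltW pi0)) subr0 [f 0 * _]mulrC in Hx.
have : rnorm D <= 2 * e * (pi *+ 2) + 2 * e * (pi *+ 2).
  rewrite /D -(subrKA (circ_int y)); apply: le_trans (rnormD _ _) _; apply: lerD.
    by rewrite rnormC.
  by rewrite -same.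
have gen (r P : R) : P != 0 -> 2 * (r / (8 * P)) * P + 2 * (r / (8 * P)) * P = r / 2.
  by move=> P0; field.
rewrite /e (gen _ _ (lt0r_neq0 pi0)) => h.
by case: (le_half _ D0 h).
Qed.

End DiscFunction.
End DiscAlgebra.

(** * Fourier coefficients on the circle *)

Section Mean.
Variable R : realType.
Local Notation C := (Cx R).
Local Notation CT := (circle R -> C).
Local Notation twopi := (pi *+ 2 : R).
Implicit Types (u v : CT) (g h : circle R -> R).

Lemma twopi_gt0 : 0 < twopi. Proof. by rewrite mulrn_wgt0 ?pi_gt0. Qed.

(** Integration with respect to normalised arc length on the circle. *)
Definition mu u : C := toC (twopi^-1) * cint (fun t => u (ccirc t)) 0 twopi.
Definition mur g : R := twopi^-1 * rint (fun t => g (ccirc t)) 0 twopi.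

Lemma rccirc_cont g : continuous g -> continuous (fun t => g (ccirc t)).
Proof.
move=> cg; have := ccirc_cont (cont_toC cg) => h t.
exact: (cvg_Re (h t)).
Qed.

Lemma mu_lin (c : C) u v : continuous u -> continuous v ->
  mu (fun t => c * u t + v t) = c * mu u + mu v.
Proof.
move=> cu cv; rewrite /mu (cint_lin c _ _ (ccirc_cont cu) (ccirc_cont cv)); ring.
Qed.

Lemma mu0 : mu (fun=> 0) = 0.
Proof. by rewrite /mu cint_cst ?mul0r ?mulr0// ltW// twopi_gt0. Qed.

Lemma mu_cst c : mu (fun=> c) = c.
Proof.
rewrite /mu cint_cst ?(ltW twopi_gt0)// subr0 mulrCA -toCM mulVf ?toC1 ?mulr1//.
by rewrite gt_eqF// twopi_gt0.
Qed.

Lemma muZ (c : C) u : continuous u -> mu (fun t => c * u t) = c * mu u.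
Proof.
move=> cu; rewrite -[RHS]addr0 -mu0 -(mu_lin c cu (@cst_continuous _ _ (0 : C))).
by congr mu; apply/funext => t; rewrite addr0.
Qed.

Lemma muD u v : continuous u -> continuous v -> mu (fun t => u t + v t) = mu u + mu v.
Proof.
move=> cu cv; rewrite -[X in X + _]mul1r -(mu_lin 1 cu cv); congr mu.
by apply/funext => t; rewrite mul1r.
Qed.

Lemma muB u v : continuous u -> continuous v -> mu (fun t => u t - v t) = mu u - mu v.
Proof.
move=> cu cv; rewrite addrC -mulN1r -(mu_lin (-1) cv cu); congr mu.
by apply/funext => t; rewrite mulN1r addrC.
Qed.

Lemma mu_sum I (r : seq I) (F : I -> CT) : (forall i, continuous (F i)) ->
  mu (fun t => \sum_(i <- r) F i t) = \sum_(i <- r) mu (F i).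
Proof.
move=> cF; elim: r => [|i r IH].
  rewrite big_nil -[RHS]mu0; congr mu.
  by apply/funext => t; rewrite big_nil.
have cs : continuous (fun t => \sum_(j <- r) F j t).
  exact: cont_sum_fun.
rewrite big_cons -IH -(muD (cF i) cs).
by congr mu; apply/funext => t; rewrite big_cons.
Qed.

Lemma mu_toC g : mu (fun t => toC (g t)) = toC (mur g).
Proof. by rewrite /mu cint_toC -toCM. Qed.

Lemma mu_conj u : continuous u -> mu (conj_fun u) = (mu u)^*.
Proof.
move=> cu; rewrite /mu rmorphM /= toCJ; congr (_ * _).
apply: Cx_ext; rewrite ?ReJ ?ImJ /=.
  by congr rint; apply/funext => t; rewrite ReJ.
have cI := Im_cont (ccirc_cont cu).
rewrite -mulN1r -[RHS]addr0 -[X in _ + X](mul0r (twopi - 0)) -(rint_cst 0 (ltW twopi_gt0)).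
rewrite -(rint_lin _ _ _ cI (@cst_continuous _ _ (0 : R))); congr rint; apply/funext => t.
by rewrite ImJ mulN1r addr0.
Qed.

Lemma mur_ge0 g : (forall t, 0 <= g t) -> 0 <= mur g.
Proof.
by move=> g0; rewrite /mur mulr_ge0 ?invr_ge0 ?(ltW twopi_gt0)//; exact: rint_ge0.
Qed.

Lemma mur_lin (c : R) g h : continuous g -> continuous h ->
  mur (fun t => c * g t + h t) = c * mur g + mur h.
Proof.
move=> cg ch; rewrite /mur (rint_lin c _ _ (rccirc_cont cg) (rccirc_cont ch)); ring.
Qed.

Lemma mur_cst c : mur (fun=> c) = c.
Proof. by apply: toC_inj; rewrite -mu_toC mu_cst. Qed.

Lemma mur_le g h : continuous g -> continuous h -> (forall t, g t <= h t) -> mur g <= mur h.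
Proof.
move=> cg ch gh; rewrite /mur ler_wpM2l ?invr_ge0 ?(ltW twopi_gt0)//.
by apply: rint_le => //; exact: rccirc_cont.
Qed.

Lemma mu_norm u : continuous u -> rnorm (mu u) <= 2 * mur (fun t => rnorm (u t)).
Proof.
move=> cu; have cn := cnorm_cont cu.
have key (g : circle R -> R) : continuous g -> (forall t, `|g t| <= rnorm (u t)) ->
    `|mur g| <= mur (fun t => rnorm (u t)).
  move=> cg h; rewrite ler_norml; apply/andP; split.
    have <- : mur (fun t => -1 * rnorm (u t) + 0) = - mur (fun t => rnorm (u t)).
      by rewrite (mur_lin _ cn (@rcont_cst _ _ 0)) mur_cst addr0 mulN1r.
    apply: (mur_le (rcontD (rcontM (@rcont_cst _ _ _) cn) (@rcont_cst _ _ _)) cg) => t.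
    by rewrite addr0 mulN1r; have := h t; rewrite ler_norml => /andP[].
  by apply: (mur_le cg cn) => t; have := h t; rewrite ler_norml => /andP[].
have cRe : continuous (fun t => complex.Re (u t)) by move=> t; exact: (cvg_Re (cu t)).
have cIm : continuous (fun t => complex.Im (u t)) by move=> t; exact: (cvg_Im (cu t)).
apply: le_trans (cnorm_le _) _; rewrite mulr_natl mulr2n; apply: lerD.
  have -> : complex.Re (mu u) = mur (fun t => complex.Re (u t)).
    by rewrite /mu ReM Im_toC mul0r subr0.
  by apply: key => // t; exact: Re_le_cnorm.
have -> : complex.Im (mu u) = mur (fun t => complex.Im (u t)).
  by rewrite /mu ImM Im_toC mul0r addr0.
by apply: key => // t; exact: Im_le_cnorm.
Qed.

Lemma mu_bound u (M : R) : continuous u -> (forall t, rnorm (u t) <= M) ->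
  rnorm (mu u) <= 2 * M.
Proof.
move=> cu h; apply: le_trans (mu_norm cu) _; rewrite ler_pM2l//.
rewrite -[leRHS]mur_cst; exact: (mur_le (cnorm_cont cu) (@rcont_cst _ _ M)).
Qed.

Lemma mu_disc (f : C -> C) : disc_algebra R f -> mu (fun t => f (set_val t)) = f 0.
Proof.
move=> fA; rewrite /mu.
have -> : (fun t => f (set_val (ccirc t))) = (fun t => f (cis t)).
  by apply/funext => t; rewrite ccircE.
rewrite (mean_value fA) mulrA -toCM mulVf ?toC1 ?mul1r//.
by rewrite gt_eqF// twopi_gt0.
Qed.

Lemma disc_algebraM (f g : C -> C) : disc_algebra R f -> disc_algebra R g ->
  disc_algebra R (f * g).
Proof.
move=> [cf df] [cg dg]; split=> [z|z z1].
  by apply: cvgM; [exact: cf|exact: cg].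
by apply: derivableM; [exact: df|exact: dg].
Qed.

Lemma disc_algebra_cst (c : C) : disc_algebra R (cst c).
Proof. by split=> [z|z z1]; [exact: cvg_cst|exact: derivable_cst]. Qed.

Lemma disc_algebra_id : disc_algebra R id.
Proof.
split=> [|z z1]; last exact: derivable_id.
by apply: continuous_subspaceT => z; exact: cvg_id.
Qed.

Lemma disc_algebraX n : disc_algebra R (fun z => z ^+ n).
Proof.
elim: n => [|n IH]; first exact: disc_algebra_cst.
have -> : (fun z : C => z ^+ n.+1) = id * (fun z => z ^+ n).
  by apply/funext => z; rewrite exprS.
exact: disc_algebraM disc_algebra_id IH.
Qed.

(** The monomial, restricted to the circle; on the circle its conjugate is
    its inverse. *)
Definition zn n : CT := fun t => set_val t ^+ n.

Lemma zn_cont n : continuous (zn n).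
Proof.
elim: n => [|n IH]; first exact: (@cst_continuous _ _ (1 : C)).
have -> : zn n.+1 = (set_val : CT) * zn n by apply/funext => t; rewrite /zn exprS.
exact: contM (@circle_val_cont R) IH.
Qed.

Lemma zn_norm n t : rnorm (zn n t) = 1.
Proof. by rewrite /zn cnormX circle_norm expr1n. Qed.

Lemma znJ n t : (zn n t)^* * zn n t = 1.
Proof. by rewrite mulrC mulJ_cnorm zn_norm expr1n. Qed.

Lemma znD m n t : zn (m + n) t = zn m t * zn n t. Proof. exact: exprD. Qed.

Lemma mu_zn n : mu (zn n) = (n == 0%N)%:R.
Proof. by rewrite (mu_disc (disc_algebraX n)) expr0n. Qed.

Lemma mu_znJ m n : mu (fun t => zn m t * (zn n t)^*) = (m == n)%:R.
Proof.
have sub (a b : nat) : (b <= a)%N -> (fun t => zn a t * (zn b t)^*) = zn (a - b).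
  move=> ba; apply/funext => t; rewrite -{1}(subnK ba) znD -mulrA.
  by rewrite [zn b t * _]mulrC znJ mulr1.
case: (leqP n m) => nm; first by rewrite (sub _ _ nm) mu_zn subn_eq0 eqn_leq nm andbT.
have -> : (fun t => zn m t * (zn n t)^*) = conj_fun (fun t => zn n t * (zn m t)^*).
  by apply/funext => t; rewrite /conj_fun rmorphM /= conjCK mulrC.
rewrite mu_conj; last by rewrite (sub _ _ (ltnW nm)); exact: zn_cont.
rewrite (sub _ _ (ltnW nm)) mu_zn subn_eq0 leqNgt nm.
by rewrite rmorph0 ltn_eqF.
Qed.

End Mean.

(** * Fejer's theorem and the disc algebra as a uniform closure *)

Section Fejer.
Variable R : realType.
Local Notation C := (Cx R).
Local Notation CT := (circle R -> C).
Implicit Types (u v : CT) (p q : {poly C}).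

(** This is the disc algebra on the circle ([disc_algebra_TP]), in a form
    that makes closure under products and uniform limits evident. *)
Definition poly_approx u := forall e : R, 0 < e -> exists p : {poly C},
  forall t, rnorm (u t - p.[set_val t]) <= e.

(** The Fejer kernel, written with the rotated variable [t * conj s]. *)
Definition fejer (N : nat) (t s : circle R) : R :=
  N.+1%:R^-1 * rnorm (\sum_(i < N.+1) zn i t * (zn i s)^*) ^+ 2.

Lemma fejer_ge0 N t s : 0 <= fejer N t s.
Proof. by rewrite /fejer mulr_ge0 ?sqr_ge0// invr_ge0. Qed.

Lemma fejerE N t s : toC (fejer N t s) = toC N.+1%:R^-1 *
  \sum_(i < N.+1) \sum_(j < N.+1) (zn i t * (zn j t)^*) * (zn j s * (zn i s)^*).
Proof.
rewrite /fejer toCM -mulJ_cnorm; congr (_ * _).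
rewrite rmorph_sum mulr_suml; apply: eq_bigr => i _.
rewrite mulr_sumr; apply: eq_bigr => j _ /=.
rewrite rmorphM /= conjCK; ring.
Qed.

Lemma znJ_cont i : continuous (fun s => (zn i s : C)^*).
Proof. exact: cont_conj (@zn_cont R i). Qed.

Lemma fejer_cont N t : continuous (fejer N t).
Proof.
apply: rcontM (@rcont_cst _ _ _) _; apply: rcont_norm_sq; apply: cont_sum_fun => i.
exact: (contM_fun (@cont_cst_fun R _ (zn i t)) (@znJ_cont i)).
Qed.

Lemma fejer_mean N t : mur (fejer N t) = 1.
Proof.
apply: toC_inj; rewrite -mu_toC.
have -> : (fun s => toC (fejer N t s)) = (fun s => toC N.+1%:R^-1 *
  \sum_(i < N.+1) \sum_(j < N.+1) (zn i t * (zn j t)^*) * (zn j s * (zn i s)^*)).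
  by apply/funext => s; rewrite fejerE.
have cj i j : continuous (fun s => zn j s * (zn i s : C)^*).
  exact: (contM_fun (@zn_cont R j) (@znJ_cont i)).
have cij i j : continuous (fun s => (zn i t * (zn j t : C)^*) * (zn j s * (zn i s)^*)).
  exact: (contM_fun (@cont_cst_fun R _ (zn i t * (zn j t)^*)) (@cj i j)).
have ci i : continuous (fun s => \sum_(j < N.+1) (zn i t * (zn j t : C)^*) * (zn j s * (zn i s)^*)).
  by apply: cont_sum_fun => j; exact: (@cij i j).
rewrite muZ; last by apply: cont_sum_fun => i; exact: (@ci i).
rewrite mu_sum => [|i]; last exact: (@ci i).
rewrite (eq_bigr (fun=> 1)) => [|i _].
  by rewrite sumr_const card_ord toCV toC_nat mulVf// pnatr_eq0.
rewrite mu_sum => [|j]; last exact: (@cij i j).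
rewrite (bigD1 i)//= big1 ?addr0 => [|j ji]; rewrite (muZ _ (@cj i _)) mu_znJ.
  by rewrite eqxx mulr1 mulrC znJ.
by rewrite -[_ == _ :> nat]/(j == i) (negbTE ji) mulr0.
Qed.

(** The geometric sum telescopes after multiplication by [t - s]. *)
Lemma fejer_away N t s (d : R) : 0 < d -> d <= rnorm (set_val t - set_val s) ->
  fejer N t s <= 4 / (N.+1%:R * d ^+ 2).
Proof.
move=> d0 hd; pose w := set_val t * (set_val s)^*.
have nw : rnorm w = 1 by rewrite cnormM cnormJ !circle_norm mulr1.
have wd : d <= rnorm (w - 1).
  apply: le_trans hd _; rewrite -[leRHS]mulr1 -[X in _ * X](circle_norm s) -cnormM.
  rewrite mulrBl mul1r /w -mulrA [_^* * _]mulrC mulJ_cnorm circle_norm expr1n mulr1.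
  exact: lexx.
have -> : fejer N t s = N.+1%:R^-1 * rnorm (\sum_(i < N.+1) w ^+ i) ^+ 2.
  rewrite /fejer; congr (_ * rnorm _ ^+ 2); apply: eq_bigr => i _.
  by rewrite /zn /w exprMn rmorphXn.
have : rnorm ((w - 1) * \sum_(i < N.+1) w ^+ i) <= 2.
  rewrite -subrX1; apply: le_trans (rnormB _ _) _.
  by rewrite cnormX nw expr1n cnorm1.
rewrite cnormM; set S := rnorm (\sum_(i < _) _) => h.
have S0 : 0 <= S by exact: rnorm_ge0.
have dS : d * S <= 2 by apply: le_trans h; rewrite ler_wpM2r.
have N0 : 0 < N.+1%:R :> R by rewrite ltr0n.
rewrite invfM [leRHS]mulrCA ler_pM2l ?invr_gt0//.
rewrite ler_pdivlMr ?exprn_gt0// mulrC -exprMn.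
have -> : 4 = 2 ^+ 2 :> R by rewrite -natrX.
by rewrite ler_sqr ?nnegrE// mulr_ge0// ltW.
Qed.

(** Fejer's theorem: the kernel is a probability density ([fejer_mean]) that
    concentrates near [t] ([fejer_away]), uniformly in [t]. *)
Lemma fejer_approx u e : continuous u -> 0 < e -> exists N, forall t,
  rnorm (mu (fun s => u s * toC (fejer N t s)) - u t) <= e.
Proof.
move=> cu e0.
have [M M0 hM] := circle_bounded cu.
have e40 : 0 < e / 4 by rewrite divr_gt0.
have [d d0 hd] := circle_unif cu e40.
have [N hN] : exists N, 2 * M * (4 / (N.+1%:R * d ^+ 2)) <= e / 4.
  exists (Num.bound (32 * M / (e * d ^+ 2))).
  set N := Num.bound _.
  have h : 32 * M / (e * d ^+ 2) < N.+1%:R.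
    apply: lt_trans (archi_boundP _) _; last by rewrite ltr_nat.
    by rewrite divr_ge0 ?mulr_ge0 ?sqr_ge0// ltW.
  rewrite mulrA ler_pdivrMr ?mulr_gt0 ?exprn_gt0 ?ltr0n//.
  move: h; rewrite ltr_pdivrMr ?mulr_gt0 ?exprn_gt0// => /ltW h.
  rewrite -(ler_pM2l (ltr0n R 4 : 0 < 4)) .
  by move: h; set n := N.+1%:R; set D := d ^+ 2 => h; nra.
exists N => t.
pose K s := fejer N t s.
have cK : continuous K by exact: (@fejer_cont N t).
have cuK : continuous (fun s => u s * toC (K s)) by exact: contM_fun cu (cont_toC cK).
have cutK : continuous (fun s => u t * toC (K s)) by exact: contM_fun (@cont_cst_fun R _ (u t)) (cont_toC cK).
have -> : u t = mu (fun s => u t * toC (K s)).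
  by rewrite (muZ _ (cont_toC cK)) mu_toC fejer_mean mulr1.
rewrite -(muB cuK cutK); apply: le_trans (mu_norm (contB_fun cuK cutK)) _.
pose b := 2 * M * (4 / (N.+1%:R * d ^+ 2)).
have : mur (fun s => rnorm (u s * toC (K s) - u t * toC (K s))) <= mur (fun s => e / 4 * K s + b).
  apply: mur_le => [||s].
  - exact: cnorm_cont (contB_fun cuK cutK).
  - exact: rcontD (rcontM (@rcont_cst _ _ _) cK) (@rcont_cst _ _ _).
  rewrite -mulrBl cnormM cnorm_toC (ger0_norm (fejer_ge0 N t s)).
  have b0 : 0 <= b by rewrite !mulr_ge0// invr_ge0 mulr_ge0 ?sqr_ge0.
  have [st|st] := ltP (rnorm (set_val s - set_val t)) d.
    rewrite -[leLHS]addr0 lerD// ler_wpM2r ?fejer_ge0// ltW// hd//.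
  rewrite -[leLHS]add0r; apply: lerD; first exact: mulr_ge0 (ltW e40) (fejer_ge0 _ _ _).
  rewrite /b; apply: ler_pM; rewrite ?rnorm_ge0 ?fejer_ge0//.
    by apply: le_trans (rnormB _ _) _; rewrite mulr_natl mulr2n lerD.
  by apply: fejer_away => //; rewrite rnormC.
rewrite (mur_lin _ cK (@rcont_cst _ _ b)) fejer_mean mulr1 mur_cst => h.
have hb : b <= e / 4 by exact: hN.
apply: (@le_trans _ _ (2 * (e / 4 + b))); first by rewrite ler_pM2l.
by move: b hb {h} => b hb; lra.
Qed.

(** The Fejer mean of [u] at [t] is a trigonometric polynomial in [t]; its
    coefficients are the Fourier coefficients of [u] with triangular
    weights, here as a double sum. *)
Lemma fejer_trig u N t : continuous u ->
  mu (fun s => u s * toC (fejer N t s)) = \sum_(i < N.+1) \sum_(j < N.+1)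
    (toC N.+1%:R^-1 * mu (fun s => u s * (zn j s * (zn i s)^*))) * (zn i t * (zn j t)^*).
Proof.
move=> cu.
have cj i j : continuous (fun s => u s * (zn j s * (zn i s : C)^*)).
  exact: contM_fun cu (contM_fun (@zn_cont R j) (@znJ_cont i)).
have cij i j : continuous (fun s => (zn i t * (zn j t : C)^*) * (u s * (zn j s * (zn i s)^*))).
  exact: (contM_fun (@cont_cst_fun R _ (zn i t * (zn j t)^*)) (@cj i j)).
have ci i : continuous (fun s => \sum_(j < N.+1)
    (zn i t * (zn j t : C)^*) * (u s * (zn j s * (zn i s)^*))).
  by apply: cont_sum_fun => j; exact: (@cij i j).
have -> : (fun s => u s * toC (fejer N t s)) = (fun s => toC N.+1%:R^-1 *
  \sum_(i < N.+1) \sum_(j < N.+1) (zn i t * (zn j t)^*) * (u s * (zn j s * (zn i s)^*))).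
  apply/funext => s; rewrite fejerE mulrCA; congr (_ * _).
  rewrite mulr_sumr; apply: eq_bigr => i _; rewrite mulr_sumr; apply: eq_bigr => j _.
  by rewrite mulrCA.
rewrite muZ; last by apply: cont_sum_fun => i; exact: (@ci i).
rewrite mu_sum => [|i]; last exact: (@ci i).
rewrite mulr_sumr; apply: eq_bigr => i _.
rewrite mu_sum => [|j]; last exact: (@cij i j).
rewrite mulr_sumr; apply: eq_bigr => j _; rewrite (muZ _ (@cj i j)); ring.
Qed.

(** The Fejer means of [f] only involve the coefficients
    [mu (f * z^j * conj z^i)], which vanish for [j > i] by the mean value
    property of [f * z^(j - i)]. *)
Lemma disc_poly_approx u : disc_algebra_T R u -> poly_approx u.
Proof.
move=> [f fA <-]; pose u' : CT := fun t => f (set_val t).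
have cu : continuous u'.
  move=> t; apply/circle_contP => e e0.
  have t1 (s : circle R) : rnorm (set_val s) <= 1 by rewrite circle_norm.
  have [d d0 hd] := disc_cont fA (t1 t) e0; exists d => // s; exact: hd (t1 s).
move=> e e0; have [N hN] := fejer_approx cu e0.
pose c k : C := mu (fun s => u' s * (zn k s)^*).
pose p : {poly C} := \sum_(i < N.+1) \sum_(j < N.+1 | (j <= i)%N)
  (toC N.+1%:R^-1 * c (i - j)%N)%:P * 'X^(i - j).
exists p => t; rewrite rnormC; apply: le_trans (hN t); rewrite le_eqVlt; apply/orP; left.
apply/eqP; congr (rnorm (_ - _)).
rewrite (fejer_trig _ _ cu) /p horner_sum; apply: eq_bigr => i _.
rewrite horner_sum [RHS](bigID (fun j : 'I_N.+1 => (j <= i)%N)) /=.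
rewrite [X in _ = _ + X]big1 ?addr0 => [|j]; last first.
  rewrite -ltnNge => ij.
  suff -> : mu (fun s => u' s * (zn j s * (zn i s)^*)) = 0 by rewrite mulr0 mul0r.
  have -> : (fun s => u' s * (zn j s * (zn i s)^*)) =
      (fun s : circle R => (f * (fun z => z ^+ (j - i))) (set_val s)).
    apply/funext => s; rewrite -{1}(subnK (ltnW ij)) znD -mulrA [zn i s * _]mulrC.
    by rewrite znJ mulr1.
  rewrite (mu_disc (disc_algebraM fA (@disc_algebraX R (j - i)))).
  rewrite -[LHS]/(f 0 * 0 ^+ (j - i)) expr0n.
  by rewrite subn_eq0 leqNgt ij mulr0.
apply: eq_bigr => j ji; rewrite hornerM hornerC hornerXn.
have -> : zn i t * (zn j t)^* = set_val t ^+ (i - j).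
  rewrite -{1}(subnK ji) znD -mulrA [zn j t * _]mulrC.
  by rewrite znJ mulr1.
have -> : mu (fun s => u' s * (zn j s * (zn i s)^*)) = c (i - j)%N.
  congr mu; apply/funext => s; rewrite -{1}(subnK ji) znD rmorphM /=.
  by rewrite [zn j s * (_ * _)]mulrCA [zn j s * _]mulrC znJ mulr1.
by [].
Qed.

End Fejer.

Section PolyDisc.
Variable R : realType.
Local Notation C := (Cx R).
Local Notation CT := (circle R -> C).
Implicit Types (u v : CT) (p q : {poly C}).

Lemma horner_cont p : continuous (fun z : C => p.[z]).
Proof.
have cX i : continuous (fun z : C => z ^+ i).
  elim: i => [|i IH]; first exact: (@cont_cst_fun R C 1).
  have -> : (fun z : C => z ^+ i.+1) = (fun z => z * z ^+ i) by apply/funext => z; rewrite exprS.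
  have ci : continuous (id : C -> C) by move=> z; exact: cvg_id.
  exact: (contM_fun ci IH).
have -> : (fun z : C => p.[z]) = (fun z => \sum_(i < size p) p`_i * z ^+ i).
  by apply/funext => z; rewrite horner_coef.
by apply: cont_sum_fun => i; exact: (contM_fun (@cont_cst_fun R C p`_i) (@cX i)).
Qed.

Lemma horner_circle_cont p : continuous (fun t : circle R => p.[set_val t]).
Proof.
move=> t; apply: (@continuous_comp _ _ _ set_val (fun z => p.[z])).
  exact: (@circle_val_cont R).
exact: horner_cont.
Qed.

(** The exponentials are orthonormal. *)
Lemma poly_coef_mu p k : p`_k = mu (fun t => p.[set_val t] * (zn k t)^*).
Proof.
have cj i : continuous (fun t => zn i t * (zn k t : C)^*).
  exact: (contM_fun (@zn_cont R i) (@znJ_cont R k)).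
have -> : (fun t => p.[set_val t] * (zn k t)^*) =
    (fun t => \sum_(i < size p) p`_i * (zn i t * (zn k t)^*)).
  by apply/funext => t; rewrite horner_coef mulr_suml; apply: eq_bigr => i _; rewrite mulrA.
rewrite mu_sum => [|i]; last exact: (contM_fun (@cont_cst_fun R _ p`_i) (@cj i)).
have [kp|kp] := ltnP k (size p).
  rewrite (bigD1 (Ordinal kp))//= (muZ _ (@cj _)) mu_znJ eqxx mulr1 big1 ?addr0// => i ik.
  rewrite (muZ _ (@cj _)) mu_znJ; case: eqP => [e|_]; last by rewrite mulr0.
  by move: ik; rewrite -val_eqE /= e eqxx.
rewrite nth_default// big1// => i _; rewrite (muZ _ (@cj _)) mu_znJ.
by rewrite ltn_eqF ?mulr0// (leq_trans (ltn_ord i)).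
Qed.

(** The coefficients are at most [2 * M] by [poly_coef_mu], so the value is
    dominated by a geometric series. *)
Lemma poly_disc_bound p (M : R) (z : C) : 0 <= M ->
  (forall t : circle R, rnorm p.[set_val t] <= M) -> rnorm z < 1 ->
  rnorm p.[z] <= 2 * M / (1 - rnorm z).
Proof.
move=> M0 hM z1; have c0 : 0 < 1 - rnorm z by rewrite subr_gt0.
have hk k : rnorm p`_k <= 2 * M.
  rewrite poly_coef_mu; apply: mu_bound.
    exact: (contM_fun (@horner_circle_cont p) (@znJ_cont R k)).
  by move=> t; rewrite cnormM cnormJ zn_norm mulr1.
rewrite horner_coef; apply: le_trans (rnorm_sum _ _ _) _.
apply: (@le_trans _ _ (2 * M * \sum_(i < size p) rnorm z ^+ i)).
  rewrite mulr_sumr; apply: ler_sum => i _.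
  by rewrite cnormM cnormX ler_wpM2r ?exprn_ge0 ?rnorm_ge0.
apply: ler_wpM2l; first exact: mulr_ge0.
rewrite -(ler_pM2l c0) divff ?gt_eqF// -opprB mulNr -subrX1 opprB.
by rewrite gerBl exprn_ge0 ?rnorm_ge0.
Qed.

(** The maximum principle for polynomials: the crude bound given by the
    coefficients, applied to all powers of [p], loses its constant after
    taking roots. *)
Lemma poly_max p (M : R) (z : C) : 0 <= M ->
  (forall t : circle R, rnorm p.[set_val t] <= M) -> rnorm z <= 1 -> rnorm p.[z] <= M.
Proof.
move=> M0 hM; rewrite le_eqVlt => /predU1P[z1|z1].
  by rewrite -(circle_ptE z1); exact: hM.
apply/ler_addgt0Pr => e e0.
have Me : 0 < M + e by rewrite ltr_wpDl.
rewrite -[leRHS]mul1r -ler_pdivrMr//.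
apply: (@pow2_bounded_le1 _ _ (2 / (1 - rnorm z))) => [|k].
  by rewrite divr_ge0 ?rnorm_ge0// ltW.
have h t : rnorm (p ^+ (2 ^ k)).[set_val (t : circle R)] <= (M + e) ^+ (2 ^ k).
  rewrite horner_exp cnormX lerXn2r ?nnegrE ?rnorm_ge0 ?(ltW Me)//.
  by apply: le_trans (hM t) _; rewrite lerDl ltW.
have Mk : 0 < (M + e) ^+ (2 ^ k) by rewrite exprn_gt0.
have := poly_disc_bound (ltW Mk) h z1.
by rewrite horner_exp cnormX expr_div_n ler_pdivrMr// [X in _ -> _ <= X]mulrAC.
Qed.

Lemma poly_cont p (z : C) (e : R) : 0 < e -> exists2 d : R, 0 < d &
  forall w, rnorm (z - w) < d -> rnorm (p.[z] - p.[w]) < e.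
Proof.
by move=> e0; have /(@rcontP R C C) h := @horner_cont p z; exact: h e e0.
Qed.

(** By [poly_max] the uniform Cauchy condition passes from the circle to the
    closed disc. *)
Lemma poly_lim (A : R) (p : nat -> {poly C}) : 0 <= A ->
  (forall n m (t : circle R), rnorm ((p n).[set_val t] - (p m).[set_val t]) <=
     A / n.+1%:R + A / m.+1%:R) ->
  exists F : C -> C,
    (forall n z, rnorm z <= 1 -> rnorm (F z - (p n).[z]) <= A / n.+1%:R) /\
    (forall z, rnorm z <= 1 -> forall e : R, 0 < e -> exists2 d : R, 0 < d &
       forall w, rnorm w <= 1 -> rnorm (z - w) < d -> rnorm (F z - F w) < e).
Proof.
move=> A0 hp.
have An n : 0 <= A / n.+1%:R by rewrite divr_ge0.
have small (e : R) : 0 < e -> exists N, forall n, (N <= n)%N -> A / n.+1%:R < e.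
  move=> e0; exists (Num.bound (A / e)) => n Nn.
  rewrite ltr_pdivrMr ?ltr0n// mulrC -ltr_pdivrMr//.
  apply: lt_le_trans (archi_boundP _) _; first by rewrite divr_ge0// ltW.
  by rewrite ler_nat ltnW.
have hd n m z : rnorm z <= 1 -> rnorm ((p n).[z] - (p m).[z]) <= A / n.+1%:R + A / m.+1%:R.
  move=> z1; have := @poly_max (p n - p m) _ z (addr_ge0 (An n) (An m)).
  rewrite hornerD hornerN; apply => // t.
  by rewrite hornerD hornerN.
have cv z : rnorm z <= 1 -> exists l : C, (fun n => (p n).[z]) @ \oo --> l.
  move=> z1; apply/cvg_ex; apply: Cx_complete; apply/cauchy_ballP => e /Cx_gt0[-> e0].
  have e20 : 0 < complex.Re e / 2 by rewrite divr_gt0.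
  have [N hN] := small _ e20.
  pose S := [set (p n).[z] | n in [set n | (N <= n)%N]].
  exists (S, S) => /=.
    by split; exists N => // n /= Nn; exists n.
  move=> [_ _] /= [[n Nn <-] [m Nm <-]]; rewrite -ball_normE /= rnormE toC_lt.
  apply: le_lt_trans (hd n m z z1) _.
  by rewrite [ltRHS]splitr ltrD// hN.
have /choice[F hF] z : exists l : C, rnorm z <= 1 -> (fun n => (p n).[z]) @ \oo --> l.
  have [z1|z1] := boolP (rnorm z <= 1); last by exists 0.
  by have [l hl] := cv z z1; exists l.
have hFn n z : rnorm z <= 1 -> rnorm (F z - (p n).[z]) <= A / n.+1%:R.
  move=> z1; apply/ler_addgt0Pr => e e0.
  have e20 : 0 < e / 2 by rewrite divr_gt0.
  have [N hN] := small _ e20.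
  have [m [Nm hm]] : exists m, (N <= m)%N /\ rnorm (F z - (p m).[z]) < e / 2.
    have /rcvgP/(_ _ e20)[K _ hK] := hF z z1.
    exists (maxn N K); split; first exact: leq_maxl.
    by apply: hK; rewrite /= leq_maxr.
  apply: le_trans (rnorm_distD (p m).[z] _ _) _.
  apply: le_trans (lerD (ltW hm) (hd m n z z1)) _.
  rewrite addrA [leLHS]addrC lerD2l [leRHS]splitr lerD2l; exact: ltW (hN m Nm).
exists F; split=> // z z1 e e0.
have e40 : 0 < e / 4 by rewrite divr_gt0.
have [N hN] := small _ e40; have {}hN := hN N (leqnn N).
have [d d0 hdd] := poly_cont (p N) z e40.
exists d => // w w1 zw.
apply: le_lt_trans (rnorm_distD (p N).[z] _ _) _.
have := rnorm_distD (p N).[w] (p N).[z] (F w).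
have := hdd w zw; have := hFn N z z1; have := hFn N w w1.
rewrite [rnorm ((p N).[w] - F w)]rnormC.
by move: (A / N.+1%:R) hN => a hN; lra.
Qed.

(** A criterion with real tolerances for differentiability in one complex
    variable. *)
Lemma derivableCP (F : C -> C) (z l : C) :
  (forall e : R, 0 < e -> exists2 d : R, 0 < d & forall h : C, h != 0 -> rnorm h < d ->
     rnorm (l - h^-1 * (F (h + z) - F z)) < e) -> derivable F z 1.
Proof.
move=> hF; apply/cvg_ex; exists l; apply/rcvgP => e /hF[d d0 hd].
exists (toC d); first by rewrite /= toC_gt0.
move=> h; rewrite /ball_/= sub0r normrN rnormE toC_lt => hhd h0.
by have := hd h h0 hhd; rewrite /GRing.scale /= mulr1.
Qed.

(** Differentiability of the limit comes from applying [poly_lim] to the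
    difference quotients at a point, which are polynomials too and are
    controlled on the circle. *)
Lemma poly_approx_disc u : poly_approx u -> disc_algebra_T R u.
Proof.
move=> hu.
have inv0 n : 0 < n.+1%:R^-1 :> R by rewrite invr_gt0 ltr0n.
have [p hp] := choice (fun n => hu n.+1%:R^-1 (inv0 n)).
have hpp n m (t : circle R) : rnorm ((p n).[set_val t] - (p m).[set_val t]) <=
    1 / n.+1%:R + 1 / m.+1%:R.
  rewrite !div1r; apply: le_trans (rnorm_distD (u t) _ _) _.
  by rewrite lerD// rnormC.
have [F [hF cF]] := poly_lim ler01 hpp.
exists F; last first.
  apply/funext => t; apply/eqP; rewrite -subr_eq0; apply: contraT => ne0.
  have D0 := rnorm_gt0 ne0; have t1 : rnorm (set_val t) <= 1 by rewrite circle_norm.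
  pose n := Num.bound (2 / rnorm (F (set_val t) - u t)).
  have hn : 2 / rnorm (F (set_val t) - u t) < n.+1%:R.
    apply: lt_trans (archi_boundP _) _; last by rewrite ltr_nat.
    by rewrite divr_ge0// ltW.
  have := rnorm_distD (p n).[set_val t] (F (set_val t)) (u t).
  have := hF n _ t1; have := hp n t; rewrite [rnorm (u t - _)]rnormC div1r.
  move: hn; rewrite ltr_pdivrMr// mulrC -ltr_pdivrMr ?ltr0n//.
  by move: n.+1%:R^-1 D0 => a D0; lra.
have disc (w : C) : `|w| <= 1 -> rnorm w <= 1 by rewrite rnormE -toC1 toC_le.
split.
  apply/subspace_continuousP => z /= /disc z1.
  apply: (proj2 (@rcvgP R C C (within _ (nbhs z)) _ F (F z))) => e e0.
  have [d d0 hd] := cF z z1 e e0.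
  apply/(@rnbhsP R C z); exists d => // w zw /= /disc w1; exact: hd.
move=> w; rewrite rnormE -toC1 toC_lt => w1.
have c0 : 0 < 1 - rnorm w by rewrite subr_gt0.
have /choice[q hq] n : exists q : {poly C}, p n - ((p n).[w])%:P = q * ('X - w%:P).
  apply/factor_theorem; rewrite /root hornerD hornerN hornerC subrr eqxx//.
have qE n z : (q n).[z] * (z - w) = (p n).[z] - (p n).[w].
  have := congr1 (fun r : {poly C} => r.[z]) (hq n).
  by rewrite hornerM !hornerE => <-.
pose A := 2 / (1 - rnorm w).
have A0 : 0 <= A by rewrite divr_ge0 // ltW.
have hqq n m (t : circle R) : rnorm ((q n).[set_val t] - (q m).[set_val t]) <=
    A / n.+1%:R + A / m.+1%:R.
  have tw : 1 - rnorm w <= rnorm (set_val t - w).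
    by rewrite -{1}(circle_norm t) rnormB_ge.
  have : rnorm ((q n).[set_val t] - (q m).[set_val t]) * rnorm (set_val t - w) <=
     2 * (1 / n.+1%:R + 1 / m.+1%:R).
    rewrite -cnormM mulrBl !qE.
    have -> : (p n).[set_val t] - (p n).[w] - ((p m).[set_val t] - (p m).[w]) =
      ((p n).[set_val t] - (p m).[set_val t]) - ((p n).[w] - (p m).[w]) by ring.
    apply: le_trans (rnormB _ _) _; rewrite mulr_natl mulr2n; apply: lerD => //.
    have := @poly_max (p n - p m) (1 / n.+1%:R + 1 / m.+1%:R) w.
    rewrite hornerD hornerN; apply; last exact: ltW.
      by rewrite addr_ge0// divr_ge0.
    by move=> s; rewrite hornerD hornerN.
  set r := rnorm _ => h.
  have : r * (1 - rnorm w) <= 2 * (1 / n.+1%:R + 1 / m.+1%:R).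
    by apply: le_trans h; rewrite ler_wpM2l// rnorm_ge0.
  rewrite -ler_pdivlMr// => /le_trans; apply.
  by rewrite /A !div1r le_eqVlt; apply/orP; left; apply/eqP; ring.
have [Q [hQ cQ]] := poly_lim A0 hqq.
have QE z : rnorm z <= 1 -> Q z * (z - w) = F z - F w.
  move=> z1; apply/eqP; rewrite -subr_eq0; apply: contraT => ne0.
  have D0 := rnorm_gt0 ne0.
  set D := rnorm _ in D0; pose B := A * rnorm (z - w) + 2.
  have B0 : 0 < B by rewrite ltr_wpDl// mulr_ge0 ?rnorm_ge0.
  pose n := Num.bound (B / D).
  have hn : B / D < n.+1%:R.
    apply: lt_trans (archi_boundP _) _; last by rewrite ltr_nat.
    by rewrite divr_ge0// ltW.
  have e : Q z * (z - w) - (F z - F w) = (Q z - (q n).[z]) * (z - w)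
     - (F z - (p n).[z]) + (F w - (p n).[w]).
    by rewrite mulrBl qE; ring.
  have : D <= A / n.+1%:R * rnorm (z - w) + 1 / n.+1%:R + 1 / n.+1%:R.
    rewrite /D e; apply: le_trans (rnormD _ _) _; rewrite lerD//; last exact: hF (ltW w1).
    apply: le_trans (rnormB _ _) _; rewrite lerD//; last exact: hF.
    by rewrite cnormM ler_wpM2r ?rnorm_ge0// hQ.
  have -> : A / n.+1%:R * rnorm (z - w) + 1 / n.+1%:R + 1 / n.+1%:R = B / n.+1%:R.
    by rewrite /B; ring.
  by rewrite ler_pdivlMr ?ltr0n// leNgt mulrC -ltr_pdivrMr// hn.
apply: (@derivableCP F w (Q w)) => e e0.
have [d d0 hd] := cQ w (ltW w1) e e0.
exists (Num.min d (1 - rnorm w)); first by rewrite lt_min d0.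
move=> h h0; rewrite lt_min => /andP[hd1 hd2].
have hw1 : rnorm (h + w) <= 1 by apply: le_trans (rnormD _ _) _; lra.
rewrite -(QE _ hw1) addrK [Q _ * h]mulrC mulKf//.
by apply: hd => //; rewrite opprD addrCA subrr addr0 rnormN.
Qed.

Lemma disc_algebra_TP u : disc_algebra_T R u <-> poly_approx u.
Proof. by split; [exact: disc_poly_approx|exact: poly_approx_disc]. Qed.

End PolyDisc.

(** * Hardy coefficients *)

Section Extension.
Variables (R : realType) (J : choiceType) (H : hilbertSpace R).
Local Notation C := (Cx R).
Local Notation l2 := (l2 R J).
Implicit Types (A B : {fset J}) (x y : l2).

Lemma big_fsubset (V : zmodType) A B (F : J -> V) : (A `<=` B)%fset ->
  \sum_(j <- B) F j = \sum_(j <- A) F j + \sum_(j <- (B `\` A)%fset) F j.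
Proof.
move=> AB; have BE : B = (A `|` (B `\` A))%fset.
  by rewrite fsetUDl fsetDv fsetD0; apply/esym/fsetUidPr.
rewrite {1}BE (perm_big (A ++ (B `\` A)%fset)) /=; first by rewrite big_cat.
apply: uniq_perm => [//||j]; last by rewrite mem_cat !inE.
rewrite cat_uniq !fset_uniq /= andbT; apply/hasPn => j.
by rewrite inE => /andP[].
Qed.

Variables (G : J -> H) (c : R).
Hypothesis c0 : 0 <= c.
Hypothesis hG : forall A (x : J -> C),
  rnorm (\sum_(j <- A) x j *: G j) ^+ 2 <= c ^+ 2 * sqs A x.

Lemma extend_ex x : exists y : H, (fun A => \sum_(j <- A) x j *: G j) @ fin_filter J --> y.
Proof.
have : cauchy ((fun A => \sum_(j <- A) x j *: G j) @ fin_filter J).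
  apply/cauchy_ballP => e /Cx_gt0[-> e0]; set e' := complex.Re e in e0 *.
  have c1 : 0 < c + 1 by rewrite ltr_wpDl.
  (* Adding [1] avoids a case distinction when [c] is zero. *)
pose d := (e' / 2 / (c + 1)) ^+ 2.
  have d0 : 0 < d by rewrite exprn_gt0// !divr_gt0.
  have /cvgrPdist_lt/(_ d d0)[A0 _ hA0] := @cvg_sqs R J x.
  pose S := (fun A => \sum_(j <- A) x j *: G j) @` [set A | (A0 `<=` A)%fset].
  exists (S, S) => /=; first by split; exists A0 => // A /= AA; exists A.
  have near A : (A0 `<=` A)%fset ->
      rnorm (\sum_(j <- A) x j *: G j - \sum_(j <- A0) x j *: G j) < e' / 2.
    move=> AA; rewrite (big_fsubset _ AA) addrAC subrr add0r.
    have e2 : 0 < e' / 2 by rewrite divr_gt0.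
    rewrite -ltr_sqr ?nnegrE ?rnorm_ge0 ?(ltW e2)//.
    apply: le_lt_trans (hG _ _) _.
    have sB : sqs (A `\` A0)%fset x < d.
      have := hA0 A0 (fsubset_refl _); rewrite /= => h0.
      apply: le_lt_trans (le_lt_trans (ler_norm _) h0).
      by rewrite lerBrDl {1}/sqs /sqs -(big_fsubset _ AA) sqs_le_nsq.
    have cd : c ^+ 2 * d < (e' / 2) ^+ 2.
      rewrite /d expr_div_n mulrCA gtr_pMr ?exprn_gt0//.
      rewrite ltr_pdivrMr ?exprn_gt0// mul1r ltr_sqr ?nnegrE ?ltrDl// ltW//.
    by apply: le_lt_trans cd; rewrite ler_wpM2l ?sqr_ge0// ltW.
  move=> [_ _] /= [[A AA <-] [B AB <-]]; rewrite -ball_normE /= rnormE toC_lt.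
  apply: le_lt_trans (rnorm_distD (\sum_(j <- A0) x j *: G j) _ _) _.
  by rewrite [ltRHS]splitr ltrD// ?near// rnormC near.
by move=> /cauchy_cvg/cvg_ex[y hy]; exists y.
Qed.

(** The continuous linear extension of the map that sends the basis vector
    [j] to [G j]; the hypothesis bounds it on finite linear combinations. *)
Definition extend x : H := projT1 (cid (extend_ex x)).

Lemma extend_cvg x : (fun A => \sum_(j <- A) x j *: G j) @ fin_filter J --> extend x.
Proof. exact: projT2 (cid (extend_ex x)). Qed.

Lemma extend_bound x : rnorm (extend x) <= c * rnorm x.
Proof.
have h : (fun A => rnorm (\sum_(j <- A) x j *: G j)) @ fin_filter J --> rnorm (extend x).
  exact: (rcvg_norm (@extend_cvg x)).
apply: (cvgr_to_le h); apply: nearW => A.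
rewrite -ler_sqr ?nnegrE ?mulr_ge0 ?rnorm_ge0//; apply: le_trans (hG _ _) _.
by rewrite exprMn ler_wpM2l ?sqr_ge0// sqs_le_norm.
Qed.

Lemma extend_lin : linear extend.
Proof.
move=> k x y.
have h1 := @extend_cvg (k *: x + y).
apply: (cvg_unique (@norm_hausdorff _ H) h1).
have -> : (fun A => \sum_(j <- A) (k *: x + y : l2) j *: G j) =
    (fun A => k *: (\sum_(j <- A) x j *: G j) + \sum_(j <- A) y j *: G j).
  apply/funext => A; rewrite scaler_sumr -big_split; apply: eq_bigr => j _ /=.
  by rewrite scalerA -scalerDl.
have h2 := @extend_cvg x; have h3 := @extend_cvg y.
by apply: cvgD; [apply: cvgZl_tmp; exact: h2|exact: h3].
Qed.

Lemma extend_delta j : extend (ldelta R j) = G j.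
Proof.
have h1 := @extend_cvg (ldelta R j).
apply: (cvg_unique (@norm_hausdorff _ H) h1); apply: cvg_near_cst.
have := fin_filter_ge [fset j]%fset; apply: filterS => A; rewrite fsub1set => jA.
rewrite (bigD1_seq j)//= eqxx scale1r big1 ?addr0// => i ij.
by rewrite (negbTE ij) scale0r.
Qed.

End Extension.

Section HardyCoefficients.
Variable R : realType.
Local Notation C := (Cx R).
Local Notation CT := (circle R -> C).
Local Notation P := ('I_2 * nat)%type.
Local Notation VF := ('I_2 -> CT).
Implicit Types (u v w : VF) (A B : {fset P}) (a b : M2fun R) (p q : P).

Definition vcont u := forall k, continuous (u k).

(** The inner product and, with [fnsq], the norm of continuous functions
    with values in the complex plane squared, in the sense of mean squares
    over the circle. *)
Definition fdot u v : C := mu (fun t => \sum_k u k t * (v k t)^*).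
Definition fnsq u (t : circle R) : R := \sum_k rnorm (u k t) ^+ 2.

Lemma fdot_cont u v : vcont u -> vcont v -> continuous (fun t => \sum_k u k t * (v k t)^*).
Proof.
move=> cu cv; apply: cont_sum_fun => k; exact: (contM_fun (cu k) (cont_conj (cv k))).
Qed.

Lemma fnsq_cont u : vcont u -> continuous (fnsq u).
Proof. by move=> cu; apply: rcont_sum => k; apply: rcont_norm_sq; exact: cu. Qed.

Lemma fdot_lin (c : C) u v w : vcont u -> vcont v -> vcont w ->
  fdot (fun k t => c * u k t + v k t) w = c * fdot u w + fdot v w.
Proof.
move=> cu cv cw; rewrite /fdot -(mu_lin c (fdot_cont cu cw) (fdot_cont cv cw)); congr mu.
apply/funext => t; rewrite mulr_sumr -big_split; apply: eq_bigr => k _ /=; ring.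
Qed.

Lemma fdotC u v : vcont u -> vcont v -> fdot v u = (fdot u v)^*.
Proof.
move=> cu cv; rewrite /fdot -(mu_conj (fdot_cont cu cv)); congr mu; apply/funext => t.
rewrite /conj_fun rmorph_sum; apply: eq_bigr => k _ /=.
by rewrite rmorphM /= conjCK mulrC.
Qed.

Lemma fdotxx u : fdot u u = toC (mur (fnsq u)).
Proof.
rewrite -mu_toC; congr mu; apply/funext => t; rewrite /fnsq toC_sum.
by apply: eq_bigr => k _; rewrite mulJ_cnorm.
Qed.

Lemma vcont_lin (c : C) u v : vcont u -> vcont v -> vcont (fun k t => c * u k t + v k t).
Proof. by move=> cu cv k; exact: (contD_fun (contM_fun (@cont_cst_fun R _ c) (cu k)) (cv k)). Qed.

Lemma vcont0 : vcont (fun _ _ => 0). Proof. by move=> k; exact: cont_cst_fun. Qed.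

Lemma fdot0l v : fdot (fun _ _ => 0) v = 0.
Proof.
rewrite /fdot -[RHS](mu0 R); congr mu; apply/funext => t; rewrite big1// => k _.
by rewrite mul0r.
Qed.

Lemma fdot_sum I (r : seq I) (c : I -> C) (u : I -> VF) w :
  (forall i, vcont (u i)) -> vcont w ->
  fdot (fun k t => \sum_(i <- r) c i * u i k t) w = \sum_(i <- r) c i * fdot (u i) w.
Proof.
move=> cu cw; elim: r => [|i r IH].
  rewrite big_nil -[RHS](fdot0l w); congr (fdot _ w); apply/funext => k; apply/funext => t.
  by rewrite big_nil.
have cs : vcont (fun k t => \sum_(j <- r) c j * u j k t).
  by move=> k; apply: cont_sum_fun => j; exact: (contM_fun (@cont_cst_fun R _ (c j)) (cu j k)).
rewrite big_cons -IH -(fdot_lin (c i) (cu i) cs cw); congr (fdot _ w).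
by apply/funext => k; apply/funext => t; rewrite big_cons.
Qed.

(** The orthonormal basis of the two copies of the Hardy space. *)
Definition ebas p : VF := fun k => if k == p.1 then zn p.2 else fun=> 0.

Lemma ebas_cont p : vcont (ebas p).
Proof. by move=> k; rewrite /ebas; case: ifP => _; [exact: zn_cont|exact: cont_cst_fun]. Qed.

Lemma fdot_ebas u p : fdot u (ebas p) = mu (fun t => u p.1 t * (zn p.2 t)^*).
Proof.
congr mu; apply/funext => t; rewrite (bigD1 p.1)//= {1}/ebas eqxx big1 ?addr0// => k kp.
by rewrite /ebas (negbTE kp) rmorph0 mulr0.
Qed.

Lemma ebas_ortho p q : fdot (ebas p) (ebas q) = (p == q)%:R.
Proof.
rewrite fdot_ebas /ebas [p == q]/(_ && _) eq_sym; case: eqP => _ /=.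
  exact: mu_znJ.
by rewrite -[RHS](mu0 R); congr mu; apply/funext => t; rewrite mul0r.
Qed.

Definition trig A (x : P -> C) : VF := fun k t => \sum_(p <- A) x p * ebas p k t.

Lemma trig_cont A x : vcont (trig A x).
Proof. by move=> k; apply: cont_sum_fun => p; exact: (contM_fun (@cont_cst_fun R _ (x p)) (@ebas_cont p k)). Qed.

Lemma fdot_trig A x v : vcont v -> fdot (trig A x) v = \sum_(p <- A) x p * fdot (ebas p) v.
Proof. by move=> cv; exact: (fdot_sum _ _ (fun p => @ebas_cont p) cv). Qed.

Lemma fdot_trig_ebas A x q : fdot (trig A x) (ebas q) = if q \in A then x q else 0.
Proof.
rewrite (fdot_trig _ _ (@ebas_cont q)); case: ifPn => qA.
  rewrite (bigD1_seq q qA (fset_uniq A)) ebas_ortho eqxx mulr1 big1 => [|p pq]; first exact: addr0.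
  by rewrite ebas_ortho (negbTE pq) mulr0.
rewrite big_seq big1// => p pA; rewrite ebas_ortho.
by case: eqP => [pq|_]; [rewrite -pq pA in qA|rewrite mulr0].
Qed.

Lemma fdot_trig_trig A x : fdot (trig A x) (trig A x) = toC (sqs A x).
Proof.
rewrite (fdot_trig _ _ (@trig_cont A x)) /sqs toC_sum big_seq [RHS]big_seq.
apply: eq_bigr => p pA.
by rewrite (fdotC (@trig_cont A x) (@ebas_cont p)) fdot_trig_ebas pA mulJ_cnorm.
Qed.

Lemma mur_fnsq_trig A x : mur (fnsq (trig A x)) = sqs A x.
Proof. by apply: toC_inj; rewrite -fdotxx fdot_trig_trig. Qed.

(** Bessel's inequality: the squared norm of what remains of [u] after its
    partial expansion is subtracted is nonnegative. *)
Lemma bessel A u : vcont u -> sqs A (fun p => fdot u (ebas p)) <= mur (fnsq u).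
Proof.
move=> cu; pose c p := fdot u (ebas p); pose T := trig A c.
have cT : vcont T by exact: trig_cont.
pose w : VF := fun k t => -1 * T k t + u k t.
have cw : vcont w by exact: (@vcont_lin (-1) T u cT cu).
have S1 : fdot T u = toC (sqs A c).
  rewrite (fdot_trig _ _ cu) /sqs toC_sum; apply: eq_bigr => p _.
  by rewrite (fdotC cu (@ebas_cont p)) mulJ_cnorm.
have : fdot w w = toC (mur (fnsq u) - sqs A c).
  have uT : fdot u T = toC (sqs A c) by rewrite (fdotC cT cu) S1 toCJ.
  have wT : fdot w T = 0 by rewrite (fdot_lin _ cT cu cT) fdot_trig_trig uT mulN1r addNr.
  have wu : fdot w u = toC (mur (fnsq u) - sqs A c).
    by rewrite (fdot_lin _ cT cu cu) S1 fdotxx mulN1r addrC toCB.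
  rewrite {1}/w (fdot_lin _ cT cu cw) (fdotC cw cT) (fdotC cw cu) wT wu.
  by rewrite rmorph0 mulr0 add0r toCJ.
rewrite fdotxx => /toC_inj h; rewrite -subr_ge0 -h.
by apply: mur_ge0 => t; apply: sumr_ge0 => k _; exact: sqr_ge0.
Qed.

(** The Fourier coefficients with nonnegative index. As coordinates, they
    are the orthogonal projection of [u] onto the Hardy space. They are
    square summable by [bessel] when [u] is continuous. *)
Definition hardy u : l2 R P := insubd (0 : l2 R P) (fun p => fdot u (ebas p)).

Lemma hardyE u p : vcont u -> hardy u p = fdot u (ebas p).
Proof.
move=> cu; have h : (fun p => fdot u (ebas p)) \in @l2_pred R P.
  by apply: (@l2_predP _ _ _ (mur (fnsq u))) => A; exact: bessel.
by have := @insubdK _ _ _ (0 : l2 R P) _ h => /(congr1 (fun f => f p)).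
Qed.

Lemma hardy_norm u : vcont u -> rnorm (hardy u) ^+ 2 <= mur (fnsq u).
Proof.
move=> cu; rewrite l2_rnorm_sq; apply: nsq_le => A.
rewrite (_ : l2val (hardy u) = (fun p => fdot u (ebas p))); first exact: bessel.
by apply/funext => p; exact: hardyE.
Qed.

Lemma hardy_lin (c : C) u v : vcont u -> vcont v ->
  hardy (fun k t => c * u k t + v k t) = c *: hardy u + hardy v.
Proof.
move=> cu cv; apply: l2_ext => p; rewrite (hardyE p (@vcont_lin c u v cu cv)).
rewrite (fdot_lin _ cu cv (@ebas_cont p)) -(hardyE p cu) -(hardyE p cv).
by [].
Qed.

Lemma hardy0 : hardy (fun _ _ => 0) = 0.
Proof. by apply: l2_ext => p; rewrite (hardyE p vcont0) fdot0l. Qed.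

Lemma hardy_sum I (r : seq I) (c : I -> C) (u : I -> VF) : (forall i, vcont (u i)) ->
  hardy (fun k t => \sum_(i <- r) c i * u i k t) = \sum_(i <- r) c i *: hardy (u i).
Proof.
move=> cu; apply: l2_ext => p; have cs : vcont (fun k t => \sum_(i <- r) c i * u i k t).
  by move=> k; apply: cont_sum_fun => j; exact: (contM_fun (@cont_cst_fun R _ (c j)) (cu j k)).
rewrite l2_sumE (hardyE p cs).
rewrite (fdot_sum _ _ cu (@ebas_cont p)); apply: eq_bigr => i _.
by rewrite -(hardyE p (cu i)).
Qed.

Lemma hardy_ebas p : hardy (ebas p) = ldelta R p.
Proof.
apply: l2_ext => q; rewrite (hardyE q (@ebas_cont p)) ebas_ortho eq_sym.
by rewrite -[l2val (ldelta R p) q]/(if q == p then 1 else 0); case: eqP.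
Qed.

Definition amul a u : VF := fun k t => \sum_l a k l t * u l t.

Lemma amul_cont a u : M2CT R a -> vcont u -> vcont (amul a u).
Proof. by move=> ca cu k; apply: cont_sum_fun => l; exact: (contM_fun (ca k l) (cu l)). Qed.

Lemma amulM a b u : amul a (amul b u) = amul (a *m b) u.
Proof.
apply/funext => k; apply/funext => t; rewrite /amul.
under eq_bigr do rewrite mulr_sumr.
rewrite exchange_big; apply: eq_bigr => l _; rewrite mulmxEt mulr_suml.
by apply: eq_bigr => j _; rewrite mulrA.
Qed.

End HardyCoefficients.

(** * Toeplitz operators with continuous matrix symbols *)

Section ToeplitzOperators.
Variable R : realType.
Local Notation C := (Cx R).
Local Notation CT := (circle R -> C).
Local Notation P := ('I_2 * nat)%type.
Local Notation VF := ('I_2 -> CT).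
Local Notation HP := (l2H R P).
Implicit Types (u v w : VF) (A B : {fset P}) (a b : M2fun R) (p q : P).

Lemma rcvg_norm_sq (V : normedModType C) (T : Type) (F : set_system T) {FF : Filter F}
    (f : T -> V) (l : V) :
  f @ F --> l -> (fun x => rnorm (f x) ^+ 2) @ F --> rnorm l ^+ 2.
Proof.
move=> fl; have h : (fun x => rnorm (f x)) @ F --> rnorm l by exact: rcvg_norm.
by rewrite expr2; under eq_fun do rewrite expr2; exact: (cvgM h h).
Qed.

Lemma mur_sum I (r : seq I) (F : I -> circle R -> R) : (forall i, continuous (F i)) ->
  mur (fun t => \sum_(i <- r) F i t) = \sum_(i <- r) mur (F i).
Proof.
move=> cF; elim: r => [|i r IH].
  rewrite big_nil -[RHS](@mur_cst R 0); congr mur.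
  by apply/funext => t; rewrite big_nil.
have cs : continuous (fun t => \sum_(j <- r) F j t) by exact: rcont_sum.
rewrite big_cons -IH -[X in X + _]mul1r -(mur_lin 1 (cF i) cs).
by congr mur; apply/funext => t; rewrite big_cons mul1r.
Qed.

Lemma murZ (c : R) g : continuous g -> mur (fun t => c * g t) = c * mur g.
Proof.
move=> cg; rewrite -[RHS]addr0 -[X in _ + X](@mur_cst R 0) -(mur_lin c cg (@rcont_cst R _ 0)).
by congr mur; apply/funext => t; rewrite addr0.
Qed.

Lemma sqs_vec2 (f : 'I_2 -> C) (A : {fset unit * 'I_2}) :
  sqs A (fun z => f z.2) <= sqs (prodset [fset tt]%fset) (fun z => f z.2).
Proof.
apply: sqs_mono; apply: (fsubset_trans (sub_prodset A)).
by apply: prodset_mono; apply/fsubsetP => -[]; rewrite inE.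
Qed.

Definition vec2 (f : 'I_2 -> C) : l2H R (unit * 'I_2)%type := L2 (l2_predP (sqs_vec2 f)).

(** The bound [pw_bound] with the two dimensional Hilbert space spelled out
    in coordinates. *)
Lemma pw_bound_raw n (c : R) (a : 'M[M2fun R]_n) t (v : 'I_n -> 'I_2 -> C) :
  0 <= c -> M2CTn a -> pw_bound c a ->
  \sum_i \sum_k rnorm (\sum_j \sum_l a i j k l t * v j l) ^+ 2 <=
  c ^+ 2 * \sum_j \sum_l rnorm (v j l) ^+ 2.
Proof.
move=> c0 ca /(_ t (fun j => vec2 (v j))).
rewrite -ler_sqr ?nnegrE ?mulr_ge0 ?hnormn_ge0// exprMn !hnormn_sq.
have -> : nsum (fun j => vec2 (v j)) = \sum_j \sum_l rnorm (v j l) ^+ 2.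
  by apply: eq_bigr => j _; rewrite l2_unit_norm.
suff -> : nsum (ract (ev t) a (fun j => vec2 (v j))) =
   \sum_i \sum_k rnorm (\sum_j \sum_l a i j k l t * v j l) ^+ 2 by [].
apply: eq_bigr => i _; rewrite l2_unit_norm; apply: eq_bigr => k _.
congr (rnorm _ ^+ 2); rewrite ractE.
transitivity (\sum_j (ev t (a i j) (vec2 (v j)) : l2 R _) (tt, k)); first exact: l2_sumE.
by apply: eq_bigr => j _; rewrite /ev (sigopE _ _ (ca i j)).
Qed.

Lemma pw_bound_ex n (a : 'M[M2fun R]_n) : M2CTn a -> exists2 c : R, 0 <= c & pw_bound c a.
Proof.
move=> ca.
have /choice[c hc] (ij : 'I_n * 'I_n) : exists c : R, 0 <= c /\
    forall k l t, rnorm (a ij.1 ij.2 k l t) <= c.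
  by have [c c0 h] := M2CT_bounded (ca ij.1 ij.2); exists c.
pose M := \sum_ij c ij.
have M0 : 0 <= M by apply: sumr_ge0 => ij _; case: (hc ij).
exists (4 * n%:R ^+ 2 * M) => [|t X]; first by rewrite mulr_ge0// mulr_ge0// sqr_ge0.
apply: (ract_entry_bound (evP t) X M0 ca) => i j k l s.
have [_ h] := hc (i, j); apply: le_trans (h k l s) _.
by rewrite /M (bigD1 (i, j))//= lerDl; apply: sumr_ge0 => ij _; case: (hc ij).
Qed.

(** Integrating the pointwise bound over the circle, multiplication by [a] has
    norm at most [c]; taking Hardy coefficients does not increase norms, and on
    trigonometric polynomials it preserves them. *)
Lemma hardy_mx_bound n (c : R) (a : 'M[M2fun R]_n) A (X : 'I_n -> P -> C) :
  0 <= c -> M2CTn a -> pw_bound c a ->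
  \sum_i rnorm (\sum_j hardy (amul (a i j) (trig A (X j)))) ^+ 2 <=
  c ^+ 2 * \sum_j sqs A (X j).
Proof.
move=> c0 ca ha.
pose U i : VF := fun k t => \sum_j 1 * amul (a i j) (trig A (X j)) k t.
have cU' i j : vcont (amul (a i j) (trig A (X j))).
  exact: (amul_cont (ca i j) (@trig_cont R A (X j))).
have cU i : vcont (U i).
  by move=> k; apply: cont_sum_fun => j; exact: (contM_fun (@cont_cst_fun R _ 1) (cU' i j k)).
have E i : \sum_j hardy (amul (a i j) (trig A (X j))) = hardy (U i).
  by rewrite /U (hardy_sum _ (fun=> 1) (cU' i)); apply: eq_bigr => j _; rewrite scale1r.
apply: (@le_trans _ _ (\sum_i mur (fnsq (U i)))).
  by apply: ler_sum => i _; rewrite E; exact: hardy_norm (cU i).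
have cn i : continuous (fnsq (U i)) by exact: fnsq_cont (cU i).
have ct j : continuous (fnsq (trig A (X j))) by exact: fnsq_cont (@trig_cont R A (X j)).
rewrite -(mur_sum _ cn).
have -> : \sum_j sqs A (X j) = \sum_j mur (fnsq (trig A (X j))).
  by apply: eq_bigr => j _; rewrite mur_fnsq_trig.
rewrite -(mur_sum _ ct) -(murZ _ (@rcont_sum R _ 'I_n _ _ ct)).
apply: (mur_le (@rcont_sum R _ 'I_n _ _ cn) (rcontM (@rcont_cst R _ _) (@rcont_sum R _ 'I_n _ _ ct))) => t.
have := pw_bound_raw t (fun j l => trig A (X j) l t) c0 ca ha.
rewrite /fnsq; congr (_ <= _); apply: eq_bigr => i _; apply: eq_bigr => k _.
congr (rnorm _ ^+ 2); apply: eq_bigr => j _.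
by rewrite mul1r.
Qed.

Lemma hardy_trig a A (x : P -> C) : M2CT R a ->
  \sum_(p <- A) x p *: hardy (amul a (ebas p)) = hardy (amul a (trig A x)).
Proof.
move=> ca; rewrite -hardy_sum => [|p]; last exact: amul_cont ca (@ebas_cont R p).
congr hardy; apply/funext => k; apply/funext => t; rewrite /amul /trig.
under eq_bigr do rewrite mulr_sumr.
rewrite exchange_big; apply: eq_bigr => l _; rewrite mulr_sumr; apply: eq_bigr => p _.
by rewrite mulrCA.
Qed.

Lemma toep_hyp a : M2CT R a -> exists c : R, 0 <= c /\ forall A (x : P -> C),
  rnorm (\sum_(p <- A) x p *: (hardy (amul a (ebas p)) : HP)) ^+ 2 <= c ^+ 2 * sqs A x.
Proof.
move=> ca; pose a1 : 'M[M2fun R]_1 := \matrix_(i, j) a.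
have ca1 : M2CTn a1 by move=> i j; rewrite mxE; exact: ca.
have [c c0 hc] := pw_bound_ex ca1; exists c; split => // A x.
have := hardy_mx_bound A (fun=> x) c0 ca1 hc.
rewrite !big_ord1 mxE -hardy_trig//; exact.
Qed.

(** The Toeplitz operator with matrix symbol [a]: multiplication by [a],
    compressed to the direct sum of two copies of the Hardy space, which is
    modelled by its coefficients in the basis [ebas]. The limit exists for
    continuous symbols, by [toep_spec]. *)
Definition toep a (x : HP) : HP :=
  lim ((fun A => \sum_(p <- A) (x : l2 R P) p *: (hardy (amul a (ebas p)) : HP)) @ fin_filter P).

Lemma toep_spec a : M2CT R a -> bounded_op (toep a) /\
  (forall x : HP, (fun A => hardy (amul a (trig A (x : l2 R P))) : HP) @ fin_filter P --> toep a x) /\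
  (forall p, toep a (ldelta R p) = hardy (amul a (ebas p))).
Proof.
move=> ca; have [c [c0 hc]] := toep_hyp ca.
have E : toep a = extend c0 hc.
  apply/funext => x; rewrite /toep; apply: cvg_lim; first exact: norm_hausdorff.
  exact: extend_cvg.
rewrite E; split.
  split; first exact: extend_lin.
  by exists c => x; exact: (@extend_bound R P HP _ c c0 hc x).
split=> [x|p]; last exact: extend_delta.
have h := @extend_cvg _ _ _ _ _ c0 hc x.
rewrite (_ : (fun A => _) = (fun A => \sum_(p <- A) (x : l2 R P) p *: (hardy (amul a (ebas p)) : HP)))//.
by apply/funext => A; rewrite -hardy_trig.
Qed.

Lemma toep_bounded a : M2CT R a -> bounded_op (toep a).
Proof. by move=> /toep_spec[]. Qed.

Lemma toep_delta a p : M2CT R a -> toep a (ldelta R p) = hardy (amul a (ebas p)).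
Proof. by move=> /toep_spec[_ []]. Qed.

(** The bound of [hardy_mx_bound] passes to the limit. This is what makes
    the map [toep] completely contractive. *)
Lemma toep_cc n (c : R) (a : 'M[M2fun R]_n) (X : 'I_n -> HP) :
  0 <= c -> M2CTn a -> pw_bound c a -> hnormn (ract toep a X) <= c * hnormn X.
Proof.
move=> c0 ca ha; rewrite hnormn_le ?mulr_ge0 ?hnormn_ge0// exprMn hnormn_sq.
have cv i : (fun A => \sum_j (hardy (amul (a i j) (trig A (X j : l2 R P))) : HP)) @ fin_filter P -->
    ract toep a X i.
  rewrite ractE; apply: (@cvg_bigsum C HP) => j.
  by have [_ []] := toep_spec (ca i j).
have cn : (fun A => \sum_i rnorm (\sum_j (hardy (amul (a i j) (trig A (X j : l2 R P))) : HP)) ^+ 2)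
    @ fin_filter P --> nsum (ract toep a X).
  apply: (@cvg_bigsum R R) => i; exact: (rcvg_norm_sq (cv i)).
apply: (cvgr_to_le cn); apply: nearW => A.
apply: le_trans (hardy_mx_bound A (fun j => X j : l2 R P) c0 ca ha) _.
rewrite ler_wpM2l ?sqr_ge0//; apply: ler_sum => j _; exact: sqs_le_norm.
Qed.

Lemma toep_lin (c : C) a b : M2CT R a -> M2CT R b ->
  toep ((cst c : CT) *: a + b) = c *: toep a + toep b.
Proof.
move=> ca cb.
have cab : M2CT R ((cst c : CT) *: a + b) by exact: (M2CTD (M2CTZ (@cont_cst R _ c) ca) cb).
apply: (bounded_op_basis (toep_bounded cab)).
  exact: (bounded_op_lin c (toep_bounded ca) (toep_bounded cb)).
move=> p; rewrite (toep_delta _ cab).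
transitivity (c *: (toep a (ldelta R p)) + toep b (ldelta R p)) => //.
rewrite (toep_delta _ ca) (toep_delta _ cb).
rewrite -(hardy_lin c (amul_cont ca (@ebas_cont R p)) (amul_cont cb (@ebas_cont R p))).
congr (hardy _ : HP); apply/funext => k; apply/funext => t.
rewrite /amul mulr_sumr -big_split; apply: eq_bigr => l _ /=.
by rewrite addmxEt mxE [(cst c * _) t]/(c * _) mulrDl mulrA.
Qed.

Lemma toep1 : toep 1%:M = id.
Proof.
apply: (bounded_op_basis (toep_bounded (@M2CT1 R)) (@bounded_op_id R HP)) => p.
rewrite (toep_delta _ (@M2CT1 R)) -(@hardy_ebas R p); congr (hardy _ : HP).
apply/funext => k; apply/funext => t; rewrite /amul (bigD1 k)//= mxE eqxx mul1r big1 ?addr0//.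
by move=> l lk; rewrite mxE eq_sym (negbTE lk) mul0r.
Qed.

End ToeplitzOperators.

(** * The triangular algebra of symbols *)

Section AlgebraB.
Variable R : realType.
Local Notation C := (Cx R).
Local Notation CT := (circle R -> C).
Implicit Types (u v : CT) (a b : M2fun R).

Lemma unif_cont u : (forall e : R, 0 < e -> exists2 v, continuous v &
  forall t, rnorm (u t - v t) <= e) -> continuous u.
Proof.
move=> hu t; apply/circle_contP => e e0.
have e4 : 0 < e / 4 by rewrite divr_gt0.
have [v cv hv] := hu _ e4.
have [d d0 hd] := proj1 (circle_contP v t) (cv t) _ e4.
exists d => // s /hd h1; have h2 := hv t; have h3 := hv s.
have -> : u t - u s = (u t - v t) + (v t - v s) - (u s - v s) by ring.
have h4 := rnormB ((u t - v t) + (v t - v s)) (u s - v s).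
have h5 := rnormD (u t - v t) (v t - v s).
move: (rnorm (u t - v t)) (rnorm (v t - v s)) (rnorm (u s - v s)) (rnorm (u t - v t + (v t - v s)))
  h1 h2 h3 h4 h5 => r1 r2 r3 r4 h1 h2 h3 h4 h5.
by apply: le_lt_trans h4 _; lra.
Qed.

Lemma poly_approx_cont u : poly_approx u -> continuous u.
Proof.
move=> hu; apply: unif_cont => e /hu[p hp].
by exists (fun t : circle R => p.[set_val t]) => //; exact: horner_circle_cont.
Qed.

Lemma poly_approx_lim u : (forall e : R, 0 < e -> exists2 v, poly_approx v &
  forall t, rnorm (u t - v t) <= e) -> poly_approx u.
Proof.
move=> hu e e0; have e2 : 0 < e / 2 by rewrite divr_gt0.
have [v hv uv] := hu _ e2; have [p hp] := hv _ e2; exists p => t.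
apply: le_trans (rnorm_distD (v t) _ _) _.
by rewrite [leRHS]splitr lerD.
Qed.

Lemma poly_approxM u v : poly_approx u -> poly_approx v -> poly_approx (fun t => u t * v t).
Proof.
move=> hu hv; apply: poly_approx_lim => e e0.
have [M M0 hM] := circle_bounded (poly_approx_cont hv).
have M1 : 0 < M + 1 by rewrite ltr_wpDl.
have [p hp] := hu (e / (M + 1)) (divr_gt0 e0 M1).
exists (fun t => p.[set_val t] * v t) => [d d0|t]; last first.
  rewrite -mulrBl cnormM -[leRHS](divfK (lt0r_neq0 M1)).
  by apply: ler_pM; rewrite ?rnorm_ge0// (le_trans (hM t))// lerDl.
have [N N0 hN] := circle_bounded (@horner_circle_cont R p).
have N1 : 0 < N + 1 by rewrite ltr_wpDl.
have [q hq] := hv (d / (N + 1)) (divr_gt0 d0 N1).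
exists (p * q) => t; rewrite hornerM -mulrBr cnormM -[leRHS](divfK (lt0r_neq0 N1)) mulrC.
by apply: ler_pM; rewrite ?rnorm_ge0// (le_trans (hN t))// lerDl.
Qed.

Lemma poly_approxD u v : poly_approx u -> poly_approx v -> poly_approx (fun t => u t + v t).
Proof.
move=> hu hv e e0; have e2 : 0 < e / 2 by rewrite divr_gt0.
have [p hp] := hu _ e2; have [q hq] := hv _ e2; exists (p + q) => t.
rewrite hornerD opprD addrACA; apply: le_trans (rnormD _ _) _.
by rewrite [leRHS]splitr lerD.
Qed.

Lemma poly_approx_cst (c : C) : poly_approx (fun=> c).
Proof. by move=> e e0; exists c%:P => t; rewrite hornerC subrr rnorm0 ltW. Qed.

Lemma poly_approx_zn n : poly_approx (@zn R n).
Proof. by move=> e e0; exists 'X^n => t; rewrite hornerXn subrr rnorm0 ltW. Qed.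

(** Membership in [calB], entry by entry ([calBP]); the analytic entries are
    described by polynomial approximation. *)
Definition tri a := [/\ poly_approx (a 0 0), forall t, a 0 1 t = 0,
  continuous (a 1 0) & poly_approx (fun t => (a 1 1 t)^*)].

Lemma calBP a : calB R a <-> tri a.
Proof.
split=> [[f [g [h [/disc_algebra_TP hf /disc_algebra_TP hg ch ->]]]]|[h00 h01 h10 h11]].
  rewrite /tri !mxE /=; split => //; rewrite (_ : (fun t => _) = g)//.
  by apply/funext => t; rewrite /conj_fun conjCK.
exists (a 0 0), (fun t => (a 1 1 t)^*), (a 1 0); split => //; [exact/disc_algebra_TP..|].
apply: M2_ext => i j t; rewrite mxE.
have [->|] := eqVneq i 0; have [->|] := eqVneq j 0 => //; rewrite -?val_eqE.
- by move: j => [[|[|j]] hj]// _; rewrite -[RHS](h01 t); congr (a _ _ t); apply/val_inj.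
- by move: i => [[|[|i]] hi]// _; congr (a _ _ t); apply/val_inj.
- move: i j => [[|[|i]] hi] [[|[|j]] hj]// _ _; rewrite /conj_fun conjCK.
  by congr (a _ _ t); apply/val_inj.
Qed.

Lemma I2P (i : 'I_2) : i = 0 \/ i = 1.
Proof. by move: i => [[|[|i]] hi]//; [left|right]; apply/val_inj. Qed.

Lemma sum_I2 (V : nmodType) (F : 'I_2 -> V) : \sum_l F l = F 0 + F 1.
Proof.
rewrite big_ord_recl big_ord1; congr (_ + _); congr F.
by have [h|h] := I2P (lift ord0 ord0); rewrite h// in |- *; move: h => /(congr1 val).
Qed.

Lemma calB_M2CT a : calB R a -> M2CT R a.
Proof.
move=> /calBP[h00 h01 h10 h11] i j.
have [->|->] := I2P i; have [->|->] := I2P j.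
- exact: (poly_approx_cont h00).
- rewrite (_ : a 0 1 = fun=> 0); first exact: (@cont_cst_fun R _ 0).
  by apply/funext.
- exact: h10.
- have -> : a 1 1 = conj_fun (fun t => (a 1 1 t)^*) by apply/funext => t; rewrite /conj_fun conjCK.
  exact: (cont_conj (poly_approx_cont h11)).
Qed.

Lemma linmxEt (c : C) a b i j t : ((cst c : CT) *: a + b) i j t = c * a i j t + b i j t.
Proof. by rewrite addmxEt mxE. Qed.

Lemma calB_lin (c : C) a b : calB R a -> calB R b -> calB R ((cst c : CT) *: a + b).
Proof.
move=> ha hb; have [ca cb] := (calB_M2CT ha, calB_M2CT hb).
have cab := M2CTD (M2CTZ (@cont_cst R _ c) ca) cb.
case/calBP: ha => a00 a01 _ a11; case/calBP: hb => b00 b01 _ b11; apply/calBP; split.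
- rewrite (_ : _ 0 0 = fun t => c * a 0 0 t + b 0 0 t); last by apply/funext => t; rewrite linmxEt.
  exact: (poly_approxD (poly_approxM (@poly_approx_cst c) a00) b00).
- by move=> t; rewrite linmxEt a01 b01 mulr0 addr0.
- exact: (cab 1 0).
- rewrite (_ : (fun t => _) = fun t => c^* * (a 1 1 t)^* + (b 1 1 t)^*); last first.
    by apply/funext => t; rewrite linmxEt rmorphD rmorphM.
  exact: (poly_approxD (poly_approxM (@poly_approx_cst c^*) a11) b11).
Qed.

Lemma calB_mul a b : calB R a -> calB R b -> calB R (a *m b).
Proof.
have E i j t : (a *m b) i j t = a i 0 t * b 0 j t + a i 1 t * b 1 j t.
  by rewrite mulmxEt sum_I2.
move=> ha hb; have cab := M2CTM (calB_M2CT ha) (calB_M2CT hb).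
case/calBP: ha => a00 a01 _ a11; case/calBP: hb => b00 b01 _ b11; apply/calBP; split.
- rewrite (_ : _ 0 0 = fun t => a 0 0 t * b 0 0 t); first exact: (poly_approxM a00 b00).
  by apply/funext => t; rewrite E a01 mul0r addr0.
- by move=> t; rewrite E a01 b01 mulr0 mul0r addr0.
- exact: (cab 1 0).
- rewrite (_ : (fun t => _) = fun t => (a 1 1 t)^* * (b 1 1 t)^*).
    exact: (poly_approxM a11 b11).
  by apply/funext => t; rewrite E b01 mulr0 add0r rmorphM.
Qed.

(** Each entry condition survives uniform limits. *)
Lemma calB_lim a : (forall e : R, 0 < e -> exists2 b, calB R b &
  forall i j t, rnorm (a i j t - b i j t) <= e) -> calB R a.
Proof.
move=> ha; apply/calBP; split.
- by apply: poly_approx_lim => e /ha[b /calBP[b00 _ _ _] h]; exists (b 0 0).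
- move=> t; apply: contrapT => /eqP /rnorm_gt0 h0.
  have h2 : 0 < rnorm (a 0 1 t) / 2 by rewrite divr_gt0.
  have [b /calBP[_ b01 _ _]] := ha _ h2.
  by move=> /(_ 0 1 t); rewrite b01 subr0; lra.
- by apply: unif_cont => e /ha[b /calBP[_ _ b10 _] h]; exists (b 1 0).
- apply: poly_approx_lim => e /ha[b /calBP[_ _ _ b11] h]; exists (fun t => (b 1 1 t)^*) => // t.
  by rewrite -rmorphB /= cnormJ.
Qed.

Lemma calB_funit10 u : continuous u -> calB R (funit u 1 0).
Proof.
move=> cu; apply/calBP; split.
- rewrite (_ : _ 0 0 = fun=> 0); last by apply/funext => t; rewrite funitEt.
  exact: (@poly_approx_cst 0).
- by move=> t; rewrite funitEt.
- by rewrite (_ : _ 1 0 = u)//; apply/funext => t; rewrite funitEt.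
- rewrite (_ : (fun t => _) = fun=> 0); last by apply/funext => t; rewrite funitEt rmorph0.
  exact: (@poly_approx_cst 0).
Qed.

Lemma calB_funit11 u : poly_approx u -> calB R (funit (conj_fun u) 1 1).
Proof.
move=> hu; apply/calBP; split.
- rewrite (_ : _ 0 0 = fun=> 0); last by apply/funext => t; rewrite funitEt.
  exact: (@poly_approx_cst 0).
- by move=> t; rewrite funitEt.
- rewrite (_ : _ 1 0 = fun=> 0); last by apply/funext => t; rewrite funitEt.
  exact: (@cont_cst_fun R _ 0).
- by rewrite (_ : (fun t => _) = u)//; apply/funext => t; rewrite funitEt /conj_fun conjCK.
Qed.

Lemma calB1 : calB R 1%:M.
Proof.
apply/calBP; split.
- rewrite (_ : _ 0 0 = fun=> 1); last by apply/funext => t; rewrite mxE.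
  exact: (@poly_approx_cst 1).
- by move=> t; rewrite mxE.
- rewrite (_ : _ 1 0 = fun=> 0); last by apply/funext => t; rewrite mxE.
  exact: (@cont_cst_fun R _ 0).
- rewrite (_ : (fun t => _) = fun=> 1); last by apply/funext => t; rewrite mxE rmorph1.
  exact: (@poly_approx_cst 1).
Qed.

Lemma calB0 : calB R 0.
Proof.
have := calB_lin (-1) calB1 calB1; congr calB; apply: M2_ext => i j t.
by rewrite linmxEt mulN1r addNr mxE.
Qed.

End AlgebraB.

(** * Toeplitz operators with triangular symbols *)

Section Multiplicative.
Variable R : realType.
Local Notation C := (Cx R).
Local Notation CT := (circle R -> C).
Local Notation P := ('I_2 * nat)%type.
Local Notation VF := ('I_2 -> CT).
Local Notation HP := (l2H R P).
Implicit Types (u v w : VF) (a b : M2fun R) (p q : P).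

Lemma hardy_le w (e : R) : 0 <= e -> vcont w -> (forall k t, rnorm (w k t) <= e) ->
  rnorm (hardy w) <= 2 * e.
Proof.
move=> e0 cw hw; rewrite -ler_sqr ?nnegrE ?mulr_ge0 ?rnorm_ge0//.
apply: le_trans (hardy_norm cw) _; rewrite -[leRHS](@mur_cst R).
apply: (mur_le (fnsq_cont cw) (@rcont_cst R _ _)) => t.
apply: (@le_trans _ _ (\sum_(k < 2) e ^+ 2)).
  by apply: ler_sum => k _; rewrite ler_sqr ?nnegrE ?rnorm_ge0.
by rewrite sumr_const card_ord; have := sqr_ge0 e; nra.
Qed.

(** The mean value property of [g * z ^ n.+1], which vanishes at [0]. *)
Lemma mu_disc_zn g n : poly_approx g -> mu (fun t : circle R => g t * zn n.+1 t) = 0.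
Proof.
move=> /disc_algebra_TP[f fA <-].
have := mu_disc (disc_algebraM fA (@disc_algebraX R n.+1)).
by rewrite -[RHS]/(f 0 * 0 ^+ n.+1) expr0n mulr0.
Qed.

(** All nonnegative Fourier coefficients of such a function vanish, by
    [mu_disc_zn] and conjugation. *)
Lemma hardy_coanalytic g n : poly_approx g ->
  hardy (fun (k : 'I_2) (t : circle R) => if k == 0 then 0 else (g t * zn n.+1 t)^*) = 0.
Proof.
move=> hg; set w : VF := fun k => _.
have cg := poly_approx_cont hg.
have cw : vcont w.
  move=> k; rewrite /w; case: (k == 0); first exact: (@cont_cst_fun R _ 0).
  exact: (cont_conj (contM_fun cg (@zn_cont R n.+1))).
apply: l2_ext => p; rewrite (hardyE p cw) fdot_ebas /w -[RHS]/(0 : C).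
case: (p.1 == 0).
  by rewrite -[RHS](mu0 R); congr mu; apply/funext => t; rewrite mul0r.
have hgm := poly_approxM hg (@poly_approx_zn R p.2).
rewrite -[RHS]conjC0 -(mu_disc_zn n hgm) -mu_conj; last first.
  exact: (contM_fun (poly_approx_cont hgm) (@zn_cont R n.+1)).
by congr mu; apply/funext => t; rewrite /conj_fun -rmorphM mulrAC.
Qed.

Section Commutation.
Variable a : M2fun R.
Hypothesis aB : calB R a.
Let ca := calB_M2CT aB.

(** Projecting [w] onto the Hardy space before multiplying by [a] makes no
    difference after the final projection. *)
Definition toep_comm w := vcont w /\ toep a (hardy w) = hardy (amul a w).

Let toepL : linear (toep a) := (toep_bounded ca).1.

Lemma toep_comm0 : toep_comm (fun _ _ => 0).
Proof.
split; first exact: vcont0.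
rewrite hardy0 (lin0 toepL) (_ : amul a _ = fun _ _ => 0) ?hardy0//.
by apply/funext => k; apply/funext => t; rewrite /amul big1// => l _; rewrite mulr0.
Qed.

Lemma amul_lin (c : C) u v :
  amul a (fun k t => c * u k t + v k t) = (fun k t => c * amul a u k t + amul a v k t).
Proof.
apply/funext => k; apply/funext => t; rewrite /amul mulr_sumr -big_split.
by apply: eq_bigr => l _ /=; rewrite mulrDr mulrCA.
Qed.

Lemma toep_comm_lin (c : C) u v : toep_comm u -> toep_comm v ->
  toep_comm (fun k t => c * u k t + v k t).
Proof.
move=> [cu hu] [cv hv]; split; first exact: (@vcont_lin R c u v cu cv).
rewrite amul_lin (hardy_lin c cu cv) (hardy_lin c (amul_cont ca cu) (amul_cont ca cv)).
by rewrite -hu -hv; exact: toepL.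
Qed.

Lemma toep_comm_sum n (c : 'I_n -> C) (u : 'I_n -> VF) : (forall i, toep_comm (u i)) ->
  toep_comm (fun k t => \sum_i c i * u i k t).
Proof.
move=> hu; elim: (index_enum _) => [|i r IH].
  have := toep_comm0; congr toep_comm; apply/funext => k; apply/funext => t.
  by rewrite big_nil.
have := toep_comm_lin (c i) (hu i) IH; congr toep_comm; apply/funext => k; apply/funext => t.
by rewrite big_cons.
Qed.

Lemma toep_comm_ebas p : toep_comm (ebas p).
Proof. by split; [exact: ebas_cont|rewrite hardy_ebas toep_delta]. Qed.

(** Negative frequencies in the second component are sent to functions
    without nonnegative frequencies, because the entry of [a] at [(0, 1)] is
    zero and the one at [(1, 1)] is conjugate to a function of the disc
    algebra. *)
Lemma toep_comm_neg n : toep_comm (fun (k : 'I_2) (t : circle R) => if k == 0 then 0 else (zn n.+1 t)^*).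
Proof.
have E : (fun k t => if k == 0 then 0 else (zn n.+1 t)^*) =
    (fun (k : 'I_2) (t : circle R) => if k == 0 then 0 else (1 * zn n.+1 t)^*).
  by apply/funext => k; apply/funext => t; rewrite mul1r.
split.
  by move=> k; case: (k == 0); [exact: (@cont_cst_fun R _ 0)|exact: (@znJ_cont R n.+1)].
rewrite [in LHS]E (hardy_coanalytic n (@poly_approx_cst R 1)) (lin0 toepL).
case/calBP: aB => _ a01 _ a11; rewrite -[LHS](hardy_coanalytic n a11); congr (hardy _ : HP).
apply/funext => k; apply/funext => t; rewrite /amul sum_I2 /= mulr0 add0r.
by have [->|->] := I2P k; rewrite /= ?a01 ?mul0r// rmorphM /= conjCK.
Qed.

Lemma toep_comm_znJ i j : toep_comm (fun (k : 'I_2) (t : circle R) => if k == 0 then 0 else zn i t * (zn j t)^*).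
Proof.
have [ij|ji] := ltnP i j.
  have := toep_comm_neg (j - i).-1; congr toep_comm; apply/funext => k; apply/funext => t.
  case: ifP => // _; rewrite prednK ?subn_gt0// -[in RHS](subnK (ltnW ij)) znD rmorphM /=.
  by rewrite mulrCA -[zn i t * _]mulrC znJ mulr1.
have := toep_comm_ebas (1, (i - j)%N); congr toep_comm; apply/funext => k; apply/funext => t.
rewrite /ebas; have [->|->] := I2P k => //=.
rewrite -[in RHS](subnK ji) znD -mulrA [zn j t * _]mulrC znJ mulr1 //.
Qed.

Lemma toep_comm_lim w : vcont w -> (forall e : R, 0 < e -> exists2 v, toep_comm v &
  forall k t, rnorm (w k t - v k t) <= e) -> toep_comm w.
Proof.
move=> cw hw; split; first exact: cw.
have num (x y z d : R) : 0 < z -> z * (x * 2 + 4 * y + 1) = d ->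
  d <= x * (2 * z) + 2 * (2 * y * z) -> False by move=> *; nra.
have [c c0 hc] := bounded_opE (toep_bounded ca).
have [m m0 hm] := M2CT_bounded ca.
apply/eqP; rewrite -subr_eq0; apply: contraT => /rnorm_gt0.
set D := toep a (hardy w) - _ => D0; pose M := c * 2 + 4 * m + 1.
have M0 : 0 < M by rewrite /M ltr_wpDl// addr_ge0// mulr_ge0.
have e0 : 0 < rnorm D / M by rewrite divr_gt0.
have [v [cv hv] hwv] := hw _ e0; move: (rnorm D / M) e0 hwv (divfK (lt0r_neq0 M0) (rnorm D)).
move=> e e0 hwv eM.
pose d : VF := fun k t => -1 * v k t + w k t.
have cd : vcont d by exact: (@vcont_lin R (-1) v w cv cw).
have hd k t : rnorm (d k t) <= e by rewrite /d mulN1r addrC.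
have DE : D = toep a (hardy d) - hardy (amul a d).
  rewrite /d amul_lin (hardy_lin (-1) cv cw) (hardy_lin (-1) (amul_cont ca cv) (amul_cont ca cw)).
  rewrite -hv [toep a _](toepL (-1)).
  have gen (V : lmodType C) (x y z : V) : y - z = (-1 *: x + y) - (-1 *: x + z).
    by rewrite opprD addrACA subrr add0r.
  exact: (gen HP).
have had k t : rnorm (amul a d k t) <= 2 * m * e.
  apply: le_trans (rnorm_sum _ _ _) _; apply: (@le_trans _ _ (\sum_(l < 2) m * e)).
    apply: ler_sum => l _; rewrite cnormM.
    by apply: ler_pM; rewrite ?rnorm_ge0//; exact: hd.
  by rewrite sumr_const card_ord; lra.
have h1 : rnorm (toep a (hardy d)) <= c * (2 * e).
  exact: (le_trans (hc _) (ler_wpM2l c0 (hardy_le (ltW e0) cd hd))).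
have h2 : rnorm (hardy (amul a d)) <= 2 * (2 * m * e).
  have me0 : 0 <= 2 * m * e := mulr_ge0 (mulr_ge0 (ler0n _ _) m0) (ltW e0).
  exact: (hardy_le me0 (amul_cont ca cd) had).
have h3 : rnorm D <= c * (2 * e) + 2 * (2 * m * e).
  by rewrite {1}DE; exact: (le_trans (rnormB _ _) (lerD h1 h2)).
by case: (num _ _ _ _ e0 eM h3).
Qed.

(** By uniform approximation it is enough to treat monomials. In the first
    component only nonnegative frequencies occur, since [w 0] is a limit of
    polynomials; in the second component all frequencies are allowed, by
    [toep_comm_neg]. *)
Lemma toep_comm_analytic w : vcont w -> poly_approx (w 0) -> toep_comm w.
Proof.
move=> cw hw0; apply: (toep_comm_lim cw) => e e0.
have [p hp] := hw0 e e0; have [N hN] := fejer_approx (cw 1) e0.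
pose c i j := toC N.+1%:R^-1 * mu (fun s => w 1 s * (zn j s * (zn i s)^*)).
have h0 := toep_comm_sum (fun i : 'I_(size p) => p`_i) (fun i => toep_comm_ebas (0, i : nat)).
have h1 := toep_comm_sum (fun i : 'I_N.+1 => 1) (fun i : 'I_N.+1 => toep_comm_sum
  (fun j : 'I_N.+1 => c i j) (fun j : 'I_N.+1 => toep_comm_znJ i j)).
have := toep_comm_lin 1 h0 h1; set v := (fun k t => _) => hv; exists v => // k t.
rewrite /v; have [->|->] := I2P k.
  rewrite mul1r [X in _ - (_ + X)]big1 ?addr0 => [|i _]; last first.
    by rewrite big1 ?mulr0// => j _; rewrite mulr0.
  by rewrite (_ : \sum_i _ = p.[set_val t])// horner_coef.
rewrite [X in _ - (1 * X + _)]big1 ?mulr0 ?add0r => [|i _]; last by rewrite /ebas mulr0.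
rewrite rnormC (_ : \sum_i _ = mu (fun s => w 1 s * toC (fejer N t s)))//.
rewrite (fejer_trig _ _ (cw 1)); apply: eq_bigr => i _; rewrite mul1r.
by [].
Qed.

End Commutation.

(** In general Toeplitz operators are not multiplicative in the symbol. For
    symbols in [calB], multiplication by [b] sends the Hardy space to
    functions with analytic first component, and there [toep_comm_analytic]
    lets the projection between [a] and [b] be dropped. *)
Lemma toepM a b : calB R a -> calB R b -> toep (a *m b) = toep a \o toep b.
Proof.
move=> ha hb; have [ca cb] := (calB_M2CT ha, calB_M2CT hb); have cab := M2CTM ca cb.
apply: (bounded_op_basis (toep_bounded cab)).
  exact: (bounded_op_comp (toep_bounded ca) (toep_bounded cb)).
move=> q; rewrite (toep_delta _ cab).
transitivity (toep a (toep b (ldelta R q))) => //.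
rewrite (toep_delta _ cb) -amulM; apply/esym.
apply: (proj2 (toep_comm_analytic ha (amul_cont cb (@ebas_cont R q)) _)).
case/calBP: hb => b00 b01 _ _.
rewrite (_ : amul b (ebas q) 0 = fun t => b 0 0 t * ebas q 0 t); last first.
  by apply/funext => t; rewrite /amul sum_I2 b01 mul0r addr0.
apply: (poly_approxM b00); rewrite /ebas; case: ifP => _; first exact: poly_approx_zn.
exact: (@poly_approx_cst R 0).
Qed.

Lemma toep_shift : toep (funit (fun=> 1) 1 0) (ldelta R (0, 0%N)) = ldelta R (1, 0%N).
Proof.
rewrite (toep_delta _ (@M2CT_funit R _ 1 0 (@cont_cst_fun R _ 1))) -(@hardy_ebas R (1, 0%N)); congr (hardy _ : HP).
apply/funext => k; apply/funext => t.
rewrite /amul sum_I2 !funitEt /ebas.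
by have [->|->] := I2P k; rewrite /= ?mul0r ?mul1r ?mulr0 ?addr0.
Qed.

Lemma toep_kill : toep (funit (conj_fun (zn 1)) 1 0) (ldelta R (0, 0%N)) = 0.
Proof.
rewrite (toep_delta _ (@M2CT_funit R _ 1 0 (cont_conj (@zn_cont R 1)))).
rewrite -(hardy_coanalytic 0 (@poly_approx_cst R 1)); congr (hardy _ : HP).
apply/funext => k; apply/funext => t.
rewrite /amul sum_I2 !funitEt /ebas.
have [->|->] := I2P k; rewrite /= ?mul0r ?mulr0 ?addr0 ?mul1r//.
by rewrite /conj_fun [zn 0 t]expr0 mulr1.
Qed.

End Multiplicative.

(** * The operator algebra and its representations *)

Lemma inv_small (R : realType) (e : R) : 0 < e -> exists n, n.+1%:R^-1 <= e.
Proof. by move=> /ltr_add_invr[n]; rewrite add0r => /ltW h; exists n. Qed.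

Lemma le_small (R : realType) (r c : R) : 0 <= c -> (forall n, r <= c * n.+1%:R^-1) -> r <= 0.
Proof.
move=> c0 h; rewrite leNgt; apply/negP => r0; have c1 : 0 < c + 1 by rewrite ltr_wpDl.
have [n hn] := inv_small (divr_gt0 r0 c1).
have := h n; apply/negP; rewrite -ltNge; apply: (@le_lt_trans _ _ (c * (r / (c + 1)))).
  by rewrite ler_wpM2l.
by rewrite mulrCA gtr_pMr// ltr_pdivrMr// mul1r ltrDl.
Qed.

Section Image.
Variables (R : realType) (K : hilbertSpace R) (rho : M2fun R -> (K -> K)).
Hypothesis rhoP : faithful_unital_star_rep rho.
Local Notation C := (Cx R).
Local Notation CT := (circle R -> C).
Let rhoS := faithful_star_rep rhoP.
Let B : set (K -> K) := rho @` calB R.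
Implicit Types (a b : M2fun R).

(** Representations of the algebra are maps on operators; through this
    inverse, maps defined on symbols become such maps. *)
Definition rinv (T : K -> K) : M2fun R :=
  if pselect (exists a, M2CT R a /\ rho a = T) is left h then projT1 (cid h) else 0.

Lemma rinvK a : M2CT R a -> rinv (rho a) = a.
Proof.
move=> ca; rewrite /rinv; case: pselect => [h|[]]; last by exists a.
by case: (cid h) => b [cb E] /=; exact: (srep_faithful rhoP cb ca E).
Qed.

Lemma symbols n (T : 'M[K -> K]_n) : (forall i j, B (T i j)) ->
  exists2 a : 'M[M2fun R]_n, forall i j, calB R (a i j) & T = map_mx rho a.
Proof.
move=> hT; have /choice[f hf] (ij : 'I_n * 'I_n) : exists a, calB R a /\ rho a = T ij.1 ij.2.
  by have [a aB E] := hT ij.1 ij.2; exists a.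
exists (\matrix_(i, j) f (i, j)) => [i j|]; first by rewrite mxE; case: (hf (i, j)).
by apply/matrixP => i j; rewrite !mxE; case: (hf (i, j)).
Qed.

(** The operator norm in the given representation controls all pointwise
    norms. Every use of the faithfulness of [rho] for norms goes through
    here or through [entry_le_of_norm]. *)
Lemma pw_bound_mxopnorm n (a : 'M[M2fun R]_n) : M2CTn a ->
  0 <= mxopnorm (map_mx rho a) /\ pw_bound (mxopnorm (map_mx rho a)) a.
Proof.
move=> ca; have ba := rep_bounded_mx rhoS ca; have m0 := mxopnorm_ge0 ba.
split; first exact: m0.
by apply: (pw_bound_of_rep rhoP m0 ca) => X; exact: (le_mxopnorm X ba).
Qed.

Section Lift.
Variables (H : hilbertSpace R) (sigma : M2fun R -> (H -> H)).
Hypothesis sigma_bounded : forall a, calB R a -> bounded_op (sigma a).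
Hypothesis sigma_lin : forall (c : C) a b, calB R a -> calB R b ->
  sigma ((cst c : CT) *: a + b) = c *: sigma a + sigma b.
Hypothesis sigma_mul : forall a b, calB R a -> calB R b ->
  sigma (a *m b) = sigma a \o sigma b.
Hypothesis sigma_cc : forall n (c : R) (a : 'M[M2fun R]_n) (X : 'I_n -> H), 0 <= c -> M2CTn a ->
  pw_bound c a -> hnormn (ract sigma a X) <= c * hnormn X.

Definition lift_rep T := sigma (rinv T).

Lemma lift_repE a : calB R a -> lift_rep (rho a) = sigma a.
Proof. by move=> /calB_M2CT ca; rewrite /lift_rep rinvK. Qed.

Lemma map_lift_rep n (a : 'M[M2fun R]_n) : (forall i j, calB R (a i j)) ->
  map_mx lift_rep (map_mx rho a) = map_mx sigma a.
Proof. by move=> ha; apply/matrixP => i j; rewrite !mxE lift_repE. Qed.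

(** A linear multiplicative map on symbols that is completely contractive
    for the pointwise norms is a representation of the algebra, whatever the
    faithful representation is. *)
Lemma lift_representation : representation B lift_rep.
Proof.
split.
- by move=> _ [a ha <-]; rewrite lift_repE//; exact: sigma_bounded.
- move=> c _ _ [a ha <-] [b hb <-].
  rewrite -(srep_lin rhoP c (calB_M2CT ha) (calB_M2CT hb)).
  rewrite (lift_repE ha) (lift_repE hb) (lift_repE (calB_lin c ha hb)); exact: sigma_lin.
- move=> _ _ [a ha <-] [b hb <-]; rewrite -(srep_mul rhoP (calB_M2CT ha) (calB_M2CT hb)).
  by rewrite (lift_repE ha) (lift_repE hb) (lift_repE (calB_mul ha hb)); exact: sigma_mul.
- move=> n T /symbols[a ha ->]; rewrite (map_lift_rep ha).
  have ca : M2CTn a by move=> i j; exact: (calB_M2CT (ha i j)).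
  have [m0 hm] := pw_bound_mxopnorm ca.
  by apply: (mxopnorm_le m0) => X; exact: (sigma_cc X m0 ca hm).
Qed.

End Lift.

Definition ev_rep (t : circle R) := lift_rep (ev t).

Lemma ev_representation t : representation B (ev_rep t).
Proof.
apply: lift_representation.
- by move=> a /calB_M2CT; exact: (star_rep_bounded (evP t)).
- by move=> c a b /calB_M2CT ca /calB_M2CT cb; exact: (star_rep_lin (evP t) c ca cb).
- by move=> a b /calB_M2CT ca /calB_M2CT cb; exact: (star_rep_mul (evP t) ca cb).
- by move=> n c a X c0 ca; exact.
Qed.

Definition toep_rep := lift_rep (@toep R).

Lemma toep_representation : representation B toep_rep.
Proof.
apply: lift_representation.
- by move=> a /calB_M2CT; exact: toep_bounded.
- by move=> c a b /calB_M2CT ca /calB_M2CT cb; exact: (toep_lin c ca cb).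
- by move=> a b; exact: toepM.
- by move=> n c a X; exact: toep_cc.
Qed.

(** Point evaluations are finite dimensional representations, and by
    [ract_le] the norm of a matrix over the algebra is the supremum of its
    pointwise norms. *)
Lemma rho_calB_RFD : RFD B.
Proof.
move=> n T /symbols[a ha ->].
have ca : M2CTn a by move=> i j; exact: (calB_M2CT (ha i j)).
set S := (X in sup X).
have evS t : S (mxopnorm (map_mx (ev t) a)).
  exists (l2H R (unit * 'I_2)%type), (ev_rep t).
  by split; [exact: l2_finite_dim|exact: ev_representation|rewrite (map_lift_rep _ ha)].
have ubS : ubound S (mxopnorm (map_mx rho a)).
  move=> _ [H [pi [_ piP ->]]]; apply: (rep_cc piP) => i j; rewrite mxE.
  by exists (a i j) => //; exact: ha.
have t1 : rnorm (1 : C) = 1 by rewrite -toC1 cnorm_toC normr1.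
have S0 : S !=set0 by exists (mxopnorm (map_mx (ev (circle_pt t1)) a)); exact: evS.
apply/eqP; rewrite eq_le; apply/andP; split; last exact: ge_sup.
have leS t : mxopnorm (map_mx (ev t) a) <= sup S.
  by apply: ub_le_sup; [exists (mxopnorm (map_mx rho a))|exact: evS].
have bev t := rep_bounded_mx (evP t) ca.
have s0 : 0 <= sup S := le_trans (mxopnorm_ge0 (bev (circle_pt t1))) (leS _).
have pw : pw_bound (sup S) a.
  move=> t X; apply: le_trans (le_mxopnorm X (bev t)) _.
  by rewrite ler_wpM2r// sqrtr_ge0.
by apply: (mxopnorm_le s0) => X; exact: (ract_le rhoS X s0 ca pw).
Qed.

Lemma entry_le_of_norm a (c : R) : 0 <= c -> M2CT R a ->
  (forall x, rnorm (rho a x) <= c * rnorm x) -> forall i j t, rnorm (a i j t) <= c.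
Proof.
move=> c0 ca ha i j t; pose a1 : 'M[M2fun R]_1 := \matrix_(i, j) a.
have ca1 : M2CTn a1 by move=> k l; rewrite mxE; exact: ca.
have n1 (X : 'I_1 -> K) : hnormn X = rnorm (X 0).
  by rewrite /hnormn big_ord1 sqrtr_sqr ger0_norm// rnorm_ge0.
have pw : pw_bound c a1.
  apply: (pw_bound_of_rep rhoP c0 ca1) => X; rewrite !n1 ractE big_ord1 mxE.
  exact: ha.
by have := pw_bound_entry c0 ca1 pw 0 0 i j t; rewrite mxE.
Qed.

(** The symbols of a convergent sequence are uniformly Cauchy by
    [entry_le_of_norm], and [calB_lim] applies to their limit. *)
Lemma rho_calB_closed (T : K -> K) : bounded_op T ->
  (forall e : R, 0 < e -> exists2 a, B a & opnorm (T - a) < e) -> B T.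
Proof.
move=> bT hT.
have inv0 n : 0 < n.+1%:R^-1 :> R by rewrite invr_gt0 ltr0n.
have /choice[b hb] n : exists b, calB R b /\
    forall x, rnorm (T x - rho b x) <= n.+1%:R^-1 * rnorm x.
  have [_ [b bB <-] hb] := hT _ (inv0 n); exists b; split => // x.
  have bTb : bounded_op (T - rho b).
    exact: (bounded_opB bT (srep_bounded rhoP (calB_M2CT bB))).
  apply: le_trans (le_opnorm x bTb) _.
  by apply: ler_wpM2r; [exact: rnorm_ge0|exact: ltW hb].
have cb n : M2CT R (b n) by apply: calB_M2CT; case: (hb n).
have hnm n m i j t : rnorm (b n i j t - b m i j t) <= n.+1%:R^-1 + m.+1%:R^-1.
  have cnm := M2CTB (cb n) (cb m).
  have nm0 : 0 <= n.+1%:R^-1 + m.+1%:R^-1 :> R by rewrite addr_ge0// ltW.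
  have := @entry_le_of_norm (b n - b m) _ nm0 cnm.
  have E : (b n - b m) i j t = b n i j t - b m i j t by rewrite !mxE.
  rewrite -E; apply => x.
  rewrite (srepB rhoS (cb n) (cb m)) -[(_ - _) x]/(rho (b n) x - rho (b m) x).
  apply: le_trans (rnorm_distD (T x) _ _) _; rewrite mulrDl; apply: lerD; last by case: (hb m).
  by rewrite rnormC; case: (hb n).
have /choice[l hl] (ijt : 'I_2 * 'I_2 * circle R) : exists l : C, forall n,
    rnorm (b n ijt.1.1 ijt.1.2 ijt.2 - l) <= n.+1%:R^-1.
  (* The limit of a uniformly Cauchy sequence of scalars is read off from
     [poly_lim], applied to constant polynomials. *)
  pose p n : {poly C} := (b n ijt.1.1 ijt.1.2 ijt.2)%:P.
  have hp n m (t : circle R) : rnorm ((p n).[set_val t] - (p m).[set_val t]) <=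
      1 / n.+1%:R + 1 / m.+1%:R by rewrite !hornerC !div1r.
  have [F [hF _]] := poly_lim ler01 hp; exists (F 0) => n.
  have z1 : rnorm (0 : C) <= 1 by rewrite rnorm0.
  by have := hF n 0 z1; rewrite hornerC rnormC div1r.
pose a : M2fun R := \matrix_(i, j) fun t => l (i, j, t).
have ha n i j t : rnorm (b n i j t - a i j t) <= n.+1%:R^-1.
  by rewrite mxE; exact: (hl (i, j, t)).
have aB : calB R a.
  apply: calB_lim => e /inv_small[n hn]; exists (b n); first by case: (hb n).
  by move=> i j t; rewrite rnormC; exact: le_trans hn.
exists a => //; apply/funext => x; apply/eqP; rewrite -subr_eq0; apply/eqP/rnorm_eq0.
apply/eqP; rewrite eq_le rnorm_ge0 andbT.
apply: (@le_small _ _ (5 * rnorm x)); first by rewrite mulr_ge0// rnorm_ge0.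
move=> n; have [_ hn] := hb n; have := hn x.
have cna := M2CTB (cb n) (calB_M2CT aB).
have : rnorm (rho (b n - a) x) <= 4 * n.+1%:R^-1 * rnorm x.
  apply: (srep_entry_bound rhoS x (ltW (inv0 n)) cna) => i j t.
  by have := ha n i j t; rewrite !mxE.
rewrite (srepB rhoS (cb n) (calB_M2CT aB)) -[(_ - _) x]/(rho (b n) x - rho a x) => h1 h2.
have := rnorm_distD (rho (b n) x) (rho a x) (T x).
rewrite [rnorm (rho a x - rho (b n) x)]rnormC [rnorm (rho (b n) x - T x)]rnormC.
move: h1 h2; clear; move: n.+1%:R^-1 => d h1 h2 h3; nra.
Qed.

Lemma rho_calB_unital : unital_operator_algebra B.
Proof.
split; last by exists 1%:M; [exact: calB1|exact: (srep_unital rhoP)].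
split.
- by move=> _ [a /calB_M2CT ca <-]; exact: (srep_bounded rhoP).
- by exists 0; [exact: calB0|exact: (srep0 rhoS)].
- move=> c _ _ [a ha <-] [b hb <-]; exists ((cst c : CT) *: a + b); first exact: calB_lin.
  exact: (srep_lin rhoP c (calB_M2CT ha) (calB_M2CT hb)).
- move=> _ _ [a ha <-] [b hb <-]; exists (a *m b); first exact: calB_mul.
  exact: (srep_mul rhoP (calB_M2CT ha) (calB_M2CT hb)).
- exact: rho_calB_closed.
Qed.

End Image.

(** * Recurrence in finite dimensional representations *)

Section Recurrence.
Variables (R : realType) (H : hilbertSpace R).
Local Notation C := (Cx R).

(** A cluster point of the image of an ultrafilter is a limit. *)
Lemma ultra_bounded_cvg (U : set_system nat) (z : nat -> C) (M : R) : UltraFilter U ->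
  (forall n, rnorm (z n) <= M) -> exists l : C, z @ U --> l.
Proof.
move=> UU hz.
have zM : (z @ U) [set w : C | rnorm w <= M].
  have -> : (z @ U) [set w : C | rnorm w <= M] = U (z @^-1` [set w : C | rnorm w <= M]) by [].
  rewrite (_ : z @^-1` _ = setT); first exact: filterT.
  by apply/seteqP; split => // n _; exact: hz.
have [l [_ hl]] := @compact_disc R M (z @ U) _ zM; exists l => V Vl.
have [//|hc] := in_ultra_setVsetC (z @^-1` V) UU.
by have [w [/= nVw Vw]] := hl (~` V) V hc Vl.
Qed.

(** Bounded sequences in a finite dimensional space converge along
    ultrafilters. The induction removes the first spanning vector [u]: [q]
    is the projection onto the orthogonal complement of [u], and the
    coefficients along [u] are bounded scalars. *)
Lemma ultra_span_cvg (U : set_system nat) : UltraFilter U ->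
  forall N (e : 'I_N -> H) (y : nat -> H) (M : R),
    (forall n, exists c : 'I_N -> C, y n = \sum_i c i *: e i) ->
    (forall n, rnorm (y n) <= M) -> exists l : H, y @ U --> l.
Proof.
move=> UU; elim=> [|N IH] e y M hy yM.
  exists 0; apply: cvg_near_cst; apply: nearW => n.
  by have [c ->] := hy n; rewrite big_ord0.
pose u := e ord0; pose k (v : H) : C := hdot H v u / hdot H u u.
pose q (v : H) : H := v - k v *: u.
have kl : linear_for *%R k by move=> c v w; rewrite /k linearPl mulrDl mulrA.
have ql : linear q.
  move=> c v w; rewrite /q kl scalerDl scalerBr scalerA opprD addrACA; congr (_ + _).
have qu : q u = 0.
  rewrite /q /k; have [->|u0] := eqVneq u 0; first by rewrite scaler0 subr0.
  have uu : hdot H u u != 0.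
    by rewrite hdotxx -[0]/(toC 0) (inj_eq (@toC_inj R)) expf_eq0 /= gt_eqF// rnorm_gt0.
  by rewrite divff// scale1r subrr.
(* When [u] is zero both sides of the next bound are zero, with the
   convention for the inverse of zero. *)
pose M' := M * rnorm u * (rnorm u ^+ 2)^-1.
have kM n : rnorm (k (y n)) <= M'.
  rewrite /k hdotxx -toCV cnormM cnorm_toC ger0_norm ?invr_ge0 ?sqr_ge0//.
  apply: ler_wpM2r; first by rewrite invr_ge0 sqr_ge0.
  by apply: le_trans (hcauchy_schwarz _ _) _; apply: ler_wpM2r; rewrite ?rnorm_ge0.
have [l1 hl1] := ultra_bounded_cvg UU kM.
have [n|n|l2 hl2] := IH (fun i => q (e (lift ord0 i))) (q \o y) (M + M' * rnorm u).
- have [c yE] := hy n; exists (fun i => c (lift ord0 i)).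
  rewrite /= yE (lin_sum ql) big_ord_recl (linZ ql) qu scaler0 add0r.
  by apply: eq_bigr => i _; rewrite (linZ ql).
- apply: le_trans (rnormB _ _) _; apply: lerD => //; rewrite rnormZ.
  by apply: ler_wpM2r; [exact: rnorm_ge0|exact: kM].
exists (l2 + l1 *: u).
rewrite (_ : y = fun n => (q \o y) n + k (y n) *: u); last first.
  by apply/funext => n; rewrite /= /q subrK.
by apply: cvgD; [exact: hl2|apply: cvgZr_tmp; exact: hl1].
Qed.

(** The sequence converges along an ultrafilter of unbounded sets of
    indices, so two of its terms with different indices are close. *)
Lemma span_recurrence N (e : 'I_N -> H) (y : nat -> H) (M d : R) :
  (forall n, exists c : 'I_N -> C, y n = \sum_i c i *: e i) ->
  (forall n, rnorm (y n) <= M) -> 0 < d ->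
  exists m k, rnorm (y m - y (m + k).+1) < d.
Proof.
move=> hy yM d0; have [U [UU hU]] := ultraFilterLemma (eventually_filter).
have [l hl] := ultra_span_cvg UU hy yM.
have d2 : 0 < d / 2 by rewrite divr_gt0.
have near_l : U [set n | rnorm (l - y n) < d / 2] by exact: (proj1 (rcvgP _ _) hl _ d2).
have [m hm] := filter_ex near_l.
have later : U [set n | (m < n)%N] by apply: hU; exists m.+1.
have [n [hn mn]] := filter_ex (filterI near_l later).
exists m, (n - m.+1)%N; rewrite -addSn subnKC//.
apply: le_lt_trans (rnorm_distD l _ _) _; rewrite rnormC.
by rewrite [ltRHS]splitr; exact: ltrD.
Qed.

End Recurrence.

Section FiniteDimRep.
Variables (R : realType) (K : hilbertSpace R) (rho : M2fun R -> (K -> K)).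
Hypothesis rhoP : faithful_unital_star_rep rho.
Local Notation C := (Cx R).
Local Notation CT := (circle R -> C).
Let rhoS := faithful_star_rep rhoP.
Let B : set (K -> K) := rho @` calB R.
Variables (H : hilbertSpace R) (pi : (K -> K) -> (H -> H)).

(** Complete contractivity of [pi] for one by one matrices. *)
Lemma rep_norm_le a (c : R) v : representation B pi -> calB R a -> 0 <= c ->
  (forall x, rnorm (rho a x) <= c * rnorm x) -> rnorm (pi (rho a) v) <= c * rnorm v.
Proof.
move=> piP aB c0 ha; pose T : 'M[K -> K]_1 := \matrix_(i, j) rho a.
have BT i j : B (T i j) by rewrite mxE; exists a.
have n1 (H' : hilbertSpace R) (X : 'I_1 -> H') : hnormn X = rnorm (X 0).
  by rewrite /hnormn big_ord1 sqrtr_sqr ger0_norm// rnorm_ge0.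
have mT : mxopnorm T <= c.
  apply: (mxopnorm_le c0) => X; rewrite !n1 /mxact big_ord1 mxE; exact: ha.
have bpT : bounded_mx (map_mx pi T).
  by move=> i j; rewrite mxE; exact: (rep_bounded piP (BT i j)).
have := le_mxopnorm (fun=> v) bpT; rewrite !n1 /mxact big_ord1 !mxE => /le_trans; apply.
by apply: ler_wpM2r; [exact: rnorm_ge0|exact: le_trans (rep_cc piP BT) mT].
Qed.

Hypothesis piF : finite_dim_rep B pi.
Variable x : H.

(** The backward shift [S] is a contraction that moves the orbit [y n], the
    image of [x] under the element [z ^ n] at position [(1, 0)], one step
    down, and that sends [y 0] to the left-hand vector. So norms increase
    along the orbit. The orbit stays in a finite dimensional space and is
    bounded, hence it almost returns: [y m] is close to some later
    [y (m + k).+1]. Applying [S] to both [m.+1] times, the left-hand vector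
    is close to [y k], whose norm is at least that of [y 0]. *)
Lemma finite_dim_rep_isometric :
  rnorm (pi (rho (funit (conj_fun (zn 1)) 1 0)) x) = rnorm (pi (rho (funit (fun=> 1) 1 0)) x).
Proof.
have [piP [N [e he]]] := piF.
pose y n := pi (rho (funit (zn n) 1 0)) x.
pose sh : M2fun R := funit (conj_fun (zn 1)) 1 1; pose S := pi (rho sh).
set z := pi _ x.
have yB n : calB R (funit (zn n) 1 0) by apply: calB_funit10; exact: zn_cont.
have shB : calB R sh by apply: calB_funit11; exact: poly_approx_zn.
have Smul (f : CT) : continuous f ->
    S (pi (rho (funit f 1 0)) x) = pi (rho (funit (conj_fun (zn 1) * f) 1 0)) x.
  move=> cf; have fB := calB_funit10 cf.
  have [B1 B2] : B (rho sh) /\ B (rho (funit f 1 0)) by split; [exists sh|exists (funit f 1 0)].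
  rewrite -(funitM _ _ 1 1 0) (srep_mul rhoP (calB_M2CT shB) (calB_M2CT fB)).
  by rewrite (rep_comp piP B1 B2).
have Sy n : S (y n.+1) = y n.
  rewrite /y (Smul _ (@zn_cont R n.+1)); congr (pi (rho (funit _ 1 0)) x).
  apply/funext => t; rewrite -[LHS]/((zn 1 t)^* * zn n.+1 t) -[n.+1]add1n znD mulrA znJ mul1r.
  by [].
have Sy0 : S (y 0%N) = z.
  rewrite /y (Smul _ (@zn_cont R 0)); congr (pi (rho (funit _ 1 0)) x).
  by apply/funext => t; rewrite -[LHS]/((zn 1 t)^* * zn 0 t) [zn 0 t]expr0 mulr1.
have bS : linear S.
  by have [] : bounded_op S by apply: (rep_bounded piP); exists sh.
have Sle v : rnorm (S v) <= rnorm v.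
  rewrite -[leRHS]mul1r; apply: (rep_norm_le _ piP shB ler01) => w.
  apply: (srep_unit_bound rhoS _ _ w ler01 (cont_conj (@zn_cont R 1))) => t.
  by rewrite cnormJ zn_norm.
have ybound n : rnorm (y n) <= rnorm x.
  rewrite -[leRHS]mul1r; apply: (rep_norm_le _ piP (yB n) ler01) => w.
  by apply: (srep_unit_bound rhoS _ _ w ler01 (@zn_cont R n)) => t; rewrite zn_norm.
have yspan n : exists c : 'I_N -> C, y n = \sum_i c i *: e i.
  apply: he; apply: subset_closure; exists 1%N, (fun=> 1), (fun=> y n).
  split=> [_|]; last by rewrite big_ord1 scale1r.
  exists (pi (rho (funit (zn n) 1 0))); last by exists x.
  by move=> D [_]; apply; exists (rho (funit (zn n) 1 0)) => //; exists (funit (zn n) 1 0).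
have ymono k : rnorm (y 0%N) <= rnorm (y k).
  by elim: k => // k /le_trans; apply; rewrite -(Sy k); exact: Sle.
(* Apply [S] to the pair of terms [m.+1] times: the first one leaves the
   orbit and becomes [z]. *)
have zclose m k : rnorm (z - y k) <= rnorm (y m - y (m + k).+1).
  elim: m => [|m /le_trans]; last apply.
    by rewrite -Sy0 -(Sy k) -(linN bS) -(linD bS); exact: Sle.
  by rewrite -(Sy m) -(Sy (m + k).+1) -(linN bS) -(linD bS) addSn; exact: Sle.
rewrite (_ : pi (rho (funit (fun=> 1) 1 0)) x = y 0%N); last first.
  by congr (pi (rho (funit _ 1 0)) x); apply/funext => t; rewrite /zn expr0.
apply/eqP; rewrite eq_le; apply/andP; split; first by rewrite -Sy0 Sle.
apply/ler_addgt0Pr => d d0.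
have [m [k hmk]] := span_recurrence yspan ybound d0.
apply: le_trans (ymono k) _; rewrite -lerBlDl.
apply: le_trans (rnormB_ge _ _) _; rewrite rnormC.
exact: le_trans (zclose m k) (ltW hmk).
Qed.

End FiniteDimRep.

(** * The Toeplitz representation is not a limit *)

Section NoApproximation.
Variables (R : realType) (K : hilbertSpace R) (rho : M2fun R -> (K -> K)).
Hypothesis rhoP : faithful_unital_star_rep rho.
Let B : set (K -> K) := rho @` calB R.

Lemma net_filter_proper (I : Type) (le : I -> I -> Prop) : directed le ->
  ProperFilter (net_filter le).
Proof.
move=> D; apply: filter_from_proper => [|i _]; last by exists i; exact: (directed_refl D).
apply: filter_from_filter => [|i j _ _]; first by case: (directed_inh D) => i; exists i.
have [k [ik jk]] := directed_ub D i j; exists k => // l kl.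
by split; apply: (directed_trans D) kl.
Qed.

(** Norms of images of [x] are continuous for pointwise strong convergence,
    so the identity of [finite_dim_rep_isometric] passes to limits of nets. *)
Lemma point_SOT_isometric (H : hilbertSpace R) (I : Type) (le : I -> I -> Prop)
    (pil : I -> (K -> K) -> (H -> H)) (pi : (K -> K) -> (H -> H)) x :
  directed le -> (forall i, finite_dim_rep B (pil i)) -> point_SOT_cvg B le pil pi ->
  rnorm (pi (rho (funit (conj_fun (zn 1)) 1 0)) x) = rnorm (pi (rho (funit (fun=> 1) 1 0)) x).
Proof.
move=> /net_filter_proper FF hfd hcv.
have cv a : calB R a -> (fun i => rnorm (pil i (rho a) x)) @ net_filter le -->
    rnorm (pi (rho a) x).
  by move=> ha; apply: rcvg_norm; apply: hcv; exists a.
have cz : calB R (funit (conj_fun (zn 1)) 1 0).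
  by apply: calB_funit10; exact: (cont_conj (@zn_cont R 1)).
have c1 : calB R (funit (fun=> 1) 1 0) by apply: calB_funit10; exact: (@cont_cst_fun R _ 1).
have h1 := cv _ cz; have h2 := cv _ c1.
have E : (fun i => rnorm (pil i (rho (funit (conj_fun (zn 1)) 1 0)) x)) =
    (fun i => rnorm (pil i (rho (funit (fun=> 1) 1 0)) x)).
  by apply/funext => i; exact: (finite_dim_rep_isometric rhoP (hfd i)).
by rewrite E in h1; apply: (cvg_unique (@Rhausdorff R) h1 h2).
Qed.

(** For the Toeplitz representation, [toep_kill] and [toep_shift] give the
    values [0] and [1] to the two norms that [point_SOT_isometric]
    identifies. *)
Lemma toep_rep_not_limit (I : Type) (le : I -> I -> Prop)
    (pil : I -> (K -> K) -> (l2H R ('I_2 * nat)%type -> l2H R ('I_2 * nat)%type)) :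
  directed le -> (forall i, finite_dim_rep B (pil i)) ->
  ~ point_SOT_cvg B le pil (toep_rep rho).
Proof.
move=> D hfd hcv; pose x : l2H R ('I_2 * nat)%type := ldelta R (0 : 'I_2, 0%N).
have := point_SOT_isometric x D hfd hcv; rewrite /x {x}.
rewrite /toep_rep !(lift_repE rhoP (@toep R)); last 2 first.
- by apply: calB_funit10; exact: (@cont_cst_fun R _ 1).
- by apply: calB_funit10; exact: (cont_conj (@zn_cont R 1)).
rewrite toep_shift toep_kill rnorm0 => /esym/rnorm_eq0.
move=> /(congr1 (fun v : l2 R _ => v (1, 0%N))); rewrite ldeltaE eqxx => /eqP.
by apply/negP; exact: oner_neq0.
Qed.

End NoApproximation.

Theorem theorem1p3 (R : realType) :
  (exists (K : hilbertSpace R) (rho : M2fun R -> (K -> K)),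
     faithful_unital_star_rep rho) /\
  (forall (K : hilbertSpace R) (rho : M2fun R -> (K -> K)),
     faithful_unital_star_rep rho ->
     let B : set (K -> K) := rho @` calB R in
     (unital_operator_algebra B /\ RFD B) /\
     (exists (H : hilbertSpace R) (pi : (K -> K) -> (H -> H)),
        [/\ representation B pi,
            pi id = id &
            ~ exists (I : Type) (le : I -> I -> Prop)
                     (pil : I -> (K -> K) -> (H -> H)),
                [/\ directed le,
                    forall i, finite_dim_rep B (pil i) &
                    point_SOT_cvg B le pil pi]])).
Proof.
split; first exact: faithful_rep_exists.
move=> K rho rhoP B; split.
  by split; [exact: rho_calB_unital|exact: rho_calB_RFD].
exists (l2H R ('I_2 * nat)%type), (toep_rep rho); split.
- exact: toep_representation.
- by rewrite -(srep_unital rhoP) /toep_rep (lift_repE rhoP _ (@calB1 R)) toep1.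
- by case=> I [le [pil [D hfd hcv]]]; exact: (toep_rep_not_limit rhoP D hfd hcv).
Qed.
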